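(* Suppose that Assumptions (A1)–(A4) hold, and fix $\tau\in(0,\infty)$ and $T>0$. For each $\delta\in(0,\frac12)$ let $x^{\delta}=\{x^{k,\delta}\}_{k\ge0}$ be the pCN Markov chain at temperature $\tau$ with parameter $\delta$, started at a fixed position $x^{0,\delta}=x_*\in\mathcal{H}^s$. Assume that $x_*$ possesses a finite quadratic variation, $V(x_* )<\infty$. Let $$v^{\delta}(t)=\frac1\delta(t-t_k)\,V(x^{k+1,\delta})+\frac1\delta(t_{k+1}-t)\,V(x^{k,\delta})\quad\text{for }t_k\le t<t_{k+1},\qquad t_k=k\delta .$$ Then, as $\delta\to0$, $v^\delta$ converges in probability in $C([0,T],\mathbb{R})$ to the solution $v$ of the differential equation $$\dot v=-2(v-\tau),\qquad v(0)=V(x_* ).$$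
   Context: Spaces. $(\mathcal{H},\langle\cdot,\cdot\rangle,\|\cdot\|)$ is a separable Hilbert space, and $C$ is a positive, self-adjoint, trace-class operator on $\mathcal{H}$ with eigenpairs $C\phi_j=\lambda_j^2\phi_j$, $j\ge1$, where $\lambda_j>0$ and $\{\phi_j\}$ is an orthonormal basis of $\mathcal{H}$. For $r\in\mathbb{R}$, with $x_j=\langle x,\phi_j\rangle$, the space $\mathcal{H}^r$ has norm $\|x\|_r^2=\sum_j j^{2r}x_j^2$. The dual of $\mathcal{H}^s$ is identified with $\mathcal{H}^{-s}$ through the pairing $\langle\cdot,\cdot\rangle$, so that $\nabla\Psi(x)\in\mathcal{H}^{-s}$ and $\partial^2\Psi(x)\in\mathcal{L}(\mathcal{H}^s,\mathcal{H}^{-s})$ for $x\in\mathcal H^s$. Quadratic variation. For $x\in\mathcal{H}$ let $V_-(x)=\liminf_{N\to\infty}N^{-1}\sum_{j=1}^N\langle x,\phi_j\rangle^2/\lambda_j^2$ and $V_+(x)=\limsup_{N\to\infty}N^{-1}\sum_{j=1}^N\langle x,\phi_j\rangle^2/\lambda_j^2$. If these are equal, $x$ is said to possess a quadratic variation, $V(x)=V_-(x)=V_+(x)$. Assumptions ($\lesssim$ means $\le$ up to a multiplicative constant independent of the variables; $\asymp$ means both $\lesssim$ and $\gtrsim$). (A1) There is $\kappa>\frac12$ with $\lambda_j\asymp j^{-\kappa}$. (A2) There is $s\in[0,\kappa-\frac12)$ such that $\Psi$ is defined on $\mathcal{H}^s$ (this $s$ is fixed throughout). (A3) $\Psi:\mathcal{H}^s\to\mathbb{R}$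 satisfies $0\le\Psi(x)\lesssim1+\|x\|_s^2$. (A4) $\|\nabla\Psi(x)\|_{-s}\lesssim1+\|x\|_s$ and $\|\partial^2\Psi(x)\|_{\mathcal{L}(\mathcal{H}^s,\mathcal{H}^{-s})}\lesssim1$. pCN chain. Let $\{\xi^k\}_{k\ge0}$ be i.i.d. $\mathrm{N}(0,C)$ and $\{U^k\}_{k\ge0}$ i.i.d. uniform on $(0,1)$, all independent. For $x\in\mathcal{H}^s$ put $y=(1-2\delta)^{1/2}x+\sqrt{2\delta\tau}\,\xi$ and $\alpha^\delta(x,\xi)=1\wedge\exp\big(-\tau^{-1}(\Psi(y)-\Psi(x))\big)$. The chain is $$x^{k+1,\delta}=\gamma^{k,\delta}y^{k,\delta}+(1-\gamma^{k,\delta})x^{k,\delta},\quad y^{k,\delta}=(1-2\delta)^{1/2}x^{k,\delta}+\sqrt{2\delta\tau}\,\xi^k,\quad \gamma^{k,\delta}=\mathbf{1}_{\{U^k<\alpha^\delta(x^{k,\delta},\xi^k)\}}.$$ *)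

(* Defs.v *)
From HB Require Import structures.
From mathcomp Require Import all_boot all_order all_algebra.
From mathcomp Require Import all_classical all_reals all_analysis.
From mathcomp Require Import ring.

Set Implicit Arguments.
Unset Strict Implicit.
Unset Printing Implicit Defensive.

Import Order.TTheory GRing.Theory Num.Theory.
Import numFieldNormedType.Exports.
Local Open Scope classical_set_scope.
Local Open Scope ring_scope.

(* Sequences indexed by j >= 1 on paper are indexed by nat here, the entry at
   j standing for the (j + 1)-st one. *)

Section weighted_sequences.
Variables (R : realType) (r : R).

Definition hs_term (u : nat -> R) (j : nat) : R :=
  j.+1%:R `^ (2 * r) * u j ^+ 2.

Definition hs_mem : {pred nat -> R} :=
  fun u => `[< cvgn (series (hs_term u)) >].

(* Elements of H^r, given by their coordinates in the basis phi.  For r < 0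
   they need not come from elements of H. *)
Record hs : Type := Hs { hs_coord :> nat -> R ; _ : hs_coord \in hs_mem }.

Definition hs_norm (u : hs) : R := Num.sqrt (limn (series (hs_term u))).

Lemma hs_term_ge0 u j : 0 <= hs_term u j.
Proof. by rewrite /hs_term mulr_ge0 ?powR_ge0 ?sqr_ge0. Qed.

Lemma hs_termD (p q : R) u v j : 0 < p -> 0 < q ->
  hs_term (u + v) j <=
  (p + q) * (p^-1 * hs_term u j + q^-1 * hs_term v j).
Proof.
move=> p0 q0; rewrite /hs_term; set w := _ `^ _.
rewrite -subr_ge0.
have -> : (p + q) * (p^-1 * (w * u j ^+ 2) + q^-1 * (w * v j ^+ 2)) -
    w * (u + v) j ^+ 2 =
    w * ((p * q)^-1 * (q * u j - p * v j) ^+ 2).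
  have -> : (u + v) j = u j + v j by [].
  by field; rewrite !gt_eqF.
apply: mulr_ge0; first exact: powR_ge0.
by apply: mulr_ge0; rewrite ?sqr_ge0// invr_ge0 mulr_ge0// ltW.
Qed.

Lemma hs_termZ (a : R) u : hs_term (a *: u) = (fun j => a ^+ 2 * hs_term u j).
Proof.
apply/funext => j; rewrite /hs_term.
by have -> : (a *: u) j = a * u j by []; rewrite exprMn mulrCA.
Qed.

Lemma cvg_hs_comb (p q : R) u v : cvgn (series (hs_term u)) ->
    cvgn (series (hs_term v)) ->
  series (fun j => p * hs_term u j + q * hs_term v j) @ \oo -->
  p * limn (series (hs_term u)) + q * limn (series (hs_term v)).
Proof.
move=> cu cv.
have -> : series (fun j => p * hs_term u j + q * hs_term v j) =
    (fun n => p * series (hs_term u) n + q * series (hs_term v) n).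
  by apply/funext => n; rewrite /series /= big_split/= !mulr_sumr.
by apply: cvgD; apply: cvgMl_tmp.
Qed.

Lemma hs_memD u v : u \in hs_mem -> v \in hs_mem -> u + v \in hs_mem.
Proof.
move=> /asboolP cu /asboolP cv; apply/asboolP.
apply: (@series_le_cvg _ _ (fun j => 2 * hs_term u j + 2 * hs_term v j)).
- by move=> j; exact: hs_term_ge0.
- by move=> j; rewrite addr_ge0// mulr_ge0// hs_term_ge0.
- move=> j; apply: le_trans (@hs_termD 1 1 u v j ltr01 ltr01) _.
  by rewrite invr1 !mul1r mulrDr.
- by apply/cvg_ex; eexists; exact: cvg_hs_comb.
Qed.

Lemma hs_memZ (a : R) u : u \in hs_mem -> a *: u \in hs_mem.
Proof.
move=> /asboolP cu; apply/asboolP; rewrite hs_termZ.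
have -> : series (fun j => a ^+ 2 * hs_term u j) =
    (fun n => a ^+ 2 * series (hs_term u) n).
  by apply/funext => n; rewrite /series /= mulr_sumr.
by apply: is_cvgMl_tmp.
Qed.

Lemma hs_mem0 : 0 \in hs_mem.
Proof.
apply/asboolP; apply/cvg_ex; exists 0.
have -> : series (hs_term 0) = cst 0.
  apply/funext => n; rewrite /series /= big1// => j _.
  by rewrite /hs_term expr0n/= mulr0.
exact: cvg_cst.
Qed.

Lemma hs_submod_closed : submod_closed hs_mem.
Proof. by split=> [|a u v hu hv]; [exact: hs_mem0|rewrite hs_memD// hs_memZ]. Qed.

HB.instance Definition _ := GRing.isSubmodClosed.Build R (nat -> R) hs_mem
  hs_submod_closed.
HB.instance Definition _ := [isSub for hs_coord].
HB.instance Definition _ := [Choice of hs by <:].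
HB.instance Definition _ := [SubChoice_isSubLmodule of hs by <:].

Lemma hs_cvg (u : hs) : cvgn (series (hs_term u)).
Proof. by case: u => u /= /asboolP. Qed.

Lemma hs_term_le_lim (u : hs) j : hs_term u j <= limn (series (hs_term u)).
Proof.
have ndu : nondecreasing_seq (series (hs_term u)).
  by apply/nondecreasing_seqP => n; rewrite seriesSr lerDl hs_term_ge0.
apply: le_trans (nondecreasing_cvgn_le ndu (hs_cvg (u:=u)) j.+1).
rewrite seriesSr lerDr /series /=.
by apply: sumr_ge0 => i _; exact: hs_term_ge0.
Qed.

Lemma hs_lim_ge0 (u : hs) : 0 <= limn (series (hs_term u)).
Proof. exact: le_trans (hs_term_ge0 u 0) (hs_term_le_lim u 0). Qed.

Lemma hs_norm_sqr (u : hs) : hs_norm u ^+ 2 = limn (series (hs_term u)).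
Proof. by rewrite /hs_norm sqr_sqrtr// hs_lim_ge0. Qed.

Lemma hs_norm_eq0 (u : hs) : hs_norm u = 0 -> u = 0.
Proof.
move=> u0; apply/val_inj/funext => j /=.
have := hs_term_le_lim u j; rewrite -hs_norm_sqr u0 expr0n/= => tj.
have /eqP : hs_term u j = 0 by apply/eqP; rewrite eq_le tj hs_term_ge0.
by rewrite /hs_term mulf_eq0 sqrf_eq0 gt_eqF ?powR_gt0//= => /eqP.
Qed.

Lemma hs_normZ (a : R) (u : hs) : hs_norm (a *: u) = `|a| * hs_norm u.
Proof.
have -> : hs_norm (a *: u) = Num.sqrt (a ^+ 2 * limn (series (hs_term u))).
  rewrite /hs_norm; congr Num.sqrt.
  have -> : (a *: u : nat -> R) = a *: (u : nat -> R) by [].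
  rewrite hs_termZ; apply: cvg_lim => //.
  have -> : series (fun j => a ^+ 2 * hs_term u j) =
      (fun n => a ^+ 2 * series (hs_term u) n).
    by apply/funext => n; rewrite /series /= mulr_sumr.
  by apply: cvgMl_tmp; exact: hs_cvg.
by rewrite sqrtrM ?sqr_ge0// sqrtr_sqr.
Qed.

Lemma hs_normD (u v : hs) : hs_norm (u + v) <= hs_norm u + hs_norm v.
Proof.
have [->|/eqP u0] := pselect (u = 0).
  by rewrite add0r lerDr sqrtr_ge0.
have [->|/eqP v0] := pselect (v = 0).
  by rewrite addr0 lerDl sqrtr_ge0.
have pos (w : hs) : w != 0 -> 0 < hs_norm w.
  move=> w0; rewrite lt_def sqrtr_ge0 andbT.
  by apply: contra w0 => /eqP/hs_norm_eq0 ->.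
have p0 := pos _ u0; have q0 := pos _ v0.
rewrite -(@ler_pXn2r _ 2)// ?nnegrE ?addr_ge0 ?sqrtr_ge0// hs_norm_sqr.
set p := hs_norm u in p0 *; set q := hs_norm v in q0 *.
have cuv := @cvg_hs_comb ((p + q) * p^-1) ((p + q) * q^-1) u v
  (@hs_cvg u) (@hs_cvg v).
have -> : (p + q) ^+ 2 = (p + q) * p^-1 * limn (series (hs_term u)) +
   (p + q) * q^-1 * limn (series (hs_term v)).
  by rewrite -!hs_norm_sqr -/p -/q; field; rewrite !gt_eqF.
rewrite -(cvg_lim _ cuv)//; apply: ler_lim.
- exact: hs_cvg.
- by apply/cvg_ex; eexists; exact: cuv.
- near=> n; rewrite /series /=; apply: ler_sum => j _.
  by apply: le_trans (hs_termD u v j p0 q0) _; rewrite mulrDr !mulrA.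
Unshelve. all: by end_near. Qed.

HB.instance Definition _ := @Lmodule_isNormed.Build R hs hs_norm
  hs_normD hs_normZ hs_norm_eq0.

End weighted_sequences.

(* The pairing between H^r and H^(-r); the series converges absolutely. *)
Definition hs_pairing (R : realType) (r r' : R) (g : hs r) (h : hs r') : R :=
  limn (series (fun j => g j * h j)).

Section hilbert_space.
Variables (R : realType) (H : completeNormedModType R) (dot : {dot H for idfun}).

Definition hilbert_norm : Prop := forall x : H, `|x| ^+ 2 = dot x x.

(* The existence of such a phi makes H separable and infinite-dimensional. *)
Definition orthonormal_basis (phi : nat -> H) : Prop :=
  (forall i j, dot (phi i) (phi j) = (i == j)%:R) /\
  (forall x, series (fun j => dot x (phi j) *: phi j) @ \oo --> x).

Definition positive_selfadjoint (C : {linear H -> H}) : Prop :=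
  [/\ continuous C, forall x y, dot (C x) y = dot x (C y)
    & forall x, 0 <= dot (C x) x].

(* For a positive operator, being trace-class means that the trace, which does
   not depend on the orthonormal basis, is finite. *)
Definition trace_class (phi : nat -> H) (C : {linear H -> H}) : Prop :=
  cvgn (series (fun j => dot (C (phi j)) (phi j))).

Definition coords (phi : nat -> H) (x : H) : nat -> R :=
  fun j => dot x (phi j).

Definition in_hs (phi : nat -> H) (r : R) (x : H) : Prop :=
  coords phi x \in hs_mem r.

(* For r >= 0, the element of H^r with the coordinates of x.  It is used with
   x in H^r almost surely; the value 0 given to the other x is a dummy. *)
Definition to_hs (phi : nat -> H) (r : R) (x : H) : hs r :=
  insubd (0 : hs r) (coords phi x).

Definition qv_avg (phi : nat -> H) (lambda : nat -> R) (x : H) (n : nat) :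
    \bar R :=
  (n.+1%:R^-1 * \sum_(j < n.+1) dot x (phi j) ^+ 2 / lambda j ^+ 2)%:E.

Definition qv_inf phi lambda x : \bar R := limn_einf (qv_avg phi lambda x).
Definition qv_sup phi lambda x : \bar R := limn_esup (qv_avg phi lambda x).

Definition has_qv phi lambda x : Prop :=
  qv_inf phi lambda x = qv_sup phi lambda x.

(* Meaningful when has_qv holds and the value is finite. *)
Definition qv phi lambda x : R := fine (qv_sup phi lambda x).

Definition has_finite_qv phi lambda x : Prop :=
  has_qv phi lambda x /\ (qv_sup phi lambda x < +oo)%E.

End hilbert_space.

Definition asymp (R : realType) (u v : nat -> R) : Prop :=
  exists c1 c2 : R, [/\ 0 < c1, 0 < c2 &
    forall j, c1 * v j <= u j <= c2 * v j].

Section potential.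
Variables (R : realType) (s : R) (Psi : hs s -> R).

Definition is_gradient (grad : hs s -> hs (- s)) : Prop :=
  forall x, differentiable Psi x /\
    forall h, 'd Psi x h = hs_pairing (grad x) h.

Definition quadratic_growth : Prop :=
  exists M : R, forall x, 0 <= Psi x <= M * (1 + `|x| ^+ 2).

(* The second derivative of Psi at x is the derivative at x of its gradient,
   as a map from H^s to H^(-s). *)
Definition derivative_bounds (grad : hs s -> hs (- s)) : Prop :=
  [/\ is_gradient grad,
      forall x, differentiable grad x,
      exists M : R, forall x, `|grad x| <= M * (1 + `|x|)
    & exists M : R, forall x h, `|'d grad x h| <= M * `|h|].

End potential.

Definition borel (R : realType) (H : normedModType R) :=
  g_sigma_algebraType (@open H).

Section noise.
Context {d : measure_display} {Omega : measurableType d} {R : realType}.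
Variable P : probability Omega R.

Definition mutually_independent (I : choiceType) (F : I -> set_system Omega) :
    Prop :=
  forall (J : seq I) (E : I -> set Omega), uniq J ->
    (forall i, i \in J -> F i (E i)) ->
    P (\bigcap_(i in [set` J]) E i) = (\prod_(i <- J) P (E i))%E.

Definition centered_normal (v : R) : set R -> \bar R :=
  if v == 0 then \d_(0 : R) else normal_prob 0 (Num.sqrt v).

(* X is an H-valued random variable with law N(0, C). *)
Definition gaussian (H : completeNormedModType R) (dot : {dot H for idfun})
    (C : {linear H -> H}) (X : Omega -> H) : Prop :=
  measurable_fun setT (X : Omega -> borel H) /\
  forall (h : H) (A : set R), measurable A ->
    P [set w | A (dot (X w) h)] = centered_normal (dot (C h) h) A.

Definition uniform01 (U : Omega -> R) : Prop :=
  measurable_fun setT U /\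
  forall A : set R, measurable A ->
    P (U @^-1` A) = uniform_prob (@ltr01 R) A.

Definition noise_sigma (H : completeNormedModType R) (xi : nat -> Omega -> H)
    (U : nat -> Omega -> R) (i : nat + nat) : set_system Omega :=
  match i with
  | inl k => preimage_set_system setT (xi k : Omega -> borel H) measurable
  | inr k => preimage_set_system setT (U k) measurable
  end.

Definition pcn_noise (H : completeNormedModType R) (dot : {dot H for idfun})
    (C : {linear H -> H}) (xi : nat -> Omega -> H) (U : nat -> Omega -> R) :
    Prop :=
  [/\ forall k, gaussian dot C (xi k),
      forall k, uniform01 (U k)
    & mutually_independent (noise_sigma xi U)].

Definition unif_dist (T : R) (f g : R -> R) : \bar R :=
  ereal_sup [set `|f t - g t|%:E | t in `[0, T]].

(* Convergence in probability in C([0, T], R), as delta -> 0+, of the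
   processes X delta to the deterministic limit v. *)
Definition C_cvg_in_probability (T : R) (X : R -> Omega -> R -> R)
    (v : R -> R) : Prop :=
  (\forall delta \near 0^'+,
     (forall w, {within `[0, T], continuous (X delta w)}) /\
     (forall t, t \in `[0, T] -> measurable_fun setT (X delta ^~ t))) /\
  (forall eps : R, 0 < eps ->
     P [set w | (eps%:E < unif_dist T (X delta w) v)%E] @[delta --> 0^'+]
       --> 0%E).

End noise.

Section pcn.
Variables (R : realType) (H : completeNormedModType R) (dot : {dot H for idfun}).
Variables (phi : nat -> H) (lambda : nat -> R) (s : R) (Psi : hs s -> R).
Variables (tau delta : R).

Definition pcn_proposal (x xi : H) : H :=
  Num.sqrt (1 - 2 * delta) *: x + Num.sqrt (2 * delta * tau) *: xi.

Definition pcn_accept (x xi : H) : R :=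
  Num.min 1 (expR (- tau^-1 *
    (Psi (to_hs dot phi s (pcn_proposal x xi)) - Psi (to_hs dot phi s x)))).

Definition pcn_step (x xi : H) (u : R) : H :=
  let gamma : R := (u < pcn_accept x xi)%R%:R in
  gamma *: pcn_proposal x xi + (1 - gamma) *: x.

Fixpoint pcn_chain (x0 : H) (xi : nat -> H) (U : nat -> R) (k : nat) : H :=
  if k is k'.+1 then pcn_step (pcn_chain x0 xi U k') (xi k') (U k') else x0.

(* For t >= 0, k is the integer such that k * delta <= t < (k + 1) * delta. *)
Definition qv_interp (x : nat -> H) (t : R) : R :=
  let k := Num.truncn (t / delta) in
  delta^-1 * (t - k%:R * delta) * qv dot phi lambda (x k.+1) +
  delta^-1 * (k.+1%:R * delta - t) * qv dot phi lambda (x k).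

End pcn.

Definition ode_solution (R : realType) (T tau v0 : R) (v : R -> R) : Prop :=
  [/\ v 0 = v0, {within `[0, T], continuous v} &
      forall t, t \in `]0, T[ -> is_derive t 1 v (- 2 * (v t - tau))].

(* Main.v *)
From HB Require Import structures.
Require Import Defs.
From mathcomp Require Import all_boot all_order all_algebra.
From mathcomp Require Import all_classical all_reals all_analysis.
From mathcomp Require Import measurable_realfun ring lra.

Set Implicit Arguments.
Unset Strict Implicit.
Unset Printing Implicit Defensive.

Import Order.TTheory GRing.Theory Num.Theory.
Import numFieldNormedType.Exports.
Local Open Scope classical_set_scope.
Local Open Scope ring_scope.

(** The quadratic variation V_k of the k-th state of the chain can be computed
    exactly along almost every noise path.  A rejected step leaves it
    unchanged.  In an accepted step the state x becomes
    sqrt(1 - 2 delta) x + sqrt(2 delta tau) xi, where xi has quadratic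
    variation 1 by the strong law of large numbers and the averages of the
    normalised products x_j xi_j tend to 0, so that
    V_(k+1) - tau = (1 - 2 delta) (V_k - tau).  The cross terms raise no
    measurability issue although x depends on the earlier noises through the
    accept or reject decisions: x is a linear combination of the starting
    point and of finitely many earlier noises, and the quadratic covariation
    [has_qcov] is bilinear, so it is enough that the countably many pairs of
    these vectors have covariation 0 almost surely ([ae_qcov_xi],
    [ae_qcov_cst_xi], [ae_qcov_xi_xi], [chain_has_qcov]).  Therefore
    V_k - tau = (V_0 - tau) (1 - 2 delta) ^ n_k, with n_k the number of
    accepted steps among the first k ([ae_chain_qv]).

    The solution of the limit equation is tau + (V_0 - tau) exp(- 2 t)
    ([ode_solutionE]).  If every step were accepted, the chain would follow
    the Euler scheme of this equation; each rejection adds an error at most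
    2 delta |V_0 - tau|.  Hence the uniform distance on [0, T] is at most
    |V_0 - tau| (2 delta R + O(delta)), where R is the number of rejections
    among the first T / delta steps, roughly ([unif_dist_le]), and by Markov's
    inequality it remains to see that delta E[R] tends to 0: the probability
    of a rejection is O(sqrt delta), uniformly up to time T
    ([integral_rejected_le]).

    The bound on the gradient makes Psi locally Lipschitz with a constant of
    linear growth ([lipschitz_of_gradient]).  A proposal at distance
    O(sqrt delta |xi| + delta |x|) is then rejected with probability
    O(sqrt delta (1 + |x|) (1 + |xi|^2)) ([proposal_bounds]), the norms being
    those of H^s, and what is missing is a bound on E|x_k| that is uniform in
    k <= T / delta.  Rejections might bias increments of size sqrt delta, so
    the chain is compared with the one that is driven by the same noise and
    accepts every proposal: its moments are explicit
    ([integral_ref_nrm]), the difference of the two contracts when the chain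
    accepts, and grows by O(sqrt delta |xi_k| + delta |x_k|) when it
    rejects ([deviationS]).  The latter has probability O(sqrt delta), so the
    expected difference grows by a factor 1 + O(delta) in one step and stays
    bounded up to time T ([integral_deviation]).  Conditioning on the past is
    replaced by an integration in two stages ([past_indep_fubini]). *)

(** * Summation of powers and the spaces H^s *)

(** The telescoping bound behind the convergence of the series of powers.  The
    inequality 1 + x <= exp x is used twice: for the logarithm of
    (j + 1) / (j + 2), and for its multiple by - b. *)
Lemma powR_gap (R : realType) (b : R) (j : nat) : 0 < b ->
  b * j.+2%:R `^ (- (1 + b)) <= j.+1%:R `^ (- b) - j.+2%:R `^ (- b).
Proof.
move=> b0.
have c0 : 0 < j.+2%:R :> R by [].
have a0 : 0 < j.+1%:R :> R by [].
have -> : j.+2%:R `^ (- (1 + b)) = j.+2%:R^-1 * j.+2%:R `^ (- b) :> R.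
  rewrite opprD powRD; last by rewrite pnatr_eq0 implybT.
  by rewrite powR_inv1.
have -> : j.+1%:R `^ (- b) = (j.+1%:R / j.+2%:R) `^ (- b) * j.+2%:R `^ (- b) :> R.
  by rewrite -powRM ?divr_ge0// divfK ?gt_eqF.
rewrite -[X in _ <= _ - X]mul1r -mulrBl mulrA ler_wpM2r ?powR_ge0//.
rewrite /powR gt_eqF ?divr_gt0// lerBrDr.
have lnle : ln (j.+1%:R / j.+2%:R) <= - j.+2%:R^-1 :> R.
  have -> : j.+1%:R / j.+2%:R = 1 + (- j.+2%:R^-1) :> R.
    apply: (mulIf (lt0r_neq0 c0)); rewrite divfK ?lt0r_neq0//.
    by rewrite mulrDl mul1r mulNr mulVf ?lt0r_neq0// -(natr1 j.+1) addrK.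
  by apply: le_ln1Dx; rewrite ltrN2 invf_lt1// ltr1n.
apply: le_trans (expR_ge1Dx _).
by rewrite addrC lerD2l mulNr -mulrN ler_pM2l// lerNr.
Qed.

Lemma cvg_series_powR (R : realType) (b : R) : 0 < b ->
  cvgn (series (fun j => j.+1%:R `^ (- (1 + b)) : R)).
Proof.
move=> b0; apply: nondecreasing_is_cvgn.
  by apply/nondecreasing_seqP => n; rewrite seriesSr lerDl powR_ge0.
have bnd (n : nat) : series (fun j => j.+1%:R `^ (- (1 + b)) : R) n.+1 <=
    1 + b^-1 * (1 - n.+1%:R `^ (- b)).
  elim: n => [|n IH].
    by rewrite /series /= big_nat1 !powR1 subrr mulr0 addr0.
  rewrite seriesSr; apply: (le_trans (lerD IH (lexx _))).
  rewrite -addrA lerD2l -lerBrDl -mulrBr.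
  rewrite -[leLHS](mulKf (lt0r_neq0 b0)).
  rewrite ler_pM2l ?invr_gt0//; apply: le_trans (powR_gap n b0) _.
  lra.
exists (1 + b^-1) => _ [[|n] _ <-].
  by rewrite /series /= big_geq// addr_ge0// invr_ge0 ltW.
apply: le_trans (bnd n) _; rewrite lerD2l ler_piMr ?invr_ge0 ?(ltW b0)//.
Qed.

(** The terms are O(j ^ (2 s - 2 kappa)), and 2 s - 2 kappa < - 1. *)
Lemma hs_mem_asymp (R : realType) (lambda : nat -> R) (kappa s : R) :
  (forall j, 0 < lambda j) -> asymp lambda (fun j => j.+1%:R `^ (- kappa)) ->
  s < kappa - 1 / 2 -> lambda \in hs_mem s.
Proof.
move=> l0 [c1 [c2 [c10 c20 lc]]] sk; apply/asboolP.
have b0 : 0 < 2 * kappa - 2 * s - 1 by lra.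
apply: (@series_le_cvg _ _ (fun j => c2 ^+ 2 * j.+1%:R `^ (- (1 + (2 * kappa - 2 * s - 1))))).
- by move=> j; exact: hs_term_ge0.
- by move=> j; rewrite mulr_ge0 ?sqr_ge0 ?powR_ge0.
- move=> j; rewrite /hs_term; have /andP[_ lj] := lc j.
  have j0 : (j.+1%:R : R) != 0 by rewrite pnatr_eq0.
  have -> : - (1 + (2 * kappa - 2 * s - 1)) = 2 * s + (- kappa + - kappa) by ring.
  rewrite powRD ?j0 ?implybT// [leRHS]mulrCA; apply: ler_wpM2l; first exact: powR_ge0.
  rewrite powRD ?j0 ?implybT// -expr2 -exprMn.
  by apply: lerXn2r; rewrite ?nnegrE ?(ltW (l0 j))// mulr_ge0 ?powR_ge0// ltW.
- have := cvg_series_powR b0.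
  set u := fun j : nat => _; move=> cu.
  have -> : series (fun j : nat => c2 ^+ 2 * j.+1%:R `^ (- (1 + (2 * kappa - 2 * s - 1)))) =
     (fun n => c2 ^+ 2 * series u n).
    by apply/funext => n; rewrite /series /= mulr_sumr.
  exact: is_cvgMl_tmp.
Qed.

Section hs_norm_facts.
Variables (R : realType) (s : R).
Implicit Types u v : hs s.

Lemma normr_hs_sqr u : `|u| ^+ 2 = limn (series (hs_term s u)).
Proof. exact: hs_norm_sqr. Qed.

Lemma series_hs_term_le u n : series (hs_term s u) n <= `|u| ^+ 2.
Proof.
rewrite normr_hs_sqr; apply: nondecreasing_cvgn_le; last exact: hs_cvg.
by apply/nondecreasing_seqP => m; rewrite seriesSr lerDl hs_term_ge0.
Qed.

Lemma hs_norm_gt0 u : u != 0 -> 0 < `|u|.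
Proof. by rewrite normr_gt0. Qed.

End hs_norm_facts.

Section hs_facts.
Variables (R : realType) (s : R).
Implicit Types u v : hs s.

(** Young's inequality with a free parameter theta, from which the
    Cauchy-Schwarz inequality for the pairing follows by optimisation. *)
Lemma hs_term_pairing (g h : nat -> R) (theta : R) j : 0 < theta ->
  `|g j * h j| <= 2^-1 * (theta * hs_term (- s) g j + theta^-1 * hs_term s h j).
Proof.
move=> t0; rewrite /hs_term.
have w0 : 0 < j.+1%:R `^ (2 * s) :> R by rewrite powR_gt0.
have -> : j.+1%:R `^ (2 * - s) = (j.+1%:R `^ (2 * s))^-1 :> R.
  by rewrite mulrN powRN.
set w := _ `^ _ in w0 *.
have -> : 2^-1 * (theta * (w^-1 * g j ^+ 2) + theta^-1 * (w * h j ^+ 2)) =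
   (2 * theta * w)^-1 * ((theta * g j) ^+ 2 + (w * h j) ^+ 2).
  by field; rewrite !gt_eqF.
rewrite [leRHS]mulrC ler_pdivlMr ?mulr_gt0//.
have -> : `|g j * h j| * (2 * theta * w) = 2 * (`|theta * g j| * `|w * h j|).
  by rewrite !normrM (gtr0_norm t0) (gtr0_norm w0); ring.
rewrite -(real_normK (num_real (theta * g j))) -(real_normK (num_real (w * h j))).
set a := `|_|; set b := `|w * _|.
rewrite -subr_ge0.
have -> : a ^+ 2 + b ^+ 2 - 2 * (a * b) = (a - b) ^+ 2 by ring.
exact: sqr_ge0.
Qed.

Lemma ler_hs_pairing (g : hs (- s)) (h : hs s) : `|hs_pairing g h| <= `|g| * `|h|.
Proof.
have p0 (g' h' : nat -> R) : (forall j, g' j * h' j = 0) ->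
    limn (series (fun j => g' j * h' j)) = 0.
  move=> e; have -> : series (fun j => g' j * h' j) = cst 0.
    by apply/funext => n; rewrite /series /= big1.
  exact: lim_cst.
have [->|g0] := eqVneq g 0.
  by rewrite /hs_pairing p0 ?normr0 ?mul0r// => j; rewrite mul0r.
have [->|h0] := eqVneq h 0.
  by rewrite /hs_pairing p0 ?normr0 ?mulr0// => j; rewrite mulr0.
have g1 : 0 < `|g| := hs_norm_gt0 g0.
have h1 : 0 < `|h| := hs_norm_gt0 h0.
have bnd n : [normed series (fun j => g j * h j)] n <= `|g| * `|h|.
  (* theta = |h| / |g| balances the two sums *)
  apply: (@le_trans _ _ (2^-1 * (`|h| / `|g| * `|g| ^+ 2 +
      (`|h| / `|g|)^-1 * `|h| ^+ 2))); last first.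
    by rewrite le_eqVlt; apply/orP; left; apply/eqP; field; rewrite !gt_eqF.
  apply: (@le_trans _ _ (2^-1 * (`|h| / `|g| * series (hs_term (- s) g) n +
      (`|h| / `|g|)^-1 * series (hs_term s h) n))).
    rewrite /series /= !mulr_sumr -big_split/= mulr_sumr; apply: ler_sum => j _.
    by apply: hs_term_pairing; rewrite divr_gt0.
  rewrite ler_pM2l ?invr_gt0//; apply: lerD.
  - by rewrite ler_pM2l ?divr_gt0// series_hs_term_le.
  - by rewrite ler_pM2l ?invr_gt0 ?divr_gt0// series_hs_term_le.
have cvgs : cvgn [normed series (fun j => g j * h j)].
  apply: nondecreasing_is_cvgn.
    by apply/nondecreasing_seqP => n; rewrite /= [leRHS]seriesSr lerDl.
  by exists (`|g| * `|h|) => _ [n _ <-].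
have cvgp := normed_cvg cvgs.
rewrite /hs_pairing -lim_norm//; apply: limr_le; first exact: is_cvg_norm.
near=> n; apply: le_trans (bnd n); rewrite /series /=; exact: ler_norm_sum.
Unshelve. all: by end_near. Qed.

(** Mean value theorem along the segment from x to y, on which the norm is at
    most |x| + |y|. *)
Lemma lipschitz_of_gradient (Psi : hs s -> R) (grad : hs s -> hs (- s)) (M : R) :
  is_gradient Psi grad -> (forall x, `|grad x| <= M * (1 + `|x|)) ->
  forall x y, `|Psi y - Psi x| <= M * (1 + `|x| + `|y|) * `|y - x|.
Proof.
move=> dPsi gM x y.
have M0 : 0 <= M.
  have := gM 0; rewrite normr0 addr0 mulr1; exact: le_trans.
pose f (t : R) := Psi (x + t *: (y - x)).
pose df (t : R) := hs_pairing (grad (x + t *: (y - x))) (y - x).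
have isd (t : R) : is_derive t 1 f (df t).
  have [dp ep] := dPsi (x + t *: (y - x)).
  have := @diff_derivable _ _ _ _ _ (y - x) dp; have := deriveE (y - x) dp.
  rewrite ep /derivable /derive => E D.
  have fE : (fun h : R => h^-1 *: ((f \o shift t) (h *: (1 : R)) - f t)) =
      (fun h : R => h^-1 *: ((Psi \o shift (x + t *: (y - x))) (h *: (y - x))
         - Psi (x + t *: (y - x)))).
    apply/funext => h; congr (_ *: (_ - _)); rewrite /f/=; congr Psi.
    by rewrite [h *: 1]mulr1 scalerDl addrCA addrC.
  by split; [rewrite /derivable fE|rewrite /derive fE].
have fcont : continuous f.
  move=> t; apply: differentiable_continuous; apply/derivable1_diffP.
  by have [] := isd t.
have [c c01] := MVT_segment ler01 (fun t _ => isd t) (continuous_subspaceT fcont).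
rewrite /f scale1r scale0r addr0 [x + _]addrC subrK subr0 mulr1 => ->.
apply: le_trans (ler_hs_pairing _ _) _.
apply: ler_wpM2r => //; apply: le_trans (gM _) _; apply: ler_wpM2l => //.
rewrite -addrA lerD2l.
move: c01; rewrite in_itv/= => /andP[c0 c1].
have -> : x + c *: (y - x) = (1 - c) *: x + c *: y.
  by rewrite scalerBr scalerBl scale1r addrCA addrC.
apply: le_trans (ler_normD _ _) _; rewrite !normrZ !ger0_norm ?subr_ge0//.
by apply: lerD; rewrite ler_piMl// lerBlDr lerDl.
Qed.

Lemma hs_finite_mem (n : nat) (u : nat -> R) : (forall j, (n <= j)%N -> u j = 0) ->
  u \in hs_mem s.
Proof.
move=> u0; apply/asboolP; apply/cvg_ex; exists (series (hs_term s u) n).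
apply: cvg_near_cst.
near=> m.
rewrite /series /= (@big_cat_nat _ _ _ n)//=; last by near: m; exists n.
rewrite [X in _ + X]big_nat [X in _ + X]big1 ?addr0// => j /andP[nj _].
by rewrite /hs_term u0// expr0n mulr0.
Unshelve. all: by end_near. Qed.

(** A sequence with finite support lies in H^s, so insubd never falls back on
    its default 0. *)
Definition hs_unit (i : nat) : hs s :=
  insubd (0 : hs s) (fun j => (j == i)%:R).

Lemma hs_unitE i j : hs_unit i j = (j == i)%:R.
Proof.
rewrite /hs_unit -[LHS]/(val (insubd (0 : hs s) (fun j => (j == i)%:R)) j).
rewrite insubdK//; apply: (@hs_finite_mem i.+1) => k ik.
by rewrite gtn_eqF.
Qed.

Definition hs_trunc (a : nat -> R) (n : nat) : hs s :=
  \sum_(i < n) a i *: hs_unit i.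

Lemma hs_coordD u v j : (u + v) j = u j + v j. Proof. by []. Qed.
Lemma hs_coordZ (c : R) u j : (c *: u) j = c * u j. Proof. by []. Qed.
Lemma hs_truncE a n j : hs_trunc a n j = if (j < n)%N then a j else 0.
Proof.
rewrite /hs_trunc; elim: n => [|n IH]; first by rewrite big_ord0.
rewrite big_ord_recr hs_coordD IH hs_coordZ hs_unitE ltnS /=.
by case: ltngtP => [||->]; rewrite ?mulr0 ?mulr1 ?addr0 ?add0r.
Qed.

(** A continuous function on H^s is thus a limit of functions of finitely many
    coordinates, which is how its measurability is obtained. *)
Lemma cvg_hs_trunc u : hs_trunc u n @[n --> \oo] --> u.
Proof.
apply/cvgrPdist_le => e e0.
have tailE n : `|u - hs_trunc u n| ^+ 2 = `|u| ^+ 2 - series (hs_term s u) n.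
  rewrite !normr_hs_sqr; apply: cvg_lim => //.
  have : series (hs_term s u) m - series (hs_term s u) n @[m --> \oo] -->
      limn (series (hs_term s u)) - series (hs_term s u) n.
    by apply: cvgB; [exact: hs_cvg|exact: cvg_cst].
  apply: cvg_trans; apply: near_eq_cvg; near=> m.
  have nm : (n <= m)%N by near: m; exists n.
  rewrite sub_series_geq// /series /= [RHS](@big_cat_nat _ _ _ n)//=.
  rewrite [X in _ = X + _]big_nat [X in _ = X + _]big1 ?add0r; last first.
    move=> j /andP[_ jn]; have -> : hs_term s (u - hs_trunc u n) j = hs_term s (fun i => u i - hs_trunc u n i) j by [].
    by rewrite /hs_term hs_truncE jn subrr expr0n mulr0.
  rewrite [LHS]big_nat [RHS]big_nat; apply: eq_bigr => j /andP[nj _].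
  have -> : hs_term s (u - hs_trunc u n) j = hs_term s (fun i => u i - hs_trunc u n i) j by [].
  by rewrite /hs_term hs_truncE ltnNge nj subr0.
have /cvgrPdist_le/(_ (e ^+ 2)) : series (hs_term s u) n @[n --> \oo] --> `|u| ^+ 2.
  by rewrite normr_hs_sqr; exact: hs_cvg.
rewrite exprn_gt0// => /(_ isT); apply: filterS => n.
rewrite -tailE ger0_norm ?sqr_ge0// => h.
by rewrite -(@ler_pXn2r _ 2)// nnegrE// ltW.
Unshelve. all: by end_near. Qed.

End hs_facts.

(** * Measurability of the chain and of its quadratic variation *)

Section caratheodory.
Context d (T : measurableType d) (R : realType).

(** Replace X by its approximation floor((n + 1) X) / (n + 1), which takes
    countably many values, and let n tend to infinity. *)
Lemma measurable_fun_caratheodory (F : T -> R -> R) (X : T -> R) :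
  (forall a, measurable_fun setT (F^~ a)) -> (forall w, continuous (F w)) ->
  measurable_fun setT X -> measurable_fun setT (fun w => F w (X w)).
Proof.
move=> mF cF mX.
pose r (n : nat) (a : R) : R := (Num.floor (n.+1%:R * a))%:~R / n.+1%:R.
have rcvg a : r n a @[n --> \oo] --> a.
  apply/cvgrPdist_le => e e0; near=> n.
  have n0 : 0 < n.+1%:R :> R by [].
  rewrite /r -{1}(mulfK (lt0r_neq0 n0) a) -mulrBl normrM (gtr0_norm (_ : 0 < n.+1%:R^-1))//.
  rewrite ler_pdivrMr// (mulrC a); have /andP[h1 h2] := floor_itv (n.+1%:R * a).
  rewrite ger0_norm ?subr_ge0// lerBlDr; apply: (le_trans (ltW h2)).
  rewrite intrD addrC lerD2r -ler_pdivrMl//.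
  rewrite mulr1; apply: (@le_trans _ _ n%:R); last by rewrite ler_nat.
  by near: n; exact: nbhs_infty_ger.
apply: (@measurable_fun_cvg _ _ _ _ (fun n w => F w (r n (X w)))).
  move=> n _ B mB; rewrite setTI.
  have -> : (fun w => F w (r n (X w))) @^-1` B =
     \bigcup_(z : int) ([set w | X w \in `[z%:~R / n.+1%:R, (z + 1)%:~R / n.+1%:R[]
        `&` (F^~ (z%:~R / n.+1%:R)) @^-1` B).
    apply/seteqP; split=> w /=.
      move=> Bw; exists (Num.floor (n.+1%:R * X w)) => //; split => //=.
      rewrite in_itv/= ler_pdivrMr// ltr_pdivlMr// mulrC; exact: floor_itv.
    move=> [z _ [/=]]; rewrite in_itv/= ler_pdivrMr// ltr_pdivlMr// => hz.
    suff -> : r n (X w) = z%:~R / n.+1%:R by [].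
    rewrite /r; congr (_%:~R / _); apply/eqP.
    by rewrite floor_eq mulrC.
  apply: countable_bigcupT_measurable; first exact: countableP.
  move=> z; apply: measurableI.
    rewrite -[X in measurable X]setTI.
    exact: (mX measurableT _ (measurable_itv `[z%:~R / n.+1%:R, (z + 1)%:~R / n.+1%:R[)).
  by rewrite -[X in measurable X]setTI; apply: mF.
move=> w _; apply: (cvg_comp (fun n => r n (X w)) (F w)); first exact: rcvg.
exact: cF.
Unshelve. all: by end_near. Qed.

End caratheodory.

Section hs_esum.
Variables (R : realType) (s : R).

(** The squared norm of H^s as an extended real, infinite for sequences outside
    H^s: its expectation can be computed before membership is known, and its
    finiteness then gives membership. *)
Definition hs_esum (x : nat -> R) : \bar R :=
  (\sum_(0 <= j <oo) (hs_term s x j)%:E)%E.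

Lemma hs_esumE (x : nat -> R) :
  hs_esum x = limn (EFin \o series (hs_term s x)).
Proof.
rewrite /hs_esum; congr (limn _); apply/funext => n /=.
by rewrite /series /= sumEFin.
Qed.

Lemma hs_esum_ge0 x : (0 <= hs_esum x)%E.
Proof. by apply: nneseries_ge0 => j _ _; rewrite lee_fin hs_term_ge0. Qed.

Lemma hs_esum_norm (u : hs s) : hs_esum u = (`|u| ^+ 2)%:E.
Proof.
rewrite hs_esumE; apply: cvg_lim => //.
by rewrite normr_hs_sqr; apply: cvg_EFin; [exact: nearW|exact: hs_cvg].
Qed.

Lemma hs_memE (x : nat -> R) : (x \in hs_mem s) = (hs_esum x < +oo)%E.
Proof.
apply/idP/idP => [hx|h].
  have -> : x = Hs hx by [].
  by rewrite hs_esum_norm ltry.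
apply/asboolP; apply: nondecreasing_is_cvgn.
  by apply: nondecreasing_series => // *; exact: hs_term_ge0.
exists (fine (hs_esum x)) => _ [n _ <-].
rewrite -lee_fin fineK ?ge0_fin_numE ?hs_esum_ge0//.
rewrite /hs_esum /series/= -sumEFin; apply: nneseries_lim_ge => j _.
by rewrite lee_fin hs_term_ge0.
Qed.

End hs_esum.

Section hs_measurability.
Context d (T : measurableType d) (R : realType) (s : R).
Variable X : T -> nat -> R.
Hypothesis mX : forall j, measurable_fun setT (fun w => X w j).

Lemma measurable_hs_esum : measurable_fun setT (fun w => hs_esum s (X w)).
Proof.
apply: ge0_emeasurable_sum => [k w _ _|k _]; first by rewrite lee_fin hs_term_ge0.
apply/measurable_EFinP; apply: measurable_funM => //.
by apply: measurable_funX; exact: mX.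
Qed.

(** One coordinate is added at a time; the function is continuous in the new
    coordinate, so the Caratheodory lemma applies.  The shift c makes the
    induction go through. *)
Lemma measurable_hs_trunc (G : hs s -> R) n : continuous G ->
  measurable_fun setT (fun w => G (hs_trunc s (X w) n)).
Proof.
move=> cG.
suff: forall c, measurable_fun setT (fun w => G (c + hs_trunc s (X w) n)).
  move=> /(_ 0); apply: eq_measurable_fun => w _; by rewrite add0r.
elim: n => [|n IH] c.
  apply: (eq_measurable_fun (cst (G c))); last exact: measurable_cst.
  by move=> w _; rewrite /hs_trunc big_ord0 addr0.
apply: (eq_measurable_fun
    (fun w => G (c + X w n *: hs_unit s n + hs_trunc s (X w) n))).
  by move=> w _; rewrite /hs_trunc big_ord_recr/= -addrA [in RHS](addrC (\sum_(_ < _) _)).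
apply: (@measurable_fun_caratheodory _ _ _
    (fun w a => G (c + a *: hs_unit s n + hs_trunc s (X w) n))) => //.
move=> w a; apply: (@continuous_comp R (hs s) R
  (fun a => c + a *: hs_unit s n + hs_trunc s (X w) n) G); last exact: cG.
apply: cvgD; last exact: cvg_cst.
apply: cvgD; first exact: cvg_cst.
by apply: cvgZr_tmp; exact: cvg_id.
Qed.

Lemma measurable_insubd_hs (G : hs s -> R) : continuous G ->
  measurable_fun setT (fun w => G (insubd (0 : hs s) (X w))).
Proof.
move=> cG.
apply: (@measurable_fun_cvg _ _ _ _ (fun n w =>
  if (hs_esum s (X w) < +oo)%E then G (hs_trunc s (X w) n) else G 0)).
  move=> n; apply: measurable_fun_ifT; [|exact: measurable_hs_trunc|exact: measurable_cst].
  apply: measurable_fun_lte; [exact: measurable_hs_esum|exact: measurable_cst].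
move=> w _; have [h|h] := boolP (hs_esum s (X w) < +oo)%E; last first.
  rewrite (_ : insubd 0 (X w) = 0); first exact: cvg_cst.
  by apply: val_inj; rewrite val_insubd hs_memE (negbTE h).
set u := insubd _ _.
have -> : X w = u by rewrite -[RHS]/(val u) insubdK// hs_memE.
apply: (cvg_comp (fun n => hs_trunc s u n) G); first exact: cvg_hs_trunc.
exact: cG.
Qed.

End hs_measurability.

Section chain_measurability.
Context d (T : measurableType d) (R : realType) (H : completeNormedModType R)
  (dot : {dot H for idfun}).
Variables (phi : nat -> H) (lambda : nat -> R) (s : R) (Psi : hs s -> R).
Hypothesis cPsi : continuous Psi.

(** Measurability of all coordinates is stable under linear combinations with
    random coefficients, and suffices for every function of the chain below. *)
Definition measurable_coords (X : T -> H) : Prop :=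
  forall j, measurable_fun setT (fun w => dot (X w) (phi j)).

Lemma measurable_coords_cst x : measurable_coords (cst x).
Proof. by move=> j; exact: (measurable_cst (dot x (phi j))). Qed.

Lemma measurable_coordsD X Y : measurable_coords X -> measurable_coords Y ->
  measurable_coords (fun w => X w + Y w).
Proof.
move=> mX mY j.
apply: (eq_measurable_fun (fun w => dot (X w) (phi j) + dot (Y w) (phi j))).
  by move=> w _; rewrite linearDl.
by apply: measurable_funD.
Qed.

Lemma measurable_coordsZ (a : T -> R) X : measurable_fun setT a ->
  measurable_coords X -> measurable_coords (fun w => a w *: X w).
Proof.
move=> ma mX j.
apply: (eq_measurable_fun (fun w => a w * dot (X w) (phi j))).
  by move=> w _; rewrite linearZl_LR.
by apply: measurable_funM.
Qed.

Lemma measurable_to_hs (G : hs s -> R) X : continuous G ->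
  measurable_coords X -> measurable_fun setT (fun w => G (to_hs dot phi s (X w))).
Proof. by move=> cG mX; apply: (measurable_insubd_hs (X := fun w => coords dot phi (X w))). Qed.

Lemma measurable_proposal delta tau X Y : measurable_coords X ->
  measurable_coords Y ->
  measurable_coords (fun w => pcn_proposal tau delta (X w) (Y w)).
Proof.
by move=> mX mY; apply: measurable_coordsD; apply: measurable_coordsZ => //;
  exact: measurable_cst.
Qed.

Lemma measurable_accept delta tau X Y : measurable_coords X ->
  measurable_coords Y ->
  measurable_fun setT (fun w => pcn_accept dot phi Psi tau delta (X w) (Y w)).
Proof.
move=> mX mY; apply: measurable_funTS; apply: measurable_minr; first exact: measurable_cst.
apply: measurableT_comp => //; apply: measurable_funM; first exact: measurable_cst.
apply: measurable_funB; apply: measurable_to_hs => //.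
exact: measurable_proposal.
Qed.

Lemma measurable_step delta tau X Y U : measurable_coords X ->
  measurable_coords Y -> measurable_fun setT U ->
  measurable_coords (fun w => pcn_step dot phi Psi tau delta (X w) (Y w) (U w)).
Proof.
move=> mX mY mU.
have mg : measurable_fun setT (fun w =>
    ((U w < pcn_accept dot phi Psi tau delta (X w) (Y w))%R%:R : R)).
  apply: (eq_measurable_fun (fun w =>
      if U w < pcn_accept dot phi Psi tau delta (X w) (Y w) then 1 else 0 : R)).
    by move=> w _; case: ifP.
  apply: measurable_fun_ifT; [|exact: measurable_cst|exact: measurable_cst].
  by apply: measurable_fun_ltr => //; exact: measurable_accept.
apply: measurable_coordsD; apply: measurable_coordsZ => //.
  exact: measurable_proposal.
by apply: measurable_funB => //; exact: measurable_cst.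
Qed.

Lemma measurable_chain delta tau x0 (xi : nat -> T -> H) (U : nat -> T -> R) k :
  (forall i, (i < k)%N -> measurable_coords (xi i)) ->
  (forall i, (i < k)%N -> measurable_fun setT (U i)) ->
  measurable_coords (fun w => pcn_chain dot phi Psi tau delta x0 (xi ^~ w) (U ^~ w) k).
Proof.
elim: k => [|k IH] mxi mU; first exact: measurable_coords_cst.
apply: measurable_step; [|exact: mxi|exact: mU].
by apply: IH => i ik; [apply: mxi|apply: mU]; rewrite (ltn_trans ik).
Qed.

Lemma measurable_qv X : measurable_coords X ->
  measurable_fun setT (fun w => qv dot phi lambda (X w)).
Proof.
move=> mX; apply: measurableT_comp; first exact: fine_measurable.
apply: measurable_fun_limn_esup => n; apply/measurable_EFinP.
apply: measurable_funM; first exact: measurable_cst.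
apply: measurable_sum => j; apply: measurable_funM; last exact: measurable_cst.
by apply: measurable_funX; exact: mX.
Qed.

Lemma measurable_qv_interp delta (X : T -> nat -> H) t :
  (forall k, measurable_coords (X^~ k)) ->
  measurable_fun setT (fun w => qv_interp dot phi lambda delta (X w) t).
Proof.
move=> mX; apply: measurable_funD; apply: measurable_funM;
  [exact: measurable_cst| |exact: measurable_cst|]; exact: measurable_qv.
Qed.

End chain_measurability.

(** * Independence and freezing of the past *)

Section independence.
Context d (Omega : measurableType d) (R : realType) (P : probability Omega R).
Local Open Scope ereal_scope.

(** By independence the law of (X, Y) is the product of the two laws, to which
    Tonelli's theorem applies. *)
Lemma indep_fubini d1 d2 (T1 : measurableType d1) (T2 : measurableType d2)
    (X : Omega -> T1) (Y : Omega -> T2) (F : T1 * T2 -> \bar R) :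
  measurable_fun setT X -> measurable_fun setT Y ->
  (forall A B, measurable A -> measurable B ->
     P (X @^-1` A `&` Y @^-1` B) = P (X @^-1` A) * P (Y @^-1` B)) ->
  measurable_fun setT F -> (forall z, 0 <= F z) ->
  \int[P]_w F (X w, Y w) = \int[P]_w \int[P]_w' F (X w, Y w').
Proof.
move=> mX mY indXY mF F0.
pose X' : {mfun Omega >-> T1} := HB.pack X (isMeasurableFun.Build _ _ _ _ X mX).
pose Y' : {mfun Omega >-> T2} := HB.pack Y (isMeasurableFun.Build _ _ _ _ Y mY).
have mZ : measurable_fun setT (fun w => (X w, Y w)) by exact: measurable_fun_pair.
pose Z : {mfun Omega >-> (T1 * T2)%type} :=
  HB.pack (fun w => (X w, Y w)) (isMeasurableFun.Build _ _ _ _ _ mZ).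
transitivity (\int[distribution P Z]_z F z).
  by rewrite ge0_integral_distribution.
transitivity (\int[distribution P X' \x distribution P Y']_z F z).
  apply: eq_measure_integral => A mA _; apply/esym.
  apply: (@product_measure_unique _ _ _ _ _ (distribution P X')
    (distribution P Y') (distribution P Z)) => //.
rewrite fubini_tonelli1// ge0_integral_distribution//.
- by apply: eq_integral => w _ /=; rewrite /fubini_F ge0_integral_distribution//=;
    exact: measurable_fun_pair2.
- exact: measurable_fun_fubini_tonelli_F.
- by move=> x; apply: integral_ge0.
Qed.

Section block.
Variables (I : choiceType) (F : I -> set_system Omega).
Hypothesis Fsigma : forall i, sigma_algebra setT (F i).
Hypothesis Fmeas : forall i, F i `<=` measurable.
Hypothesis Findep : mutually_independent P F.

(** Finite intersections of events, one for each index: a pi-system that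
    generates the joint sigma-algebra of the family restricted to J. *)
Definition block (J : set I) : set_system Omega :=
  [set A | exists (s : seq I) (E : I -> set Omega),
     [/\ uniq s, forall i, i \in s -> J i /\ F i (E i)
       & A = \bigcap_(i in [set` s]) E i]].

Lemma F_T i : F i setT.
Proof.
have [h0 hD _] := Fsigma i; have := hD _ h0.
by rewrite setD0.
Qed.

Lemma F_I i A B : F i A -> F i B -> F i (A `&` B).
Proof.
have := Fsigma i; rewrite sigma_algebraP//; first by case=> _ _ _; exact.
Qed.

Lemma block_T J : block J setT.
Proof.
by exists [::], (fun=> setT); split => //; rewrite bigcap_seq big_nil.
Qed.

Lemma block_1 (J : set I) i A : J i -> F i A -> block J A.
Proof.
move=> Ji FA; exists [:: i], (fun=> A); split => //.
  by move=> j; rewrite inE => /eqP ->.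
by rewrite bigcap_seq big_seq1.
Qed.

Lemma block_I J : setI_closed (block J).
Proof.
move=> _ _ [s1 [E1 [u1 J1 ->]]] [s2 [E2 [u2 J2 ->]]].
exists (undup (s1 ++ s2)), (fun i =>
  (if i \in s1 then E1 i else setT) `&` (if i \in s2 then E2 i else setT)).
split; first exact: undup_uniq.
  move=> i; rewrite mem_undup mem_cat => /orP h; split.
    by case: h => [/J1[]|/J2[]].
  apply: F_I; [case: ifPn => [/J1[]//|_]|case: ifPn => [/J2[]//|_]];
    exact: F_T.
apply/seteqP; split => [w [h1 h2] i _|w h]; split.
- by case: ifPn => // i1; apply: h1.
- by case: ifPn => // i2; apply: h2.
- move=> i i1; have /= := h i; rewrite mem_undup mem_cat.
  by rewrite (i1 : i \in s1)/= => /(_ isT)[].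
- move=> i i2; have /= := h i; rewrite mem_undup mem_cat.
  by rewrite (i2 : i \in s2) orbT => /(_ isT)[].
Qed.

Lemma block_measurable J : block J `<=` measurable.
Proof.
move=> _ [s [E [us Js ->]]]; rewrite bigcap_seq.
rewrite big_seq; elim/big_ind : _ => //.
- by move=> A B mA mB; exact: measurableI.
- by move=> i /Js[_]; exact: Fmeas.
Qed.

Lemma sblock_measurable J : <<s block J>> `<=` measurable.
Proof.
apply: smallest_sub; last exact: block_measurable.
exact: sigma_algebra_measurable.
Qed.

Lemma block_indep (J : set I) i A B : ~ J i -> block J A -> F i B ->
  P (A `&` B) = P A * P B.
Proof.
move=> Ji [s [E [us Js ->]]] FB.
have is_ : i \notin s by apply/negP => /Js[].
pose E' j := if j == i then B else E j.
have E's j : j \in s -> E' j = E j.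
  by move=> js; rewrite /E'; case: eqP => // ji; rewrite -ji js in is_.
have := @Findep (i :: s) E'.
rewrite /= is_ us => /(_ isT) H.
have {}H : P (\bigcap_(i0 in [set` i :: s]) E' i0) = (\prod_(i0 <- i :: s) P (E' i0)).
  apply: H => j; rewrite inE => /orP[/eqP ->|js]; first by rewrite /E' eqxx.
  by rewrite E's//; case: (Js _ js).
have H2 : P (\bigcap_(i0 in [set` s]) E i0) = \prod_(i0 <- s) P (E i0).
  by apply: Findep => // j /Js[].
rewrite H2 muleC.
move: H; rewrite bigcap_seq !big_cons {1 3}/E' eqxx -bigcap_seq.
rewrite (eq_bigcapr E's) (eq_big_seq (fun j => P (E j))); last first.
  by move=> j js; rewrite E's.
by rewrite setIC.
Qed.

(** Both sides are finite measures in A that agree on the pi-system block J. *)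
Lemma sblock_indep (J : set I) i A B : ~ J i -> <<s block J>> A -> F i B ->
  P (A `&` B) = P A * P B.
Proof.
move=> Ji sA FB.
have mB := Fmeas FB.
have PB : P B \is a fin_num by rewrite fin_num_measure.
(* the right-hand side is the measure P scaled by the number P B *)
pose r : {nonneg R} := NngNum (fine_ge0 (measure_ge0 P B)).
have := @g_sigma_algebra_measure_unique d R Omega (block J)
  (@block_measurable J) (fun=> setT) (fun=> block_T J) _
  (mrestr P mB) (mscale r P) (@block_I J) _ _ A sA.
have rE C : mscale r P C = P C * P B by rewrite /mscale/= fineK// muleC.
rewrite -rE; apply.
- by rewrite bigcup_const//; exists 0%N.
- by move=> C bC; apply: etrans (esym (rE C)); exact: (block_indep Ji bC FB).
- move=> _; suff : P (setT `&` B) < +oo by [].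
  by rewrite setTI -ge0_fin_numE.
Qed.

(** Omega with the sigma-algebra generated by the indices in J.  The identity
    map from Omega to this type collects at once everything that depends on J,
    without a product space indexed by J. *)
Definition past (J : set I) := g_sigma_algebraType (block J).

(** Replaces conditioning on J: Y is integrated out first, with all that depends
    on J frozen. *)
Lemma past_indep_fubini (J : set I) i d2 (T2 : measurableType d2)
    (Y : Omega -> T2) (G : past J * T2 -> \bar R) : ~ J i ->
  (forall B, measurable B -> F i (Y @^-1` B)) ->
  measurable_fun setT G -> (forall z, 0 <= G z) ->
  \int[P]_w G (w, Y w) = \int[P]_w \int[P]_w' G (w, Y w').
Proof.
move=> Ji FY mG G0.
apply: (@indep_fubini _ _ (past J) T2 (fun w => w) Y) => //.
- by move=> _ A mA; rewrite setTI; have := @sblock_measurable J A mA.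
- by move=> _ B mB; rewrite setTI; apply: Fmeas; exact: FY.
- by move=> A B mA mB; apply: (sblock_indep Ji) => //; exact: FY.
Qed.

Lemma measurable_past (J : set I) i d2 (T2 : measurableType d2)
    (Y : Omega -> T2) : J i -> (forall B, measurable B -> F i (Y @^-1` B)) ->
  measurable_fun setT (Y : past J -> T2).
Proof.
move=> Ji FY _ B mB; rewrite setTI; apply: sub_sigma_algebra.
by apply: (block_1 Ji); exact: FY.
Qed.

Lemma past_measurable_fun (J : set I) d2 (T2 : measurableType d2)
    (f : Omega -> T2) : measurable_fun setT (f : past J -> T2) ->
  measurable_fun setT f.
Proof.
by move=> mf _ B mB; apply: (@sblock_measurable J); apply: mf.
Qed.

End block.
End independence.

Lemma borel_measurable_fun (R : realType) (H : normedModType R) (f : H -> R) :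
  continuous f -> measurable_fun setT (f : borel H -> R).
Proof.
move=> cf; apply: (@measurability _ _ (borel H) R setT f _ (RGenOInfty.measurableE R)) => _ [_ [a ->] <-].
rewrite setTI; apply: sub_sigma_algebra.
by apply: open_comp => [x _|]; [exact: cf|exact: interval_open].
Qed.

(** * Moments of the normal law *)

Section gauss_moments.
Variable R : realType.
Notation mu := (@lebesgue_measure R).

Section weight.
Variables (c : R).
Hypothesis c0 : 0 < c.

Definition gauss_weight (x : R) : R := expR (- (c * x ^+ 2)).
Let w := gauss_weight.

Lemma is_derive_gauss_weight (x : R) : is_derive x 1 w (- (2 * c * x) * w x).
Proof.
have d1 : is_derive x 1 (fun y : R => - (c * y ^+ 2)) (- (2 * c * x)).
  have -> : (fun y : R => - (c * y ^+ 2)) = - (c \*: ((@idfun R) ^+ 2)) by [].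
  apply: is_derive_eq; rewrite /GRing.scale/= expr1 mulr1; ring.
apply: is_derive_eq (is_derive1_comp (is_derive_expR _) d1) _.
by rewrite mulrC.
Qed.

Lemma continuous_gauss_weight : continuous w.
Proof.
move=> x; apply: differentiable_continuous; apply/derivable1_diffP.
by have [] := is_derive_gauss_weight x.
Qed.

Lemma continuous_moment k : continuous (fun x : R => x ^+ k * w x).
Proof.
move=> x; apply: cvgM; last exact: continuous_gauss_weight.
exact: exprn_continuous.
Qed.

Lemma is_derive_moment k (x : R) : is_derive x 1 (fun y => y ^+ k.+1 * w y)
  (k.+1%:R * (x ^+ k * w x) - 2 * c * (x ^+ k.+2 * w x)).
Proof.
have -> : (fun y : R => y ^+ k.+1 * w y) = (@idfun R) ^+ k.+1 * w.
  by rewrite mulrfctE exprfctE.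
have dX := is_deriveX k.+1 (is_derive_id x (1 : R)).
apply: is_derive_eq (is_deriveM dX (is_derive_gauss_weight x)) _.
rewrite exprfctE /GRing.scale/= !exprS; ring.
Qed.

(** Fundamental theorem of calculus for x ^ (k + 1) w(x) on [- a, a]. *)
Lemma integral_moment_step k (a : R) : 0 < a ->
  ((2 * c)%:E * \int[mu]_(x in `[(- a)%R, a]) (x ^+ k.+2 * w x)%:E =
   k.+1%:R%:E * \int[mu]_(x in `[(- a)%R, a]) (x ^+ k * w x)%:E -
   (a ^+ k.+1 * w a - (- a) ^+ k.+1 * w (- a))%:E)%E.
Proof.
move=> a0.
have int (l : R) k' : mu.-integrable `[- a, a] (EFin \o (fun x : R => l * (x ^+ k' * w x))).
  apply: continuous_compact_integrable; first exact: segment_compact.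
  apply: continuous_subspaceT => x; apply: cvgM; first exact: cvg_cst.
  exact: continuous_moment.
have int1 k' : mu.-integrable `[- a, a] (EFin \o (fun x : R => x ^+ k' * w x)).
  apply: continuous_compact_integrable; first exact: segment_compact.
  apply: continuous_subspaceT => x; exact: continuous_moment.
pose F (x : R) := x ^+ k.+1 * w x.
pose f (x : R) := k.+1%:R * (x ^+ k * w x) - 2 * c * (x ^+ k.+2 * w x).
have := @continuous_FTC2 _ f F (- a) a.
rewrite gtrN// => /(_ isT) FTC.
have cf : continuous f.
  by move=> x; apply: cvgB; apply: cvgM; (try exact: cvg_cst);
    exact: continuous_moment.
have FTC2 : (\int[mu]_(x in `[(- a)%R, a]) (f x)%:E = (F a)%:E - (F (- a))%:E)%E.
  apply: FTC; first exact: continuous_subspaceT.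
    split; [move=> x _; by have [] := is_derive_moment k x| |].
      apply: cvg_at_right_filter; exact: continuous_moment.
    apply: cvg_at_left_filter; exact: continuous_moment.
  move=> x _; rewrite derive1E; exact: (@derive_val _ _ _ _ _ _ _ (is_derive_moment k x)).
move: FTC2.
under eq_integral do rewrite EFinB.
rewrite (integralB_EFin _ (int _ _) (int _ _))//.
under eq_integral do rewrite EFinM.
rewrite (integralZl _ (int1 k))//.
under [X in (_ - X)%E]eq_integral do rewrite EFinM.
rewrite (integralZl _ (int1 k.+2))//.
have fin k' : (\int[mu]_(x in `[(- a)%R, a]) (x ^+ k' * w x)%:E)%E \is a fin_num.
  exact: (integrable_fin_num _ (int1 k')).
rewrite -/(F a) -/(F (- a)).
rewrite -(fineK (fin k)) -(fineK (fin k.+2)) -!EFinM -!EFinB => -[E].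
by congr (_%:E); rewrite -E; ring.
Qed.

(** The exponential series gives exp(c a^2) >= (c a^2) ^ (k + 1) / (k + 1)!,
    which beats a ^ (k + 1) by a factor a ^ (k + 1) >= a, up to a constant. *)
Lemma cvg_moment_boundary k :
  n.+1%:R ^+ k.+1 * w n.+1%:R - (- n.+1%:R) ^+ k.+1 * w (- n.+1%:R) @[n --> \oo] --> (0:R).
Proof.
have cv1 : n.+1%:R ^+ k.+1 * w n.+1%:R @[n --> \oo] --> (0 : R).
  pose C : R := k.+1`!%:R / c ^+ k.+1.
  apply: (@squeeze_cvgr _ _ _ _ (cst 0) (fun n => C * n.+1%:R^-1)); first last.
  - rewrite -[X in _ --> X](mulr0 C); apply: cvgMl_tmp; exact: cvg_harmonic.
  - exact: cvg_cst.
  - near=> n; have n0 : 0 < n.+1%:R :> R by [].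
    rewrite mulr_ge0 ?exprn_ge0 ?expR_ge0//= /w /gauss_weight expRN.
    rewrite -ler_pdivlMr ?invr_gt0 ?expR_gt0// invrK.
    have y0 : 0 <= c * n.+1%:R ^+ 2 :> R by rewrite mulr_ge0 ?sqr_ge0 ?(ltW c0).
    have h := expR_ge1Dxn k y0.
    have {}h : (c * n.+1%:R ^+ 2) ^+ k.+1 / k.+1`!%:R <= expR (c * n.+1%:R ^+ 2).
      by apply: le_trans h; rewrite lerDr.
    apply: (@le_trans _ _ (C * n.+1%:R^-1 * ((c * n.+1%:R ^+ 2) ^+ k.+1 / k.+1`!%:R))); last first.
      by rewrite ler_wpM2l// mulr_ge0// divr_ge0// exprn_ge0// ltW.
    have -> : C * n.+1%:R^-1 * ((c * n.+1%:R ^+ 2) ^+ k.+1 / k.+1`!%:R) =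
       n.+1%:R ^+ k.+1 * n.+1%:R ^+ k :> R.
      have f0 : k.+1`!%:R != 0 :> R by rewrite pnatr_eq0 -lt0n fact_gt0.
      have ck0 : c ^+ k.+1 != 0 by rewrite expf_neq0// gt_eqF.
      rewrite /C exprMn (expr2 n.+1%:R) exprMn [in RHS]exprS.
      move: (c ^+ k.+1) ck0 (k.+1`!%:R) f0 => ck ck0 f f0.
      rewrite !exprS; field; rewrite ck0 f0 !andbT; exact: lt0r_neq0.
    by rewrite ler_peMr ?exprn_ge0// exprn_ege1// ler1n.
rewrite -[X in _ --> X](subr0 0).
apply: cvgB => //.
have -> : (fun n => (- n.+1%:R) ^+ k.+1 * w (- n.+1%:R)) =
   (fun n => (-1) ^+ k.+1 * (n.+1%:R ^+ k.+1 * w n.+1%:R)) :> (nat -> R).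
  by apply/funext => n; rewrite mulrA -exprNn /w /gauss_weight sqrrN.
rewrite -[X in _ --> X](mulr0 ((-1) ^+ k.+1)); exact: cvgMl_tmp.
Unshelve. all: by end_near. Qed.

(** For even k the integrand is nonnegative, and monotone convergence applies. *)
Lemma cvg_integral_moment k : ~~ odd k ->
  (\int[mu]_(x in `[(- n.+1%:R)%R, n.+1%:R%R]) (x ^+ k * w x)%:E)%E @[n --> \oo] -->
  (\int[mu]_x (x ^+ k * w x)%:E)%E.
Proof.
move=> ek.
have -> : [set: R] = \bigcup_n `[- n.+1%:R, n.+1%:R]%classic.
  apply/esym; rewrite -subTset => x _ /=; exists (Num.truncn `|x|) => //=.
  rewrite in_itv/= -ler_norml; apply/ltW; exact: truncnS_gt.
apply: ge0_nondecreasing_set_cvg_integral => //.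
- apply/nondecreasing_seqP => n; apply/subsetPset => x /=.
  rewrite !in_itv/= -!ler_norml => /le_trans; apply; by rewrite ler_nat.
- move=> n; apply: measurable_funTS; apply/measurable_EFinP.
  by apply: continuous_measurable_fun => x; exact: continuous_moment.
- by move=> n x _; rewrite lee_fin mulr_ge0 ?expR_ge0// exprn_even_ge0.
Qed.

Lemma integral_moment_rec k : ~~ odd k ->
  (\int[mu]_x (x ^+ k * w x)%:E)%E \is a fin_num ->
  ((2 * c)%:E * \int[mu]_x (x ^+ k.+2 * w x)%:E =
   k.+1%:R%:E * \int[mu]_x (x ^+ k * w x)%:E)%E.
Proof.
move=> ek fk.
have ek2 : ~~ odd k.+2 by rewrite /= negbK.
have h1 := cvgeZl (isT : (2 * c)%:E \is a fin_num) (cvg_integral_moment ek2).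
rewrite -(cvg_lim _ h1)//; apply: cvg_lim => //.
have h2 := cvgeZl (isT : k.+1%:R%:E \is a fin_num) (cvg_integral_moment ek).
rewrite -[X in _ --> X]sube0.
rewrite (eq_cvg _ _ (fun n => integral_moment_step k (ltr0Sn R n))).
apply: cvgeB => //; first by rewrite fin_num_adde_defl.
by apply: cvg_EFin; [exact: nearW|exact: cvg_moment_boundary].
Qed.

End weight.

(** Integrals against the law are computed with its Radon-Nikodym density, which
    is almost everywhere the normal density because both give the same measure. *)
Lemma integral_normal_prob (m sigma : R) (f : R -> \bar R) : sigma != 0 ->
  measurable_fun setT f -> (forall x, 0 <= f x)%E ->
  (\int[normal_prob m sigma]_x f x =
   \int[mu]_x (f x * (normal_pdf m sigma x)%:E))%E.
Proof.
move=> s0 mf f0.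
have dom := normal_prob_dominates m sigma.
have mpdf : measurable_fun setT (fun x => (normal_pdf m sigma x)%:E).
  by apply/measurable_EFinP; exact: measurable_normal_pdf.
rewrite -(Radon_Nikodym_SigmaFinite.change_of_variables dom f0 measurableT mf).
have mRN := measurable_int _ (Radon_Nikodym_SigmaFinite.f_integrable dom).
apply: ge0_ae_eq_integral => //.
- exact: emeasurable_funM.
- exact: emeasurable_funM.
- by move=> x _; rewrite mule_ge0// Radon_Nikodym_SigmaFinite.f_ge0.
- by move=> x _; rewrite mule_ge0// lee_fin normal_pdf_ge0.
have : ae_eq mu setT (Radon_Nikodym_SigmaFinite.f (normal_prob m sigma) mu)
    (fun x => (normal_pdf m sigma x)%:E).
  apply: integral_ae_eq => //.
    exact: Radon_Nikodym_SigmaFinite.f_integrable.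
  move=> E _ mE; rewrite -(Radon_Nikodym_SigmaFinite.f_integral dom)//.
by apply: filterS => x /= /[apply] ->.
Qed.

Lemma normal_moment_rec (sigma : R) k : 0 < sigma -> ~~ odd k ->
  (\int[normal_prob 0 sigma]_x (x ^+ k)%:E)%E \is a fin_num ->
  (\int[normal_prob 0 sigma]_x (x ^+ k.+2)%:E =
   (sigma ^+ 2 * k.+1%:R)%:E * \int[normal_prob 0 sigma]_x (x ^+ k)%:E)%E.
Proof.
move=> s0 ek.
have sn0 : sigma != 0 by rewrite gt_eqF.
pose c := (2 * sigma ^+ 2)^-1.
have c0 : 0 < c by rewrite invr_gt0 mulr_gt0// exprn_gt0.
have E k' : ~~ odd k' -> (\int[normal_prob 0 sigma]_x (x ^+ k')%:E =
   (normal_peak sigma)%:E * \int[mu]_x (x ^+ k' * gauss_weight c x)%:E)%E.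
  move=> ek'; rewrite integral_normal_prob//.
  - rewrite -ge0_integralZl//=.
    + apply: eq_integral => x _; rewrite -!EFinM; congr (_%:E).
      rewrite normal_pdfE// /normal_fun /gauss_weight subr0 mulrCA; congr (_ * (_ * expR _)).
      by rewrite /c mulNr mulrC -mulr_natl.
    + apply/measurable_EFinP; apply: continuous_measurable_fun => x.
      exact: continuous_moment.
    + by move=> x _; rewrite lee_fin mulr_ge0 ?expR_ge0// exprn_even_ge0.
    + by rewrite lee_fin normal_peak_ge0.
  - by apply/measurable_EFinP; apply: continuous_measurable_fun => x; exact: exprn_continuous.
  - by move=> x; rewrite lee_fin exprn_even_ge0.
have pk0 := normal_peak_gt0 sn0.
rewrite !E//=; last by rewrite negbK.
move=> h.
have fk : (\int[mu]_x (x ^+ k * gauss_weight c x)%:E)%E \is a fin_num.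
  set I := (I in I \is a fin_num); set p := normal_peak sigma in pk0 h *.
  have -> : (I = (p^-1)%:E * (p%:E * I))%E.
    by rewrite muleA -EFinM mulVf ?mul1e// gt_eqF.
  exact: fin_numM.
have := integral_moment_rec c0 ek fk.
rewrite -(fineK fk) => rec.
have -> : (\int[mu]_x (x ^+ k.+2 * gauss_weight c x)%:E =
   ((sigma ^+ 2 * k.+1%:R) * fine (\int[mu]_x (x ^+ k * gauss_weight c x)%:E))%:E)%E.
  transitivity ((2 * c)^-1%:E * ((2 * c)%:E * \int[mu]_x (x ^+ k.+2 * gauss_weight c x)%:E))%E.
    by rewrite muleA -EFinM mulVf ?mul1e// gt_eqF// mulr_gt0.
  rewrite rec -!EFinM; congr (_%:E); rewrite /c; field.
  by rewrite sn0.
by rewrite -!EFinM; congr (_%:E); ring.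
Qed.

Lemma normal_moment2 (sigma : R) : 0 < sigma ->
  (\int[normal_prob 0 sigma]_x (x ^+ 2)%:E = (sigma ^+ 2)%:E)%E.
Proof.
move=> s0.
have E0 : (\int[normal_prob 0 sigma]_x (x ^+ 0)%:E = 1)%E.
  under eq_integral do rewrite expr0.
  rewrite integral_cst//= mul1e.
  exact: (@probability_setT _ _ _ (normal_prob 0 sigma)).
by rewrite normal_moment_rec ?E0// mule1 mulr1.
Qed.

Lemma normal_moment4 (sigma : R) : 0 < sigma ->
  (\int[normal_prob 0 sigma]_x (x ^+ 4)%:E = (3 * sigma ^+ 4)%:E)%E.
Proof.
move=> s0; rewrite normal_moment_rec ?normal_moment2// -EFinM; congr (_%:E); ring.
Qed.

End gauss_moments.

(** * Convergence of averages *)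

Section averages.
Variable R : realType.

Definition average (q : nat -> R) (n : nat) : R := n%:R^-1 * \sum_(j < n) q j.

Lemma averageD p q n : average (fun j => p j + q j) n = average p n + average q n.
Proof. by rewrite /average big_split/= mulrDr. Qed.

Lemma averageZ a q n : average (fun j => a * q j) n = a * average q n.
Proof. by rewrite /average -mulr_sumr mulrCA. Qed.

Lemma le_sum_lt (q : nat -> R) m n : (forall j, 0 <= q j) -> (m <= n)%N ->
  \sum_(j < m) q j <= \sum_(j < n) q j.
Proof.
move=> q0 mn; rewrite -(subnK mn) addnC big_split_ord/= lerDl.
by apply: sumr_ge0.
Qed.

(** Between two consecutive squares the sums are monotone and the lengths differ
    by a factor that tends to 1, so convergence along the squares is enough. *)
Lemma cvg_average_squares (q : nat -> R) (l : R) : (forall j, 0 <= q j) ->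
  average q (m.+1 ^ 2) @[m --> \oo] --> l -> average q n.+1 @[n --> \oo] --> l.
Proof.
move=> q0 cq.
(* r is the ratio of two consecutive squares *)
pose r (m : nat) : R := (m.+2%:R / m.+1%:R) ^+ 2.
have cr : r m @[m --> \oo] --> (1 : R).
  rewrite -[X in _ --> X](expr1n _ 2); apply: (cvg_comp _ (fun x : R => x ^+ 2)); last exact: exprn_continuous.
  have -> : (fun m => m.+2%:R / m.+1%:R) = (fun m => 1 + m.+1%:R^-1) :> (nat -> R).
    by apply/funext => m; rewrite -[m.+2%:R]natr1 mulrDl mul1r divff.
  suff : 1 + m.+1%:R^-1 @[m --> \oo] --> (1 + 0 : R) by rewrite addr0.
  by apply: cvgD; [exact: cvg_cst|exact: cvg_harmonic].
(* (k n).+1 is the integer part of the square root of n.+1 *)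
pose k (n : nat) : nat := (Num.truncn (Num.sqrt n.+1%:R : R)).-1.
have kP n : (((k n).+1 ^ 2 <= n.+1) && (n.+1 <= (k n).+2 ^ 2))%N.
  have s0 : 0 <= Num.sqrt n.+1%:R :> R by exact: sqrtr_ge0.
  have /andP[h1 h2] := truncn_itv s0.
  have t0 : (0 < Num.truncn (Num.sqrt n.+1%:R : R))%N.
    by rewrite truncn_gt0 -[X in X <= _]sqrtr1 ler_sqrt// ler1n.
  rewrite /k prednK// -(ler_nat R) -[X in _ && X](ler_nat R) !natrX.
  have e : (Num.sqrt n.+1%:R) ^+ 2 = n.+1%:R :> R by rewrite sqr_sqrtr.
  apply/andP; split.
    by rewrite -[leRHS]e ler_pXn2r// nnegrE.
  by rewrite -[leLHS]e ler_pXn2r// ?nnegrE// ltW.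
have koo : k n @[n --> \oo] --> \oo.
  apply/cvgnyPge => A; near=> n.
  rewrite leqNgt; apply/negP => kA.
  have /andP[_ h] := kP n.
  have : (n.+1 <= A.+1 ^ 2)%N by apply: leq_trans h _; rewrite leq_exp2r.
  by rewrite leqNgt ltnS => /negP; apply; near: n; exists (A.+1 ^ 2)%N.
apply: (@squeeze_cvgr _ _ _ _
    (fun n => average q ((k n).+1 ^ 2) / r (k n))
    (fun n => average q ((k n).+2 ^ 2) * r (k n))).
- apply: nearW => n; have /andP[h1 h2] := kP n.
  have kn0 : (k n).+1%:R != 0 :> R by [].
  have kn1 : (k n).+2%:R != 0 :> R by [].
  have n0 : 0 < n.+1%:R :> R by [].
  have S0 m : 0 <= \sum_(j < m) q j by apply: sumr_ge0.
  apply/andP; split.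
    have -> : average q ((k n).+1 ^ 2) / r (k n) =
        ((k n).+2%:R ^+ 2)^-1 * \sum_(j < (k n).+1 ^ 2) q j.
      rewrite /average /r natrX.
      by move: ((k n).+1%:R : R) ((k n).+2%:R : R) kn0 kn1 => a b a0 b0; field; rewrite a0 b0.
    apply: ler_pM => //; last exact: le_sum_lt.
    by rewrite lef_pV2 ?posrE ?exprn_gt0// -natrX ler_nat.
  have -> : average q ((k n).+2 ^ 2) * r (k n) =
      ((k n).+1%:R ^+ 2)^-1 * \sum_(j < (k n).+2 ^ 2) q j.
    rewrite /average /r natrX.
      by move: ((k n).+1%:R : R) ((k n).+2%:R : R) kn0 kn1 => a b a0 b0; field; rewrite a0 b0.
  apply: ler_pM => //; last exact: le_sum_lt.
  by rewrite lef_pV2 ?posrE ?exprn_gt0// -natrX ler_nat.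
- rewrite -[l]divr1; apply: cvgM.
    exact: (cvg_comp k (fun m => average q (m.+1 ^ 2)) koo cq).
  by apply: cvgV => //; exact: (cvg_comp k r koo cr).
- rewrite -[l]mulr1; apply: cvgM; last exact: (cvg_comp k r koo cr).
  have cq2 : average q (m.+2 ^ 2) @[m --> \oo] --> l.
    by move: cq; rewrite -(cvg_shiftS (fun m => average q (m.+1 ^ 2))).
  exact: (cvg_comp k (fun m => average q (m.+2 ^ 2)) koo cq2).
Unshelve. all: by end_near. Qed.

(** The sequence c + q is nonnegative, so convergence along the squares is enough
    for it, and q is subtracted afterwards. *)
Lemma cvg_average_dominated (c q : nat -> R) (l : R) :
  (forall j, `|c j| <= q j) -> average q n.+1 @[n --> \oo] --> l ->
  average c (m.+1 ^ 2) @[m --> \oo] --> (0 : R) ->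
  average c n.+1 @[n --> \oo] --> (0 : R).
Proof.
move=> cq cvq cvc.
have cvq2 : average q (m.+1 ^ 2) @[m --> \oo] --> l.
  have moo : ((m.+1 ^ 2).-1)%N @[m --> \oo] --> \oo.
    apply/cvgnyPge => A; near=> m.
    apply: (@leq_trans m); first by near: m; exists A.
    by rewrite -ltnS prednK ?expn_gt0// expnS expn1 leq_pmull.
  apply: cvg_trans (cvg_comp _ (fun n => average q n.+1) moo cvq).
  by apply: near_eq_cvg; apply: nearW => m; rewrite /comp prednK ?expn_gt0.
have cvs : average (fun j => c j + q j) n.+1 @[n --> \oo] --> l.
  apply: cvg_average_squares => [j|].
    by rewrite -lerBlDr sub0r; have := cq j; rewrite ler_norml => /andP[].
  under eq_fun do rewrite averageD.
  by rewrite -[l]add0r; exact: cvgD.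
have -> : (fun n => average c n.+1) =
    (fun n => average (fun j => c j + q j) n.+1 - average q n.+1).
  by apply/funext => n; rewrite averageD addrK.
by rewrite -(subrr l); exact: cvgB.
Unshelve. all: by end_near. Qed.

End averages.

Section almost_sure.
Context d (Omega : measurableType d) (R : realType) (P : probability Omega R).

Lemma ae_lty (f : Omega -> \bar R) : measurable_fun setT f ->
  (forall w, 0 <= f w)%E -> (\int[P]_w f w < +oo)%E ->
  {ae P, forall w, (f w < +oo)%E}.
Proof.
move=> mf f0 fi.
have fI : P.-integrable setT f.
  apply/integrableP; split => //.
  by under eq_integral do rewrite gee0_abs//.
have := integrable_ae measurableT fI.
by apply: filterS => w /(_ I); rewrite ge0_fin_numE.
Qed.

(** The sum of the expectations is finite, hence so is the sum of the variables
    almost surely, and its terms tend to 0. *)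
Lemma ae_cvg0 (Y : nat -> Omega -> R) (K : R) :
  (forall m, measurable_fun setT (Y m)) -> (forall m w, 0 <= Y m w) ->
  (forall m, \int[P]_w (Y m w)%:E <= (K * (m.+1%:R ^+ 2)^-1)%:E)%E ->
  {ae P, forall w, Y m w @[m --> \oo] --> (0 : R)}.
Proof.
move=> mY Y0 YK.
pose S w := (\sum_(0 <= m <oo) (Y m w)%:E)%E.
have mYE m : measurable_fun setT (fun w => (Y m w)%:E) by exact/measurable_EFinP.
have mS : measurable_fun setT S.
  by apply: ge0_emeasurable_sum => // m w _ _; rewrite lee_fin.
have Soo : (\int[P]_w S w < +oo)%E.
  rewrite /S integral_nneseries//; last by move=> m w _; rewrite lee_fin.
  have c2 : cvgn (series (fun m => m.+1%:R `^ (- (1 + 1)) : R)).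
    by apply: cvg_series_powR.
  have pE m : m.+1%:R `^ (- (1 + 1)) = (m.+1%:R ^+ 2)^-1 :> R.
    by rewrite -(natrD _ 1 1) powRN powR_mulrn.
  apply: (@le_lt_trans _ _ (\sum_(0 <= m <oo) (K * m.+1%:R `^ (- (1 + 1)))%:E)%E).
    apply: lee_nneseries => m _; last by rewrite pE.
    by move=> _; apply: integral_ge0 => w _; rewrite lee_fin.
  have K0 : 0 <= K.
    have h0 : (0 <= \int[P]_w (Y 0%N w)%:E)%E.
      by apply: integral_ge0 => w _; rewrite lee_fin.
    by have := le_trans h0 (YK 0%N); rewrite lee_fin expr1n invr1 mulr1.
  under eq_eseriesr do rewrite EFinM.
  rewrite nneseriesZl//.
  have -> : (\sum_(0 <= i <oo) (i.+1%:R `^ (- (1 + 1)))%:E =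
      (limn (series (fun m => m.+1%:R `^ (- (1 + 1)) : R)))%:E)%E.
    rewrite -EFin_lim//; congr (limn _); apply/funext => n /=.
    by rewrite /series/= sumEFin.
  by rewrite -EFinM ltry.
have S0 w : (0 <= S w)%E by apply: nneseries_ge0 => m _ _; rewrite lee_fin.
have := ae_lty mS S0 Soo.
apply: filterS => w Sw.
apply: cvg_series_cvg_0.
apply: nondecreasing_is_cvgn.
  by apply/nondecreasing_seqP => n; rewrite seriesSr lerDl.
exists (fine (S w)) => _ [n _ <-].
rewrite -lee_fin fineK ?ge0_fin_numE//.
rewrite /series/= -sumEFin; apply: nneseries_lim_ge => m _ _.
by rewrite lee_fin.
Qed.

(** A law of large numbers for terms of any sign.  The second moments give
    convergence along the squares, as their sum over squares is finite; the
    domination by q fills the gaps between squares. *)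
Lemma ae_average0 (c q : nat -> Omega -> R) (l K : R) :
  (forall j, measurable_fun setT (c j)) ->
  (forall j w, `|c j w| <= q j w) ->
  {ae P, forall w, average (q ^~ w) n.+1 @[n --> \oo] --> l} ->
  (forall n, \int[P]_w ((\sum_(j < n) c j w) ^+ 2)%:E <= (K * n%:R)%:E)%E ->
  {ae P, forall w, average (c ^~ w) n.+1 @[n --> \oo] --> (0 : R)}.
Proof.
move=> mc cq ql cK.
have : {ae P, forall w, (average (c ^~ w) (m.+1 ^ 2)) ^+ 2 @[m --> \oo] --> (0 : R)}.
  apply: (@ae_cvg0 _ K) => [m|m w|m].
  - apply: measurable_funX; apply: measurable_funM; first exact: measurable_cst.
    by apply: measurable_sum => j; exact: mc.
  - exact: sqr_ge0.
  - rewrite /average; under eq_integral do rewrite exprMn EFinM.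
    have mS : measurable_fun setT (fun w => ((\sum_(j < m.+1 ^ 2) c j w) ^+ 2)%:E).
      apply/measurable_EFinP; apply: measurable_funX.
      by apply: measurable_sum => j; exact: mc.
    rewrite ge0_integralZl_EFin//; last by move=> w _; rewrite lee_fin sqr_ge0.
    apply: (@le_trans _ _ (((m.+1 ^ 2)%:R^-1 ^+ 2)%:E * (K * (m.+1 ^ 2)%:R)%:E)%E).
      by apply: lee_wpmul2l => //; rewrite lee_fin sqr_ge0.
    rewrite -EFinM lee_fin natrX le_eqVlt; apply/orP; left; apply/eqP.
    by field; rewrite gt_eqF.
move: ql; apply: filterS2 => w qw cw.
apply: (cvg_average_dominated (cq ^~ w) qw).
apply/norm_cvg0P.
have : Num.sqrt (average (c^~ w) (m.+1 ^ 2) ^+ 2) @[m --> \oo] --> (0 : R).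
  by rewrite -sqrtr0; apply: (cvg_comp _ Num.sqrt cw); exact: sqrt_continuous.
by under eq_fun do rewrite sqrtr_sqr.
Qed.

End almost_sure.

(** * Gaussian variables in a Hilbert space *)

Lemma integral_prob_cst d (T : measurableType d) (R : realType)
    (P : probability T R) (r : R) : (\int[P]__ r%:E = r%:E)%E.
Proof.
rewrite integral_cst//= -[RHS]mule1; congr (_ * _)%E.
exact: probability_setT.
Qed.

Section hilbert.
Variables (R : realType) (H : completeNormedModType R) (dot : {dot H for idfun}).
Hypothesis hilb : hilbert_norm dot.

Lemma dotC x y : dot x y = dot y x.
Proof. by rewrite hermC expr0 mul1r. Qed.

Lemma dotDl x y z : dot (x + y) z = dot x z + dot y z.
Proof. exact: linearDl. Qed.

Lemma dotZl a x z : dot (a *: x) z = a * dot x z.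
Proof. exact: linearZl_LR. Qed.

Lemma dotDr x y z : dot z (x + y) = dot z x + dot z y.
Proof. by rewrite dotC dotDl !(dotC z). Qed.

Lemma dotZr a x z : dot z (a *: x) = a * dot z x.
Proof. by rewrite dotC dotZl (dotC z). Qed.

Lemma dot0r x : dot x 0 = 0.
Proof. by rewrite -(scale0r 0) dotZr mul0r. Qed.

Lemma dot_sumr I (s : seq I) (F : I -> H) x :
  dot x (\sum_(i <- s) F i) = \sum_(i <- s) dot x (F i).
Proof.
elim: s => [|i s IH]; first by rewrite !big_nil dot0r.
by rewrite !big_cons dotDr IH.
Qed.

(** Polarisation expresses the inner product through the norm. *)
Lemma continuous_dot h : continuous (fun x : H => dot x h).
Proof.
have -> : (fun x => dot x h) = (fun x : H => 4^-1 * (`|x + h| ^+ 2 - `|x - h| ^+ 2)).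
  apply/funext => x; rewrite !hilb -scaleN1r !(dotDl, dotDr, dotZl, dotZr) (dotC h x).
  by field.
move=> x; apply: cvgM; first exact: cvg_cst.
have cn (g : H -> H) : {for x, continuous g} ->
    `|g y| ^+ 2 @[y --> x] --> (`|g x| ^+ 2 : R).
  move=> cg; apply: (cvg_comp (fun y => `|g y|) (fun t : R => t ^+ 2)).
    by apply: (cvg_comp g (fun y : H => `|y|) cg); exact: norm_continuous.
  exact: exprn_continuous.
by apply: cvgB; apply: cn; [apply: cvgD|apply: cvgB] => //; exact: cvg_cst.
Qed.

Section gaussian.
Variables (C : {linear H -> H}) (phi : nat -> H) (lambda : nat -> R).
Hypothesis orth : forall i j, dot (phi i) (phi j) = (i == j)%:R.
Hypothesis lambda0 : forall j, 0 < lambda j.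
Hypothesis eigC : forall j, C (phi j) = lambda j ^+ 2 *: phi j.
Context d (Omega : measurableType d) (P : probability Omega R).
Variable X : Omega -> H.
Hypothesis gX : gaussian P dot C X.

Lemma measurable_dot h : measurable_fun setT (fun w => dot (X w) h).
Proof.
have [mX _] := gX.
have mb : measurable_fun setT ((fun x => dot x h) : borel H -> R).
  by apply: borel_measurable_fun; exact: continuous_dot.
exact: (measurableT_comp mb mX).
Qed.

Lemma gaussian_integral (h : H) (f : R -> \bar R) : 0 < dot (C h) h ->
  measurable_fun setT f -> (forall x, 0 <= f x)%E ->
  (\int[P]_w f (dot (X w) h) =
   \int[normal_prob 0 (Num.sqrt (dot (C h) h))]_x f x)%E.
Proof.
move=> v0 mf f0.
pose Y0 : Omega -> measurableTypeR R := fun w => dot (X w) h.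
have mY0 : measurable_fun setT Y0 := measurable_dot h.
pose Y : {mfun Omega >-> measurableTypeR R} :=
  HB.pack Y0 (isMeasurableFun.Build _ _ _ _ Y0 mY0).
transitivity (\int[distribution P Y]_x f x)%E.
  by rewrite ge0_integral_distribution.
apply: eq_measure_integral => A mA _.
have [_ /(_ h A mA)] := gX.
rewrite /centered_normal gt_eqF//.
Qed.

Lemma gaussian_moment2 h : 0 <= dot (C h) h ->
  (\int[P]_w (dot (X w) h ^+ 2)%:E = (dot (C h) h)%:E)%E.
Proof.
rewrite le_eqVlt => /predU1P[v0|v0].
  have [_ /(_ h [set~ 0])] := gX.
  have m0 : measurable [set~ (0:R)] by exact: measurableC.
  rewrite -v0 /centered_normal eqxx => /(_ m0).
  rewrite diracE memNset ?[X in _ = X -> _]/=; last by move=> /=; exact.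
  move=> PX0; rewrite -[RHS](integral0 P setT).
  apply: ge0_ae_eq_integral => //.
  - apply/measurable_EFinP; apply: measurable_funX; exact: measurable_dot.
  - by move=> w _; rewrite lee_fin sqr_ge0.
  exists [set w | [set~ 0] (dot (X w) h)]; split => //.
    rewrite -[X in measurable X]setTI; exact: (measurable_dot h).
  move=> w /= /not_implyP[_] h2 h0; apply: h2; by rewrite h0 expr0n.
rewrite (@gaussian_integral h (fun x => (x ^+ 2)%:E))//.
- by rewrite normal_moment2 ?sqrtr_gt0// sqr_sqrtr// ltW.
- by apply/measurable_EFinP; apply: continuous_measurable_fun => x; exact: exprn_continuous.
- by move=> x; rewrite lee_fin sqr_ge0.
Qed.

Lemma gaussian_moment4 h : 0 < dot (C h) h ->
  (\int[P]_w (dot (X w) h ^+ 4)%:E = (3 * dot (C h) h ^+ 2)%:E)%E.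
Proof.
move=> v0.
rewrite (@gaussian_integral h (fun x => (x ^+ 4)%:E))//.
- rewrite normal_moment4 ?sqrtr_gt0//; congr (_%:E); congr (_ * _).
  by rewrite (exprM _ 2 2) sqr_sqrtr// ltW.
- by apply/measurable_EFinP; apply: continuous_measurable_fun => x; exact: exprn_continuous.
- by move=> x; rewrite lee_fin exprn_even_ge0.
Qed.

(** For X of law N(0, C) these variables are independent standard normals; only
    their joint moments of order at most four enter below, and those are read
    off from the laws of inner products with suitable vectors. *)
Definition normalized j w : R := dot (X w) (phi j) / lambda j.
Local Notation eta := normalized.

Lemma measurable_normalized j : measurable_fun setT (eta j).
Proof. by apply: measurable_funM; [exact: measurable_dot|exact: measurable_cst]. Qed.

Let CZ a x : C (a *: x) = a *: C x. Proof. exact: linearZ. Qed.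
Let CD x y : C (x + y) = C x + C y. Proof. exact: linearD. Qed.

Lemma dotC_comb (n : nat) (b : nat -> R) :
  let h := \sum_(j < n) b j *: phi j in
  dot (C h) h = \sum_(j < n) b j ^+ 2 * lambda j ^+ 2.
Proof.
move=> h; rewrite {2}/h dot_sumr; apply: eq_bigr => j _.
rewrite dotZr expr2 -!mulrA; congr (_ * _).
rewrite /h linear_sum /= dotC dot_sumr (bigD1 j)//= big1 ?addr0.
  by rewrite CZ eigC !dotZr orth eqxx mulr1.
move=> i ij; rewrite CZ eigC !dotZr orth.
have -> : (val j == val i) = false by apply/negbTE; rewrite eq_sym.
by rewrite !mulr0.
Qed.

(** The combination is the inner product of X with one vector h, so its second
    moment is the value of the quadratic form of C at h. *)
Lemma gaussian_comb2 n (a : nat -> R) :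
  (\int[P]_w ((\sum_(j < n) a j * eta j w) ^+ 2)%:E = (\sum_(j < n) a j ^+ 2)%:E)%E.
Proof.
pose h := \sum_(j < n) (a j / lambda j) *: phi j.
have vh : dot (C h) h = \sum_(j < n) a j ^+ 2.
  rewrite (dotC_comb n (fun j => a j / lambda j)); apply: eq_bigr => j _.
  by rewrite exprMn exprVn mulfVK// expf_neq0// gt_eqF.
rewrite -vh -gaussian_moment2; last first.
  by rewrite vh; apply: sumr_ge0 => j _; exact: sqr_ge0.
apply: eq_integral => w _; congr ((_ ^+ 2)%:E).
rewrite /h dot_sumr; apply: eq_bigr => j _.
by rewrite dotZr /eta mulrA mulrAC.
Qed.

Lemma gaussian_pair4 i j (e : R) : i != j -> e ^+ 2 = 1 ->
  (\int[P]_w ((eta i w + e * eta j w) ^+ 4)%:E = 12%:E)%E.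
Proof.
move=> ij e2.
pose h := (lambda i)^-1 *: phi i + (e / lambda j) *: phi j.
have li : lambda i != 0 by rewrite gt_eqF.
have lj : lambda j != 0 by rewrite gt_eqF.
have vh : dot (C h) h = 2.
  rewrite /h CD !CZ !eigC !(dotDl, dotDr, dotZl, dotZr) !orth !eqxx.
  rewrite (negbTE ij) eq_sym (negbTE ij) /=.
  transitivity (1 + e ^+ 2); last by rewrite e2.
  by field; rewrite li lj.
have := @gaussian_moment4 h; rewrite vh => /(_ (ltr0Sn _ _)).
have -> : 3 * 2 ^+ 2 = 12 :> R by ring.
move=> <-; apply: eq_integral => w _; congr ((_ ^+ 4)%:E).
by rewrite /h dotDr !dotZr /eta; ring.
Qed.

Lemma normalized_moment4 j : (\int[P]_w (eta j w ^+ 4)%:E = 3%:E)%E.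
Proof.
have lj : lambda j != 0 by rewrite gt_eqF.
pose h := (lambda j)^-1 *: phi j.
have vh : dot (C h) h = 1.
  by rewrite /h CZ eigC !(dotZl, dotZr) orth eqxx/=; field.
have := @gaussian_moment4 h; rewrite vh => /(_ ltr01).
rewrite expr1n mulr1 => <-; apply: eq_integral => w _; congr ((_ ^+ 4)%:E).
by rewrite /h dotZr /eta mulrC.
Qed.

Lemma normalized_moment2 j : (\int[P]_w (eta j w ^+ 2)%:E = 1%:E)%E.
Proof.
have lj : lambda j != 0 by rewrite gt_eqF.
pose h := (lambda j)^-1 *: phi j.
have vh : dot (C h) h = 1.
  by rewrite /h CZ eigC !(dotZl, dotZr) orth eqxx/=; field.
have := @gaussian_moment2 h; rewrite vh => /(_ ler01) <-.
apply: eq_integral => w _; congr ((_ ^+ 2)%:E).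
by rewrite /h dotZr /eta mulrC.
Qed.

(** Polarisation: the sum and the difference of two such variables have variance
    2, hence fourth moment 12, and
    (a + b)^4 + (a - b)^4 = 2 a^4 + 2 b^4 + 12 a^2 b^2. *)
Lemma normalized_cross22 i j : i != j ->
  (\int[P]_w (eta i w ^+ 2 * eta j w ^+ 2)%:E = 1%:E)%E.
Proof.
move=> ij.
have mc4 k : measurable_fun setT (fun w => (eta k w ^+ 4)%:E).
  by apply/measurable_EFinP; apply: measurable_funX; exact: measurable_normalized.
have mX4 (e : R) : measurable_fun setT (fun w => ((eta i w + e * eta j w) ^+ 4)%:E).
  apply/measurable_EFinP; apply: measurable_funX; apply: measurable_funD.
    exact: measurable_normalized.
  by apply: measurable_funM; [exact: measurable_cst|exact: measurable_normalized].
have mcr : measurable_fun setT (fun w => (eta i w ^+ 2 * eta j w ^+ 2)%:E).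
  by apply/measurable_EFinP; apply: measurable_funM; apply: measurable_funX; exact: measurable_normalized.
have : (\int[P]_w (((eta i w + 1 * eta j w) ^+ 4)%:E + ((eta i w + (-1) * eta j w) ^+ 4)%:E) =
   \int[P]_w ((2%:E * (eta i w ^+ 4)%:E + 2%:E * (eta j w ^+ 4)%:E)
      + 12%:E * (eta i w ^+ 2 * eta j w ^+ 2)%:E))%E.
  by apply: eq_integral => w _; rewrite -!EFinM -!EFinD; congr (_%:E); ring.
have p4 (x : R) : (0 <= (x ^+ 4)%:E)%E by rewrite lee_fin exprn_even_ge0.
have p22 (x y : R) : (0 <= (x ^+ 2 * y ^+ 2)%:E)%E by rewrite lee_fin mulr_ge0// sqr_ge0.
rewrite ge0_integralD//; try by [].
rewrite !gaussian_pair4 ?sqrrN ?expr1n//.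
rewrite ge0_integralD//; last first.
  exact: measurable_funeM.
  by move=> w _; rewrite mule_ge0.
  by apply: emeasurable_funD; exact: measurable_funeM.
  by move=> w _; rewrite adde_ge0// mule_ge0.
rewrite ge0_integralD//; last first.
  exact: measurable_funeM.
  by move=> w _; rewrite mule_ge0.
  exact: measurable_funeM.
  by move=> w _; rewrite mule_ge0.
rewrite !ge0_integralZl_EFin// !normalized_moment4.
set I := (\int[P]_w _)%E.
have I0 : (0 <= I)%E by apply: integral_ge0 => w _.
move: I I0 => [r| |] I0 //=; last first.
  by rewrite -!EFinM -!EFinD gt0_muley ?lte_fin// addey.
rewrite -!EFinM -!EFinD => -[] E; congr (_%:E); lra.
Qed.

Let msq j : measurable_fun setT (fun w => (eta j w ^+ 2)%:E).
Proof. by apply/measurable_EFinP; apply: measurable_funX; exact: measurable_normalized. Qed.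

Let S n w := \sum_(j < n) eta j w ^+ 2.

Let mS n : measurable_fun setT (S n).
Proof.
by apply: measurable_sum => j; apply: measurable_funX; exact: measurable_normalized.
Qed.

Lemma integral_sum_normalized_sqr n : (\int[P]_w (S n w)%:E = n%:R%:E)%E.
Proof.
under eq_integral do rewrite /S -sumEFin.
rewrite ge0_integral_sum//; last by move=> j w _; rewrite lee_fin sqr_ge0.
under eq_bigr do rewrite normalized_moment2.
by rewrite sumEFin big_const iter_addr addr0 card_ord.
Qed.

Lemma integral_sqr_sum_normalized_sqr n :
  (\int[P]_w (S n w ^+ 2)%:E = (n%:R ^+ 2 + 2 * n%:R)%:E)%E.
Proof.
have m22 i j : measurable_fun setT (fun w => (eta i w ^+ 2 * eta j w ^+ 2)%:E).
  by apply/measurable_EFinP; apply: measurable_funM; apply: measurable_funX; exact: measurable_normalized.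
have p22 (x y : R) : (0 <= (x ^+ 2 * y ^+ 2)%:E)%E by rewrite lee_fin mulr_ge0// sqr_ge0.
transitivity (\sum_(i < n) \sum_(j < n) \int[P]_w (eta i w ^+ 2 * eta j w ^+ 2)%:E)%E.
  transitivity (\int[P]_w (\sum_(i < n) \sum_(j < n) (eta i w ^+ 2 * eta j w ^+ 2)%:E))%E.
    apply: eq_integral => w _; rewrite expr2 /S big_distrl/= -sumEFin.
    by apply: eq_bigr => i _; rewrite big_distrr/= sumEFin.
  rewrite ge0_integral_sum//.
  - apply: eq_bigr => i _; rewrite ge0_integral_sum//.
  - by move=> i; apply: emeasurable_sum => j.
  - by move=> i w _; apply: sume_ge0.
have E (i : 'I_n) : (\sum_(j < n) \int[P]_w (eta i w ^+ 2 * eta j w ^+ 2)%:E = (n%:R + 2)%:E)%E.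
  rewrite (bigD1 i)//=.
  have -> : (\int[P]_w (eta i w ^+ 2 * eta i w ^+ 2)%:E = 3%:E)%E.
    by rewrite -(normalized_moment4 i); apply: eq_integral => w _; rewrite -exprD.
  rewrite (eq_bigr (fun=> 1%:E)); last first.
    by move=> j ji; rewrite normalized_cross22// eq_sym.
  rewrite sumEFin -EFinD sumr_const; congr (_%:E).
  rewrite (_ : #|_| = n.-1); last first.
    by have := cardC1 i; rewrite card_ord => <-; apply: eq_card => j; rewrite !inE.
  have n0 : (0 < n)%N by exact: leq_ltn_trans (ltn_ord i).
  by rewrite -{2}(prednK n0) -natr1; ring.
rewrite (eq_bigr _ (fun i _ => E i)) sumEFin sumr_const card_ord -mulr_natl.
by congr (_%:E); ring.
Qed.

Lemma variance_sum_normalized_sqr n :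
  (\int[P]_w ((S n w - n%:R) ^+ 2)%:E = (2 * n%:R)%:E)%E.
Proof.
have m1 : measurable_fun setT (fun w => ((S n w - n%:R) ^+ 2)%:E).
  apply/measurable_EFinP; apply: measurable_funX; apply: measurable_funB.
    exact: mS.
  exact: measurable_cst.
have S0 w : 0 <= S n w by apply: sumr_ge0 => j _; exact: sqr_ge0.
have m2 : measurable_fun setT (fun w => (S n w)%:E) by exact/measurable_EFinP.
have m3 : measurable_fun setT (fun w => (S n w ^+ 2)%:E).
  by apply/measurable_EFinP; exact: measurable_funX.
have : (\int[P]_w (((S n w - n%:R) ^+ 2)%:E + (2 * n%:R)%:E * (S n w)%:E) =
   \int[P]_w ((S n w ^+ 2)%:E + (n%:R ^+ 2)%:E))%E.
  by apply: eq_integral => w _; rewrite -EFinM -!EFinD; congr (_%:E); ring.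
rewrite ge0_integralD//; first last.
  exact: measurable_funeM.
  by move=> w _; rewrite mule_ge0// lee_fin// mulr_ge0.
  by move=> w _; rewrite lee_fin sqr_ge0.
rewrite ge0_integralD//; last first.
  by move=> w _; rewrite lee_fin sqr_ge0.
rewrite ge0_integralZl_EFin//; last by move=> w _; rewrite lee_fin.
rewrite integral_sum_normalized_sqr integral_sqr_sum_normalized_sqr.
rewrite integral_prob_cst.
set I := (\int[P]_w _)%E.
have I0 : (0 <= I)%E by apply: integral_ge0 => w _; rewrite lee_fin sqr_ge0.
move: I I0 => [r| |] I0 //=.
by rewrite -EFinM -!EFinD => -[] E; congr (_%:E); lra.
Qed.

(** The variance of the sum of n squares is 2 n, so that the variances of the
    averages are summable along n = (m + 1)^2; the squares are nonnegative,
    which allows the passage to all n. *)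
Lemma ae_average_normalized_sqr :
  {ae P, forall w, average (fun j => eta j w ^+ 2) n.+1 @[n --> \oo] --> (1 : R)}.
Proof.
have : {ae P, forall w, (average (fun j => eta j w ^+ 2) (m.+1 ^ 2) - 1) ^+ 2
    @[m --> \oo] --> (0 : R)}.
  apply: (@ae_cvg0 _ _ _ _ _ 2) => [m|m w|m].
  - apply: measurable_funX; apply: measurable_funB; last exact: measurable_cst.
    by apply: measurable_funM; [exact: measurable_cst|exact: mS].
  - exact: sqr_ge0.
  - set n := (m.+1 ^ 2)%N.
    have n0 : n%:R != 0 :> R by rewrite /n natrX expf_neq0.
    under eq_integral.
      move=> w _.
      have -> : (average (fun j => eta j w ^+ 2) n - 1) ^+ 2 =
         (n%:R^-1) ^+ 2 * (S n w - n%:R) ^+ 2.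
        by rewrite /average -/(S n w); field.
      rewrite EFinM; over.
    have m1 : measurable_fun setT (fun w => ((S n w - n%:R) ^+ 2)%:E).
      apply/measurable_EFinP; apply: measurable_funX; apply: measurable_funB.
        exact: mS.
      exact: measurable_cst.
    rewrite ge0_integralZl_EFin//; last by move=> w _; rewrite lee_fin sqr_ge0.
    rewrite variance_sum_normalized_sqr -EFinM lee_fin le_eqVlt; apply/orP; left; apply/eqP.
    by move: n0; rewrite /n natrX; move: (m.+1%:R ^+ 2 : R) => a a0; field.
apply: filterS => w cw.
apply: cvg_average_squares => [j|]; first exact: sqr_ge0.
rewrite -subr_cvg0; apply/norm_cvg0P.
have : Num.sqrt ((average (fun j => eta j w ^+ 2) (m.+1 ^ 2) - 1) ^+ 2) @[m --> \oo] --> (0 : R).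
  by rewrite -sqrtr0; apply: (cvg_comp _ Num.sqrt cw); exact: sqrt_continuous.
by under eq_fun do rewrite sqrtr_sqr.
Qed.

End gaussian.
End hilbert.

(** * Quadratic covariation along the chain *)

Section quadratic_covariation.
Variables (R : realType) (H : completeNormedModType R) (dot : {dot H for idfun}).
Variables (phi : nat -> H) (lambda : nat -> R).

Definition qcov_term (x y : H) (j : nat) : R :=
  dot x (phi j) * dot y (phi j) / lambda j ^+ 2.

(** Polarised quadratic variation.  It is bilinear, and for a fixed noise path
    the decisions to accept or reject are mere scalars, so it can be followed
    along the chain. *)
Definition has_qcov (x y : H) (V : R) : Prop :=
  average (qcov_term x y) n.+1 @[n --> \oo] --> V.

Lemma has_qcovC x y V : has_qcov x y V -> has_qcov y x V.
Proof.
rewrite /has_qcov (_ : qcov_term y x = qcov_term x y)//.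
by apply/funext => j; rewrite /qcov_term (mulrC (dot y _)).
Qed.

Lemma has_qcov_combl a b x y z A B : has_qcov x z A -> has_qcov y z B ->
  has_qcov (a *: x + b *: y) z (a * A + b * B).
Proof.
move=> hx hy; rewrite /has_qcov.
have -> : qcov_term (a *: x + b *: y) z =
    (fun j => a * qcov_term x z j + b * qcov_term y z j).
  by apply/funext => j; rewrite /qcov_term dotDl !dotZl; ring.
under eq_fun do rewrite averageD !averageZ.
by apply: cvgD; apply: cvgMl_tmp.
Qed.

Lemma has_qcov_comb a b x y A B D : has_qcov x x A -> has_qcov y y B ->
  has_qcov x y D ->
  has_qcov (a *: x + b *: y) (a *: x + b *: y)
    (a ^+ 2 * A + b ^+ 2 * B + 2 * a * b * D).
Proof.
move=> hx hy hxy.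
have h1 := has_qcovC (has_qcov_combl (a := a) (b := b) hx (has_qcovC hxy)).
have h2 := has_qcovC (has_qcov_combl (a := a) (b := b) hxy hy).
have := has_qcov_combl (a := a) (b := b) h1 h2.
have -> : a * (a * A + b * D) + b * (a * D + b * B) =
  a ^+ 2 * A + b ^+ 2 * B + 2 * a * b * D by ring.
by [].
Qed.

Lemma qv_avgE x n : qv_avg dot phi lambda x n = (average (qcov_term x x) n.+1)%:E.
Proof.
rewrite /qv_avg /average; congr (_%:E); congr (_ * _).
Qed.

Lemma has_qcov_qv x V : has_qcov x x V ->
  has_finite_qv dot phi lambda x /\ qv dot phi lambda x = V.
Proof.
move=> hV.
have cV : qv_avg dot phi lambda x n @[n --> \oo] --> V%:E.
  under eq_fun do rewrite qv_avgE.
  by apply: cvg_EFin; [exact: nearW|].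
have [h1 h2] := cvg_limn_einf_sup cV.
rewrite /has_finite_qv /has_qv /qv /qv_inf /qv_sup h1 h2; split => //.
by split => //; rewrite ltry.
Qed.

(** The averages are nonnegative, so a common value of the lower and upper limits
    that is less than +oo is a real limit. *)
Lemma has_finite_qv_qcov x : has_finite_qv dot phi lambda x ->
  has_qcov x x (qv dot phi lambda x).
Proof.
rewrite /has_finite_qv /has_qv /qv /qv_inf /qv_sup => -[eqv fin].
set u := qv_avg dot phi lambda x in eqv fin *.
have u0 n : (0 <= u n)%E.
  rewrite lee_fin mulr_ge0// sumr_ge0// => j _.
  by rewrite mulr_ge0 ?sqr_ge0// invr_ge0 sqr_ge0.
have cu : u @ \oo --> limn_esup u.
  apply: (@squeeze_cvge _ _ _ _ (einfs u) _ (esups u)).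
  - apply: nearW => n; apply/andP; split.
      by apply: ereal_inf_lbound; exists n => /=.
    by apply: ereal_sup_ubound; exists n => /=.
  - by rewrite -eqv limn_einf_lim; exact: is_cvg_einfs.
  - by rewrite limn_esup_lim; exact: is_cvg_esups.
have f0 : (0 <= limn_esup u)%E.
  have <- := cvg_lim _ cu; last by [].
  by apply: lime_ge; [apply/cvg_ex; eexists; exact: cu|exact: nearW].
have ff : limn_esup u \is a fin_num by rewrite ge0_fin_numE.
move: cu; rewrite -(fineK ff) => /fine_cvg.
rewrite fineK//.
Qed.

End quadratic_covariation.

Section chain_qv.
Variables (R : realType) (H : completeNormedModType R) (dot : {dot H for idfun}).
Variables (phi : nat -> H) (lambda : nat -> R) (s : R) (Psi : hs s -> R).
Variables (tau delta V0 : R) (x0 : H) (xi : nat -> H) (U : nat -> R).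
Hypotheses (tau0 : 0 < tau) (delta0 : 0 < delta) (delta1 : delta < 2^-1).
Local Notation qcov := (has_qcov dot phi lambda).
Hypothesis qx0 : qcov x0 x0 V0.
Hypothesis qxi : forall k, qcov (xi k) (xi k) 1.
Hypothesis qx0xi : forall k, qcov x0 (xi k) 0.
Hypothesis qxixi : forall i k, (i < k)%N -> qcov (xi i) (xi k) 0.

Let x := pcn_chain dot phi Psi tau delta x0 xi U.

Definition accepted (k : nat) : bool :=
  U k < pcn_accept dot phi Psi tau delta (x k) (xi k).

Definition n_accepted (k : nat) : nat := \sum_(i < k) accepted i.

Lemma pcn_chainS k : x k.+1 =
  if accepted k then pcn_proposal tau delta (x k) (xi k) else x k.
Proof.
rewrite /x /= /pcn_step -/x -/(accepted k); case: accepted.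
  by rewrite scale1r subrr scale0r addr0.
by rewrite scale0r add0r subr0 scale1r.
Qed.

(** A statement about one noise path.  An accepted step maps V to
    (1 - 2 delta) V + 2 delta tau, a contraction towards tau by the factor
    1 - 2 delta.  The covariation 0 with all later noises is carried through the
    induction to dispose of the cross term. *)
Lemma chain_has_qcov k :
  qcov (x k) (x k) (tau + (V0 - tau) * (1 - 2 * delta) ^+ n_accepted k) /\
  forall l, (k <= l)%N -> qcov (x k) (xi l) 0.
Proof.
elim: k => [|k [IHv IHx]].
  split; last by move=> l _; exact: qx0xi.
  by rewrite /n_accepted big_ord0 expr0 mulr1 addrC subrK.
rewrite pcn_chainS /n_accepted big_ord_recr/= -/(n_accepted k).
case: ifPn => _; last first.
  by rewrite addn0; split => // l kl; apply: IHx; exact: ltnW.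
rewrite /pcn_proposal addn1; split; last first.
  move=> l kl; have := has_qcov_combl (a := Num.sqrt (1 - 2 * delta))
    (b := Num.sqrt (2 * delta * tau)) (IHx _ (ltnW kl)) (qxixi kl).
  by rewrite !mulr0 addr0.
have := has_qcov_comb (a := Num.sqrt (1 - 2 * delta))
    (b := Num.sqrt (2 * delta * tau)) IHv (qxi k) (IHx _ (leqnn k)).
rewrite !sqr_sqrtr; last 2 first.
- by rewrite mulr_ge0 ?(ltW tau0)// mulr_ge0 ?(ltW delta0).
- by rewrite subr_ge0 ltW// -ltr_pdivlMl// mulr1.
have e (p q r : R) : (1 - 2 * delta) * (tau + (V0 - tau) * p) +
    2 * delta * tau * 1 + 2 * q * r * 0 = tau + (V0 - tau) * ((1 - 2 * delta) * p).
  by ring.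
by rewrite e -exprS.
Qed.

End chain_qv.

(** * Quadratic covariations of the noise *)

Section noise_facts.
Variables (R : realType) (H : completeNormedModType R) (dot : {dot H for idfun}).
Hypothesis hilb : hilbert_norm dot.
Variables (C : {linear H -> H}) (phi : nat -> H) (lambda : nat -> R).
Hypothesis orth : forall i j, dot (phi i) (phi j) = (i == j)%:R.
Hypothesis lambda0 : forall j, 0 < lambda j.
Hypothesis eigC : forall j, C (phi j) = lambda j ^+ 2 *: phi j.
Context d (Omega : measurableType d) (P : probability Omega R).
Variables (xi : nat -> Omega -> H) (U : nat -> Omega -> R).
Hypothesis noise : pcn_noise P dot C xi U.
Local Notation F := (noise_sigma xi U).

Lemma noise_sigma_sigma i : sigma_algebra setT (F i).
Proof.
by case: i => k /=; apply: sigma_algebra_preimage; exact: sigma_algebra_measurable.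
Qed.

Lemma noise_sigma_measurable i : F i `<=` measurable.
Proof.
have [gxi uU _] := noise.
case: i => k /= _ [B mB <-].
  by have [mX _] := gxi k; exact: mX.
by have [mU _] := uU k; exact: mU.
Qed.

Lemma noise_sigma_xi k (B : set (borel H)) : measurable B -> F (inl k) (xi k @^-1` B).
Proof. by move=> mB; exists B => //; rewrite setTI. Qed.

Lemma noise_sigma_U k (B : set R) : measurable B -> F (inr k) (U k @^-1` B).
Proof. by move=> mB; exists B => //; rewrite setTI. Qed.

Definition noise_past (J : set (nat + nat)) := past F J.

Lemma noise_fubini (J : set (nat + nat)) i d2 (T2 : measurableType d2)
    (Y : Omega -> T2) (G : noise_past J * T2 -> \bar R) : ~ J i ->
  (forall B, measurable B -> F i (Y @^-1` B)) ->
  measurable_fun setT G -> (forall z, 0 <= G z)%E ->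
  (\int[P]_w G (w, Y w) = \int[P]_w \int[P]_w' G (w, Y w'))%E.
Proof.
have [_ _ ind] := noise.
exact: (past_indep_fubini noise_sigma_sigma noise_sigma_measurable ind).
Qed.

Lemma measurable_past_dot (J : set (nat + nat)) k h : J (inl k) ->
  measurable_fun setT ((fun w => dot (xi k w) h) : noise_past J -> R).
Proof.
move=> Jk.
have mb : measurable_fun setT ((fun x => dot x h) : borel H -> R).
  by apply: borel_measurable_fun; exact: continuous_dot.
apply: (measurableT_comp mb (_ : measurable_fun setT (xi k : noise_past J -> borel H))).
by apply: (measurable_past Jk); exact: noise_sigma_xi.
Qed.

Lemma measurable_past_U (J : set (nat + nat)) k : J (inr k) ->
  measurable_fun setT (U k : noise_past J -> R).
Proof. by move=> Jk; apply: (measurable_past Jk); exact: noise_sigma_U. Qed.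

Lemma measurable_borel_dot h : measurable_fun setT ((fun x => dot x h) : borel H -> R).
Proof. by apply: borel_measurable_fun; exact: continuous_dot. Qed.

Local Notation eta k := (normalized dot phi lambda (xi k)).

Lemma qcov_term_eta (y : H) k j w :
  qcov_term dot phi lambda y (xi k w) j = dot y (phi j) / lambda j * eta k j w.
Proof.
rewrite /qcov_term /normalized expr2; field; rewrite gt_eqF//.
Qed.

Lemma ae_qcov_xi k : {ae P, forall w, has_qcov dot phi lambda (xi k w) (xi k w) 1}.
Proof.
have [gxi _ _] := noise.
have := ae_average_normalized_sqr hilb orth lambda0 eigC (gxi k).
apply: filterS => w; rewrite /has_qcov (_ : qcov_term _ _ _ _ _ = fun j => eta k j w ^+ 2)//.
by apply/funext => j; rewrite qcov_term_eta /normalized expr2.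
Qed.

Lemma average_bounded (q : nat -> R) (l : R) : average q n.+1 @[n --> \oo] --> l ->
  exists K, forall n, \sum_(j < n) q j <= K * n%:R.
Proof.
move=> cq; have /cvg_seq_bounded[M [_ /(_ (M + 1))]] : cvgn (fun n => average q n.+1).
  by apply/cvg_ex; exists l.
rewrite ltrDl ltr01 => /(_ isT) bnd.
exists (M + 1) => -[|n]; first by rewrite big_ord0 mulr0.
have := bnd n I; rewrite /average => /(le_trans (ler_norm _)).
by rewrite ler_pdivrMl// mulrC.
Qed.

(** With a_j the coordinates of y divided by lambda_j, the terms are a_j eta_j.
    The second moment of a partial sum is the sum of the a_j^2, which grows
    linearly because y has a quadratic variation, and a_j^2 + eta_j^2 dominates. *)
Lemma ae_qcov_cst_xi (y : H) V k : has_qcov dot phi lambda y y V ->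
  {ae P, forall w, has_qcov dot phi lambda y (xi k w) 0}.
Proof.
move=> qy; have [gxi _ _] := noise.
pose a j := dot y (phi j) / lambda j.
have ya : average (fun j => a j ^+ 2) n.+1 @[n --> \oo] --> V.
  rewrite (_ : (fun j => a j ^+ 2) = qcov_term dot phi lambda y y)//.
  by apply/funext => j; rewrite /a /qcov_term exprMn exprVn expr2.
have [K aK] := average_bounded ya.
have := @ae_average0 _ _ _ P (fun j w => a j * eta k j w)
  (fun j w => a j ^+ 2 + eta k j w ^+ 2) (V + 1) K.
move=> LLN; have cvg0 : {ae P, forall w, average (fun j => a j * eta k j w) n.+1 @[n --> \oo] --> (0 : R)}.
  apply: LLN.
  - by move=> j; apply: measurable_funM; [exact: measurable_cst|apply: measurable_normalized => //; exact: gxi].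
  - move=> j w; rewrite normrM; set u := a j; set v := eta k j w.
    rewrite -(real_normK (num_real u)) -(real_normK (num_real v)).
    have := sqr_ge0 (`|u| - `|v|); have := normr_ge0 u; have := normr_ge0 v; nra.
  - have := ae_average_normalized_sqr hilb orth lambda0 eigC (gxi k).
    apply: filterS => w hw.
    under eq_fun do rewrite averageD.
    exact: cvgD.
  - move=> n; rewrite (gaussian_comb2 hilb orth lambda0 eigC (gxi k)) lee_fin.
    exact: aK.
apply: filterS cvg0 => w; rewrite /has_qcov (_ : qcov_term _ _ _ _ _ = fun j => a j * eta k j w)//.
by apply/funext => j; rewrite qcov_term_eta.
Qed.

(** Integrating over xi_k first, as for a constant vector, and then over xi_i,
    the second moment of the sum of the first n terms is n. *)
Lemma ae_qcov_xi_xi i k : i != k ->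
  {ae P, forall w, has_qcov dot phi lambda (xi i w) (xi k w) 0}.
Proof.
move=> ik; have [gxi _ _] := noise.
have cvg0 : {ae P, forall w, average (fun j => eta i j w * eta k j w) n.+1 @[n --> \oo] --> (0 : R)}.
  apply: (@ae_average0 _ _ _ P (fun j w => eta i j w * eta k j w)
    (fun j w => eta i j w ^+ 2 + eta k j w ^+ 2) (1 + 1) 1).
  - by move=> j; apply: measurable_funM; apply: measurable_normalized => //; exact: gxi.
  - move=> j w; rewrite normrM; set u := eta i j w; set v := eta k j w.
    rewrite -(real_normK (num_real u)) -(real_normK (num_real v)).
    have := sqr_ge0 (`|u| - `|v|); have := normr_ge0 u; have := normr_ge0 v; nra.
  - have := ae_average_normalized_sqr hilb orth lambda0 eigC (gxi k).
    apply: filterS2 (ae_average_normalized_sqr hilb orth lambda0 eigC (gxi i)) => w hi hk.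
    under eq_fun do rewrite averageD.
    exact: cvgD.
  - move=> n; rewrite mul1r.
    pose J : set (nat + nat) := [set inl i].
    pose G (z : noise_past J * borel H) : \bar R :=
      ((\sum_(j < n) eta i j z.1 * (dot z.2 (phi j) / lambda j)) ^+ 2)%:E.
    have mG : measurable_fun setT G.
      apply/measurable_EFinP; apply: measurable_funX; apply: measurable_sum => j.
      apply: measurable_funM; apply: measurable_funM; try exact: measurable_cst.
        apply: (measurableT_comp (f := fun w : noise_past J => dot (xi i w) (phi j))) => //.
        exact: measurable_past_dot.
      apply: (measurableT_comp (f := fun x : borel H => dot x (phi j))) => //.
      exact: measurable_borel_dot.
    have Jk : ~ J (inl k) by rewrite /J /= => -[] /esym /eqP; rewrite (negbTE ik).
    have G0 z : (0 <= G z)%E by rewrite lee_fin sqr_ge0.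
    have := noise_fubini Jk (@noise_sigma_xi k) mG G0.
    rewrite {1}/G /= => ->.
    under eq_integral => w _.
      rewrite (gaussian_comb2 hilb orth lambda0 eigC (gxi k) n (fun j => eta i j w)).
      over.
    by rewrite (integral_sum_normalized_sqr hilb orth lambda0 eigC (gxi i)).
apply: filterS cvg0 => w; rewrite /has_qcov (_ : qcov_term _ _ _ _ _ = fun j => eta i j w * eta k j w)//.
by apply/funext => j; rewrite qcov_term_eta.
Qed.

End noise_facts.

(** * Probability and cost of a rejection *)

Section rejection_bound.
Variable R : realType.

(** An explicit value for the constant of rejection_bound; what matters is that
    it depends neither on t nor on N nor on X. *)
Definition rejection_cst (m b : R) : R :=
  4 * (1 + m * (2 + b) ^+ 2) ^+ 2 * (1 + b) + 2.

Lemma rejection_cst_ge0 m b : 0 <= m -> 0 <= b -> 0 <= rejection_cst m b.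
Proof.
move=> m0 b0; rewrite /rejection_cst addr_ge0// mulr_ge0 ?addr_ge0//.
by rewrite mulr_ge0// sqr_ge0.
Qed.

(** In the application t = sqrt delta, N and X are the norms of the state and of
    the noise, and r is the probability of rejection.  The hypothesis is
    quadratic in N, and r <= 1 brings it down to a bound linear in N, which is
    what a Gronwall argument tolerates.  The second conclusion bounds the mean
    displacement lost by a rejection: both factors are of order t, so it is of
    order t^2 = delta. *)
Lemma rejection_bound (m b t N X r : R) : 0 <= m -> 0 <= b -> 0 <= t <= 1 ->
  0 <= N -> 0 <= X -> 0 <= r <= 1 ->
  r <= m * ((1 + 2 * N + t * b * X) * (2 * t ^+ 2 * N + t * b * X)) ->
  r <= rejection_cst m b * (t * ((1 + N) * (1 + X ^+ 2))) /\
  (t * b * X + 2 * t ^+ 2 * N) * r <=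
    rejection_cst m b * (t ^+ 2 * ((1 + N) * (1 + X ^+ 2))).
Proof.
move=> m0 b0 /andP[t0 t1] N0 X0 /andP[r0 r1] rle.
pose B := 2 + b; pose mu := 1 + m * B ^+ 2; pose L := 1 + N.
have B0 : 0 <= B by rewrite addr_ge0.
have mB0 : 0 <= m * B ^+ 2 by rewrite mulr_ge0// sqr_ge0.
have mu1 : 1 <= mu by rewrite lerDl.
have mu0 : 0 <= mu by exact: le_trans mu1.
have L1 : 1 <= L by rewrite lerDl.
have L0 : 0 <= L by exact: le_trans L1.
have tX0 : 0 <= t * X by exact: mulr_ge0.
have h1 : 1 + 2 * N + t * b * X <= B * (L + t * X).
  rewrite /B /L -subr_ge0.
  have -> : (2 + b) * (1 + N + t * X) - (1 + 2 * N + t * b * X) =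
     1 + b + b * N + 2 * (t * X) by ring.
  by rewrite !addr_ge0// mulr_ge0.
have h2 : 2 * t ^+ 2 * N + t * b * X <= B * (t ^+ 2 * L + t * X).
  rewrite /B /L -subr_ge0.
  have -> : (2 + b) * (t ^+ 2 * (1 + N) + t * X) - (2 * t ^+ 2 * N + t * b * X) =
     2 * t ^+ 2 + b * t ^+ 2 + b * t ^+ 2 * N + 2 * (t * X) by ring.
  by rewrite !addr_ge0// ?mulr_ge0 ?sqr_ge0.
have h3 : r <= mu ^+ 2 * ((t * (L + X)) ^+ 2 + 2 * t * (L * X)).
  apply: (le_trans rle).
  apply: (@le_trans _ _ (m * ((B * (L + t * X)) * (B * (t ^+ 2 * L + t * X))))).
    apply: ler_wpM2l => //; apply: ler_pM => //.
      by rewrite !addr_ge0// ?mulr_ge0.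
    by rewrite !addr_ge0// ?mulr_ge0// sqr_ge0.
  have -> : m * ((B * (L + t * X)) * (B * (t ^+ 2 * L + t * X))) =
     m * B ^+ 2 * ((L + t * X) * (t ^+ 2 * L + t * X)) by ring.
  apply: ler_pM => //.
  - by rewrite mulr_ge0// addr_ge0// mulr_ge0// sqr_ge0.
  - rewrite /mu; nra.
  - rewrite -subr_ge0.
    have -> : (t * (L + X)) ^+ 2 + 2 * t * (L * X) - (L + t * X) * (t ^+ 2 * L + t * X) =
      t * (L * X) * (1 - t ^+ 2) + 2 * t ^+ 2 * (L * X) by ring.
    have tt1 : 0 <= 1 - t ^+ 2 by rewrite subr_ge0 expr_le1.
    by rewrite addr_ge0// !mulr_ge0// sqr_ge0.
pose a := t * (L + X).
have a0 : 0 <= a by rewrite mulr_ge0// addr_ge0.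
(* min(1, u^2) <= u for u = mu a: this is where the bound becomes linear in L *)
have h4 : r <= mu * a + mu ^+ 2 * (2 * t * (L * X)).
  have q0 : 0 <= mu ^+ 2 * (2 * t * (L * X)) by rewrite !mulr_ge0// sqr_ge0.
  have [ma|ma] := leP 1 (mu * a).
    by apply: (le_trans r1); apply: (le_trans ma); rewrite lerDl.
  apply: (le_trans h3); rewrite mulrDr lerD2r -/a -exprMn expr2.
  by apply: ler_piMl; [exact: mulr_ge0|exact: ltW].
have h5 : r <= mu ^+ 2 * (t * (L * (1 + 3 * X))).
  apply: (le_trans h4); rewrite -subr_ge0 /a.
  have -> : mu ^+ 2 * (t * (L * (1 + 3 * X))) -
      (mu * (t * (L + X)) + mu ^+ 2 * (2 * t * (L * X))) =
    mu * t * (L * (mu - 1) + X * (mu * (L - 1) + (mu - 1))) by ring.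
  rewrite mulr_ge0 ?mulr_ge0// addr_ge0// mulr_ge0// ?subr_ge0//.
  by rewrite addr_ge0 ?mulr_ge0// subr_ge0.
have X2 : 0 <= X ^+ 2 by exact: sqr_ge0.
have Xle : X <= 1 + X ^+ 2 by have := sqr_ge0 (1 - X); nra.
rewrite /rejection_cst -/B -/mu.
have mu20 : 0 <= mu ^+ 2 by exact: sqr_ge0.
have q0 : 0 <= 1 + X ^+ 2 by rewrite addr_ge0.
split.
  apply: (le_trans h5).
  apply: (@le_trans _ _ (4 * mu ^+ 2 * (t * (L * (1 + X ^+ 2))))).
    have -> : 4 * mu ^+ 2 * (t * (L * (1 + X ^+ 2))) = mu ^+ 2 * (t * (L * (4 * (1 + X ^+ 2)))) by ring.
    by apply: ler_wpM2l => //; apply: ler_wpM2l => //; apply: ler_wpM2l => //; lra.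
  apply: ler_wpM2r; first by rewrite !mulr_ge0.
  have : 0 <= 4 * mu ^+ 2 * b by rewrite !mulr_ge0.
  lra.
rewrite mulrDl.
have p1 : t * b * X * r <= 4 * mu ^+ 2 * b * (t ^+ 2 * (L * (1 + X ^+ 2))).
  apply: (@le_trans _ _ (t * b * X * (mu ^+ 2 * (t * (L * (1 + 3 * X)))))).
    by apply: ler_wpM2l => //; rewrite !mulr_ge0.
  have -> : t * b * X * (mu ^+ 2 * (t * (L * (1 + 3 * X)))) =
     mu ^+ 2 * b * (t ^+ 2 * (L * (X + 3 * X ^+ 2))) by ring.
  have -> : 4 * mu ^+ 2 * b * (t ^+ 2 * (L * (1 + X ^+ 2))) =
     mu ^+ 2 * b * (t ^+ 2 * (L * (4 * (1 + X ^+ 2)))) by ring.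
  apply: ler_wpM2l; first by rewrite mulr_ge0.
  apply: ler_wpM2l; first exact: sqr_ge0.
  by apply: ler_wpM2l => //; lra.
have p2 : 2 * t ^+ 2 * N * r <= 2 * (t ^+ 2 * (L * (1 + X ^+ 2))).
  apply: (@le_trans _ _ (2 * t ^+ 2 * N)).
    by rewrite ler_piMr// !mulr_ge0// sqr_ge0.
  rewrite -mulrA; apply: ler_wpM2l => //; apply: ler_wpM2l; first exact: sqr_ge0.
  apply: (@le_trans _ _ L); first by rewrite /L lerDr.
  by rewrite ler_peMr// lerDl.
have p3 : 0 <= 4 * mu ^+ 2 * (t ^+ 2 * (L * (1 + X ^+ 2))) by rewrite !mulr_ge0// sqr_ge0.
rewrite -/L; move: p1 p2 p3.
move: (t ^+ 2 * (L * (1 + X ^+ 2))) (t * b * X * r) (2 * t ^+ 2 * N * r) (mu ^+ 2) => Q A1 A2 mm.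
move=> p1 p2 p3.
have -> : (4 * mm * (1 + b) + 2) * Q = 4 * mm * b * Q + 2 * Q + 4 * mm * Q by ring.
lra.
Qed.

End rejection_bound.

Lemma le_of_lipschitz (R : realType) (M p a b c e : R) : 0 <= M -> 0 <= a -> 0 <= b ->
  p <= M * a * b -> a <= c -> b <= e -> p <= M * (c * e).
Proof.
move=> M0 a0 b0 pl ac be; apply: (le_trans pl); rewrite -mulrA.
by apply: ler_wpM2l => //; exact: ler_pM.
Qed.

Section sobolev_norm.
Variables (R : realType) (H : completeNormedModType R) (dot : {dot H for idfun}).
Variables (phi : nat -> H) (s : R).

(** The norm of H^s as a total function on H, with the dummy value 0 outside
    H^s. *)
Definition sobolev_norm (x : H) : R := `|to_hs dot phi s x|.
Local Notation nrm := sobolev_norm.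

Lemma in_hs_comb a b x y : in_hs dot phi s x -> in_hs dot phi s y ->
  in_hs dot phi s (a *: x + b *: y).
Proof.
move=> hx hy; rewrite /in_hs.
have -> : coords dot phi (a *: x + b *: y) = a *: coords dot phi x + b *: coords dot phi y.
  by apply/funext => j; rewrite /coords dotDl !dotZl.
by apply: hs_memD; apply: hs_memZ.
Qed.

Lemma to_hs_comb a b x y : in_hs dot phi s x -> in_hs dot phi s y ->
  to_hs dot phi s (a *: x + b *: y) = a *: to_hs dot phi s x + b *: to_hs dot phi s y.
Proof.
move=> hx hy; apply: val_inj.
rewrite [LHS]insubdK; last exact: in_hs_comb.
rewrite [RHS](_ : _ = a *: val (to_hs dot phi s x) + b *: val (to_hs dot phi s y))//.
rewrite !insubdK//.
by apply/funext => j; rewrite /coords dotDl !dotZl.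
Qed.

Lemma sobolev_norm_comb a b x y : in_hs dot phi s x -> in_hs dot phi s y ->
  nrm (a *: x + b *: y) <= `|a| * nrm x + `|b| * nrm y.
Proof.
move=> hx hy; rewrite /nrm to_hs_comb//; apply: le_trans (ler_normD _ _) _.
by rewrite !normrZ.
Qed.

Lemma sobolev_norm_ge0 x : 0 <= nrm x. Proof. exact: normr_ge0. Qed.

Lemma hs_esum_coords x : in_hs dot phi s x ->
  hs_esum s (coords dot phi x) = (nrm x ^+ 2)%:E.
Proof. by move=> hx; rewrite -hs_esum_norm /to_hs -[in RHS]/(val _) insubdK. Qed.

Lemma sobolev_norm_le_esum x : ((nrm x ^+ 2)%:E <= hs_esum s (coords dot phi x))%E.
Proof.
have [hx|hx] := boolP (coords dot phi x \in hs_mem s).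
  by rewrite hs_esum_coords.
rewrite /nrm (_ : to_hs _ _ _ _ = 0) ?normr0 ?expr0n ?hs_esum_ge0//.
by apply: val_inj; rewrite /to_hs val_insubd (negbTE hx).
Qed.

Lemma measurable_sobolev_norm d (T : measurableType d) (X : T -> H) :
  measurable_coords dot phi X -> measurable_fun setT (fun w => nrm (X w)).
Proof.
move=> mX; apply: (measurable_to_hs (G := fun u : hs s => `|u|)) => //.
by move=> u; exact: norm_continuous.
Qed.

Section proposal.
Variables (Psi : hs s -> R) (tau delta M : R).
Hypotheses (tau0 : 0 < tau) (delta0 : 0 < delta) (delta1 : delta < 2^-1).
Hypothesis Psi_lip : forall x y, `|Psi y - Psi x| <= M * (1 + `|x| + `|y|) * `|y - x|.
Hypothesis M0 : 0 <= M.
Local Notation sigma := (Num.sqrt (2 * delta * tau)).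

Lemma sqrt1_le1 : Num.sqrt (1 - 2 * delta) <= 1.
Proof. by rewrite -[leRHS]sqrtr1 ler_sqrt// gerBl mulr_ge0// ltW. Qed.

Lemma onem_sqrt1 : 1 - Num.sqrt (1 - 2 * delta) <= 2 * delta.
Proof.
set q := Num.sqrt _.
have q0 : 0 <= q by exact: sqrtr_ge0.
have q1 : q <= 1 := sqrt1_le1.
have q2 : q ^+ 2 = 1 - 2 * delta.
  by rewrite sqr_sqrtr// subr_ge0 ltW// -ltr_pdivlMl// mulr1.
nra.
Qed.

Lemma pcn_accept_itv x y : 0 <= pcn_accept dot phi Psi tau delta x y <= 1.
Proof.
by rewrite /pcn_accept le_min ler01 expR_ge0 ge_min lexx.
Qed.

(** Since 1 - min(1, exp(- u)) <= |u|, the probability of rejection is controlled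
    by the variation of Psi between the state and the proposal. *)
Lemma proposal_bounds x xi : in_hs dot phi s x -> in_hs dot phi s xi ->
  let r := 1 - pcn_accept dot phi Psi tau delta x xi in
  let c := rejection_cst (M / tau) (Num.sqrt (2 * tau)) in
  let Lq := (1 + nrm x) * (1 + nrm xi ^+ 2) in
  r <= c * (Num.sqrt delta * Lq) /\
  (sigma * nrm xi + 2 * delta * nrm x) * r <= c * (delta * Lq).
Proof.
move=> hx hxi r c Lq.
set q := Num.sqrt (1 - 2 * delta).
have q0 : 0 <= q by exact: sqrtr_ge0.
have q1 : q <= 1 := sqrt1_le1.
have t0 : 0 <= Num.sqrt delta by exact: sqrtr_ge0.
have t1 : Num.sqrt delta <= 1.
  by rewrite -[leRHS]sqrtr1 ler_sqrt// ltW// (lt_trans delta1)// invf_lt1// ltr1n.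
have sE : sigma = Num.sqrt delta * Num.sqrt (2 * tau).
  by rewrite -sqrtrM ?(ltW delta0)//; congr Num.sqrt; ring.
have tE : delta = Num.sqrt delta ^+ 2 by rewrite sqr_sqrtr// ltW.
have /andP[acc0 acc1] := pcn_accept_itv x xi.
have r01 : 0 <= r <= 1 by rewrite subr_ge0 acc1 gerBl.
have s0 : 0 <= sigma by exact: sqrtr_ge0.
have y_le : nrm (pcn_proposal tau delta x xi) <= nrm x + sigma * nrm xi.
  apply: le_trans (sobolev_norm_comb _ _ hx hxi) _.
  by rewrite !ger0_norm// lerD2r; apply: ler_piMl => //; exact: sobolev_norm_ge0.
have dy_le : `|to_hs dot phi s (pcn_proposal tau delta x xi) - to_hs dot phi s x| <=
    2 * delta * nrm x + sigma * nrm xi.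
  rewrite /pcn_proposal to_hs_comb// -/q addrAC -[X in _ - X + _]scale1r -scalerBl.
  apply: le_trans (ler_normD _ _) _; rewrite !normrZ (ger0_norm s0) -/(nrm x) -/(nrm xi).
  rewrite lerD2r ler_wpM2r ?sobolev_norm_ge0// distrC ger0_norm ?subr_ge0//.
  exact: onem_sqrt1.
have a_le : 1 + nrm x + nrm (pcn_proposal tau delta x xi) <= 1 + 2 * nrm x + sigma * nrm xi.
  have -> : 1 + 2 * nrm x + sigma * nrm xi = 1 + nrm x + (nrm x + sigma * nrm xi).
    by rewrite mulrDl mul1r !addrA.
  exact: lerD (lexx _) y_le.
have r_le : r <= (M / tau) * ((1 + 2 * nrm x + sigma * nrm xi) *
    (2 * delta * nrm x + sigma * nrm xi)).
  apply: (@le_trans _ _ (tau^-1 * `|Psi (to_hs dot phi s (pcn_proposal tau delta x xi)) -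
      Psi (to_hs dot phi s x)|)).
    rewrite /r /pcn_accept; set D := Psi _ - _.
    have tD0 : 0 <= tau^-1 * `|D| by rewrite mulr_ge0// invr_ge0 ltW.
    have [h|h] := leP 1 (expR (- tau^-1 * D)); first by rewrite subrr.
    rewrite lerBlDr -lerBlDl; apply: le_trans (expR_ge1Dx _).
    rewrite mulNr lerD2l lerN2; apply: ler_wpM2l; first by rewrite invr_ge0 ltW.
    exact: ler_norm.
  rewrite -mulrA mulrCA.
  apply: ler_wpM2l; first by rewrite invr_ge0 ltW.
  apply: (le_of_lipschitz M0 _ _ (Psi_lip _ _)); [| |exact: a_le|exact: dy_le].
    by rewrite addr_ge0 ?normr_ge0// addr_ge0 ?normr_ge0.
  exact: normr_ge0.
have := @rejection_bound R (M / tau) (Num.sqrt (2 * tau)) (Num.sqrt delta)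
  (nrm x) (nrm xi) r.
rewrite -sE -tE; apply => //.
- by rewrite divr_ge0// ltW.
- by rewrite t0.
- exact: sobolev_norm_ge0.
- exact: sobolev_norm_ge0.
Qed.

End proposal.
End sobolev_norm.

(** * Moments of the chain *)

Section real_inequalities.
Variable R : realType.

Lemma norm1_comb_le (a b : R) : `|1 : R| * a + `|1 : R| * b <= a + b.
Proof. by rewrite normr1 !mul1r. Qed.

(** One step of the discrete Gronwall inequality, in extended reals because the
    integrals may a priori be infinite. *)
Lemma growth_step (K q : R) (I I' r : \bar R) : 0 <= K -> (0 <= I)%E ->
  (I' <= I + r -> r <= K%:E * (1 + I) -> 1 + I <= q%:E ->
  1 + I' <= ((1 + K) * q)%:E)%E.
Proof.
move=> K0 I0 I'r rle IH.
apply: (@le_trans _ _ (1 + (I + K%:E * (1 + I)))%E).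
  by rewrite leeD2l//; apply: (le_trans I'r); rewrite leeD2l.
case: I I0 IH {I'r rle} => [i| |]//.
have -> : (1 + (i%:E + K%:E * (1 + i%:E)))%E = (1 + (i + K * (1 + i)))%:E by [].
have -> : (1 + i%:E)%E = (1 + i)%:E by [].
rewrite !lee_fin => i0 IH.
apply: le_trans (ler_wpM2l _ IH); last by rewrite addr_ge0.
by rewrite le_eqVlt; apply/orP; left; apply/eqP; ring.
Qed.

Lemma onem_add_le (B : R) (I J : \bar R) : (0 <= I -> J <= B%:E -> 1 <= B%:E ->
  1 + (I + J) <= (2 * B)%:E * (1 + I))%E.
Proof.
move=> I0 JB B1; rewrite lee_fin in B1.
apply: (@le_trans _ _ (1 + (I + B%:E))%E).
  by rewrite leeD2l// leeD2l.
have B0 := lt_le_trans ltr01 B1.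
move: I I0 => [r| |]//; last by rewrite /= gt0_muley ?leey// lte_fin mulr_gt0.
have -> : (1 + (r%:E + B%:E))%E = (1 + (r + B))%:E by [].
have -> : ((2 * B)%:E * (1 + r%:E))%E = ((2 * B) * (1 + r))%:E by [].
rewrite !lee_fin => r0; nra.
Qed.

Lemma integral_onem_add d (T : measurableType d) (P : probability T R) (f g : T -> R) :
  measurable_fun setT f -> measurable_fun setT g ->
  (forall w, 0 <= f w) -> (forall w, 0 <= g w) ->
  (\int[P]_w (1 + (f w + g w))%:E = 1 + (\int[P]_w (f w)%:E + \int[P]_w (g w)%:E))%E.
Proof.
move=> /measurable_EFinP mf /measurable_EFinP mg f0 g0.
under eq_integral do rewrite EFinD.
rewrite ge0_integralD//; first last.
- by apply/measurable_EFinP; apply: measurable_funD; exact/measurable_EFinP.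
- by move=> w _; rewrite lee_fin addr_ge0.
rewrite integral_prob_cst; congr (1 + _)%E.
under eq_integral do rewrite EFinD.
by rewrite ge0_integralD// => w _; rewrite lee_fin.
Qed.

Lemma le_add_mul0 (a b c' : R) : a <= b -> a <= b + 0 * c'.
Proof. by rewrite mul0r addr0. Qed.

Lemma contraction_le (a b : R) : 0 <= a <= 1 -> 0 <= b -> a * b + 0 * b <= b.
Proof. by move=> /andP[a0 a1] b0; rewrite mul0r addr0 ler_piMl. Qed.

Lemma norm_comb_le (a b e f u : R) : 0 <= b -> a <= e + f ->
  `|1| * a + `| - b| * u <= e + (b * u + f).
Proof. by move=> b0 h; rewrite normr1 mul1r normrN ger0_norm// [leLHS]addrC [leRHS]addrCA lerD2l. Qed.

Lemma contraction_le2 (a b n e : R) : 0 <= a <= 1 -> 0 <= b -> 0 <= n ->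
  1 - a <= e -> `|a| * b + `|1 - a| * n <= b + e * n.
Proof.
move=> /andP[a0 a1] b0 n0 ae; rewrite !ger0_norm ?subr_ge0//.
by apply: lerD; [exact: ler_piMl|exact: ler_wpM2r].
Qed.

End real_inequalities.

Section moments.
Variables (R : realType) (H : completeNormedModType R) (dot : {dot H for idfun}).
Hypothesis hilb : hilbert_norm dot.
Variables (C : {linear H -> H}) (phi : nat -> H) (lambda : nat -> R).
Hypothesis orth : forall i j, dot (phi i) (phi j) = (i == j)%:R.
Hypothesis lambda0 : forall j, 0 < lambda j.
Hypothesis eigC : forall j, C (phi j) = lambda j ^+ 2 *: phi j.
Context d (Omega : measurableType d) (P : probability Omega R).
Variables (xi : nat -> Omega -> H) (U : nat -> Omega -> R).
Hypothesis noise : pcn_noise P dot C xi U.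
Variable s : R.
Hypothesis lambda_hs : lambda \in hs_mem s.
Local Notation nrm := (sobolev_norm dot phi s).

(** The expected squared norm of the noise in H^s. *)
Definition trace_s : R := fine (hs_esum s lambda).

Lemma trace_sE : hs_esum s lambda = trace_s%:E.
Proof.
by rewrite /trace_s fineK// ge0_fin_numE ?hs_esum_ge0// -hs_memE.
Qed.

Lemma trace_s_ge0 : 0 <= trace_s.
Proof. exact: fine_ge0 (hs_esum_ge0 _ _). Qed.

Lemma integral_hs_esum (X : Omega -> H) (v : nat -> R) :
  measurable_coords dot phi X ->
  (forall j, \int[P]_w (dot (X w) (phi j) ^+ 2)%:E <= (v j)%:E)%E ->
  (\int[P]_w hs_esum s (coords dot phi (X w)) <=
    \sum_(0 <= j <oo) (j.+1%:R `^ (2 * s) * v j)%:E)%E.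
Proof.
move=> mX Xv.
have msq j : measurable_fun setT (fun w => (dot (X w) (phi j) ^+ 2)%:E).
  by apply/measurable_EFinP; apply: measurable_funX; exact: mX.
have mt j : measurable_fun setT (fun w => (hs_term s (coords dot phi (X w)) j)%:E).
  by apply/measurable_EFinP; apply: measurable_funM; [exact: measurable_cst|apply: measurable_funX; exact: mX].
rewrite integral_nneseries//; last by move=> j w _; rewrite lee_fin hs_term_ge0.
apply: lee_nneseries => j _.
  by move=> _; apply: integral_ge0 => w _; rewrite lee_fin hs_term_ge0.
rewrite /hs_term /coords; under eq_integral do rewrite EFinM.
rewrite ge0_integralZl_EFin//; last by move=> w _; rewrite lee_fin sqr_ge0.
by rewrite EFinM lee_wpmul2l// lee_fin powR_ge0.
Qed.

Lemma measurable_xi k : measurable_coords dot phi (xi k).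
Proof. by have [gxi _ _] := noise; move=> j; apply: (measurable_dot hilb (gxi k)). Qed.

Lemma measurable_U k : measurable_fun setT (U k).
Proof. by have [_ uU _] := noise; have [] := uU k. Qed.

Lemma xi_coord2 k j : (\int[P]_w (dot (xi k w) (phi j) ^+ 2)%:E = (lambda j ^+ 2)%:E)%E.
Proof.
have [gxi _ _] := noise.
have vE : dot (C (phi j)) (phi j) = lambda j ^+ 2.
  by rewrite eigC dotZl orth eqxx mulr1.
by rewrite (gaussian_moment2 hilb (gxi k)) vE// sqr_ge0.
Qed.

Lemma integral_xi_esum k :
  (\int[P]_w hs_esum s (coords dot phi (xi k w)) <= trace_s%:E)%E.
Proof.
rewrite -trace_sE; apply: integral_hs_esum; first exact: measurable_xi.
by move=> j; rewrite xi_coord2.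
Qed.

Lemma integral_nrm_le (X : Omega -> H) : measurable_coords dot phi X ->
  (\int[P]_w (nrm (X w) ^+ 2)%:E <= \int[P]_w hs_esum s (coords dot phi (X w)))%E.
Proof.
move=> mX; apply: ge0_le_integral => //.
- by move=> w _; rewrite lee_fin sqr_ge0.
- by apply/measurable_EFinP; apply: measurable_funX; exact: measurable_sobolev_norm.
- exact: measurable_hs_esum.
- by move=> w _; exact: sobolev_norm_le_esum.
Qed.

Lemma integral_xi_nrm2 k : (\int[P]_w (nrm (xi k w) ^+ 2)%:E <= trace_s%:E)%E.
Proof. exact: le_trans (integral_nrm_le (measurable_xi k)) (integral_xi_esum k). Qed.

Lemma ae_xi_in_hs : {ae P, forall w, forall k, in_hs dot phi s (xi k w)}.
Proof.
apply: ae_foralln => k.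
have : {ae P, forall w, (hs_esum s (coords dot phi (xi k w)) < +oo)%E}.
  apply: ae_lty.
  - by apply: measurable_hs_esum => j; exact: measurable_xi.
  - by move=> w; exact: hs_esum_ge0.
  - exact: le_lt_trans (integral_xi_esum k) (ltry _).
by apply: filterS => w; rewrite -hs_memE.
Qed.

(** The law of xi is symmetric, so the integral is the half sum of those with
    b and - b, in which the linear term, of varying sign, cancels before it is
    integrated. *)
Lemma gaussian_affine2 k j (a b : R) : 0 < b ->
  (\int[P]_w ((a + b * dot (xi k w) (phi j)) ^+ 2)%:E =
   (a ^+ 2 + b ^+ 2 * lambda j ^+ 2)%:E)%E.
Proof.
move=> b0; have [gxi _ _] := noise.
have vE e : e ^+ 2 = 1 -> dot (C ((e * b) *: phi j)) ((e * b) *: phi j) = b ^+ 2 * lambda j ^+ 2.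
  move=> e2; have -> : C ((e * b) *: phi j) = (e * b) *: C (phi j) by exact: linearZ.
  rewrite eigC !dotZl !dotZr orth eqxx/= mulr1.
  by rewrite -[in RHS](mul1r (b ^+ 2)) -e2; ring.
have v0 : 0 < b ^+ 2 * lambda j ^+ 2 by rewrite mulr_gt0 ?exprn_gt0.
pose f (x : R) : \bar R := ((a + x) ^+ 2)%:E.
have mf : measurable_fun setT f.
  apply/measurable_EFinP; apply: continuous_measurable_fun => x.
  apply: (cvg_comp (fun x => a + x) (fun x : R => x ^+ 2)); last exact: exprn_continuous.
  by apply: cvgD; [exact: cvg_cst|exact: cvg_id].
have f0 x : (0 <= f x)%E by rewrite lee_fin sqr_ge0.
have I e : e ^+ 2 = 1 -> (\int[P]_w ((a + e * (b * dot (xi k w) (phi j))) ^+ 2)%:E =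
   \int[normal_prob 0 (Num.sqrt (b ^+ 2 * lambda j ^+ 2))]_x f x)%E.
  move=> e2; have := @gaussian_integral _ _ _ hilb _ _ _ _ _ (gxi k) ((e * b) *: phi j) f.
  rewrite vE// => /(_ v0 mf f0) <-; apply: eq_integral => w _.
  by rewrite /f dotZr mulrA.
have I1 := I 1 (expr1n _ _); have I2 := I (-1) (etrans (sqrrN _) (expr1n _ _)).
have mm e : measurable_fun setT (fun w => ((a + e * (b * dot (xi k w) (phi j))) ^+ 2)%:E).
  apply/measurable_EFinP; apply: measurable_funX; apply: measurable_funD; first exact: measurable_cst.
  do 2 (apply: measurable_funM; first exact: measurable_cst); exact: measurable_xi.
have : (\int[P]_w (((a + 1 * (b * dot (xi k w) (phi j))) ^+ 2)%:E +
    ((a + (-1) * (b * dot (xi k w) (phi j))) ^+ 2)%:E) =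
   \int[P]_w ((2 * a ^+ 2)%:E + (2 * b ^+ 2)%:E * (dot (xi k w) (phi j) ^+ 2)%:E))%E.
  by apply: eq_integral => w _; rewrite -EFinM -!EFinD; congr (_%:E); ring.
have msq : measurable_fun setT (fun w => (dot (xi k w) (phi j) ^+ 2)%:E).
  by apply/measurable_EFinP; apply: measurable_funX; exact: measurable_xi.
have q0 (x : R) : (0 <= (x ^+ 2)%:E)%E by rewrite lee_fin sqr_ge0.
have c0 (x : R) : 0 <= 2 * x ^+ 2 by rewrite mulr_ge0// sqr_ge0.
rewrite ge0_integralD//.
rewrite [X in _ = X -> _]ge0_integralD//; first last.
  exact: measurable_funeM.
  by move=> w _; rewrite mule_ge0// lee_fin.
  by move=> w _; rewrite lee_fin.
rewrite ge0_integralZl_EFin// xi_coord2 integral_prob_cst I2 -I1.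
under [X in (X + _)%E]eq_integral do rewrite mul1r.
under [X in (_ + X)%E]eq_integral do rewrite mul1r.
set K := (\int[P]_w _)%E.
have K0 : (0 <= K)%E by apply: integral_ge0 => w _.
move: K K0 => [r| |] K0 //=.
by rewrite -EFinM -!EFinD => -[] E; congr (_%:E); lra.
Qed.

Section chains.
Variables (Psi : hs s -> R) (M tau delta : R) (xstar : H).
Hypothesis cPsi : continuous Psi.
Hypothesis Psi_lip : forall x y, `|Psi y - Psi x| <= M * (1 + `|x| + `|y|) * `|y - x|.
Hypothesis M0 : 0 <= M.
Hypotheses (tau0 : 0 < tau) (delta0 : 0 < delta) (delta1 : delta < 2^-1).
Hypothesis xstar_hs : in_hs dot phi s xstar.

(** The chain that accepts every proposal. *)
Fixpoint ref_chain (w : Omega) (k : nat) : H :=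
  if k is k'.+1 then pcn_proposal tau delta (ref_chain w k') (xi k' w) else xstar.

Let x (w : Omega) := pcn_chain dot phi Psi tau delta xstar (xi ^~ w) (U ^~ w).

(** Indices of the variables that determine the k-th state. *)
Definition before (k : nat) : set (nat + nat) :=
  [set i | (match i with inl j => j | inr j => j end < k)%N].

(** Indices of the variables that determine the k-th proposal. *)
Definition before_xi (k : nat) : set (nat + nat) :=
  [set i | match i with inl j => (j <= k)%N | inr j => (j < k)%N end].

Local Notation past J := (noise_past (d:=d) xi U J).

Lemma measurable_past_xi (J : set (nat + nat)) k : J (inl k) ->
  measurable_coords dot phi (xi k : past J -> H).
Proof. by move=> Jk j; exact: measurable_past_dot. Qed.

Lemma measurable_past_ref (J : set (nat + nat)) k : (forall j, (j < k)%N -> J (inl j)) ->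
  measurable_coords dot phi ((ref_chain ^~ k) : past J -> H).
Proof.
elim: k => [|k IH] Jk; first exact: measurable_coords_cst.
apply: measurable_proposal; last by apply: measurable_past_xi; exact: Jk.
by apply: IH => j jk; apply: Jk; rewrite (ltn_trans jk).
Qed.

Lemma measurable_past_chain (J : set (nat + nat)) k :
  (forall j, (j < k)%N -> J (inl j) /\ J (inr j)) ->
  measurable_coords dot phi ((x ^~ k) : past J -> H).
Proof.
move=> Jk; apply: measurable_chain => // i ik.
  by apply: measurable_past_xi; case: (Jk i ik).
by apply: measurable_past_U; case: (Jk i ik).
Qed.

Lemma measurable_ref k : measurable_coords dot phi (ref_chain ^~ k).
Proof.
elim: k => [|k IH]; first exact: measurable_coords_cst.
by apply: measurable_proposal => //; exact: measurable_xi.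
Qed.

Lemma measurable_pcn_chain k : measurable_coords dot phi (x ^~ k).
Proof.
apply: measurable_chain => // i ik; [exact: measurable_xi|exact: measurable_U].
Qed.

Local Notation sigma := (Num.sqrt (2 * delta * tau)).

(** Integrating the last noise out, the second moment m becomes
    (1 - 2 delta) m + 2 delta tau lambda_j^2, a convex combination of m and
    tau lambda_j^2. *)
Lemma ref_coord2 k j : (\int[P]_w (dot (ref_chain w k) (phi j) ^+ 2)%:E <=
  (dot xstar (phi j) ^+ 2 + tau * lambda j ^+ 2)%:E)%E.
Proof.
have tl0 : 0 <= tau * lambda j ^+ 2 by rewrite mulr_ge0 ?sqr_ge0// ltW.
elim: k => [|k IH].
  by rewrite /= integral_prob_cst lee_fin lerDl.
pose G (z : past (before k) * borel H) : \bar R :=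
  (dot (pcn_proposal tau delta (ref_chain z.1 k) z.2) (phi j) ^+ 2)%:E.
have mG : measurable_fun setT G.
  apply/measurable_EFinP; apply: measurable_funX.
  apply: (measurable_proposal (phi := phi)) => i.
    apply: (measurableT_comp (f := fun w : past (before k) => dot (ref_chain w k) (phi i))) => //.
    by apply: measurable_past_ref => l lk.
  apply: (measurableT_comp (f := fun u : borel H => dot u (phi i))) => //.
  exact: measurable_borel_dot.
have Jk : ~ before k (inl k) by rewrite /before /= ltnn.
have G0 z : (0 <= G z)%E by rewrite lee_fin sqr_ge0.
have := noise_fubini noise Jk (@noise_sigma_xi _ _ _ _ xi U k) mG G0.
rewrite /G /= => ->.
have s0 : 0 < sigma by rewrite sqrtr_gt0 !mulr_gt0.
have d1 : 0 <= 1 - 2 * delta by rewrite subr_ge0 ltW// -ltr_pdivlMl// mulr1.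
have inner w : (\int[P]_w' (dot (pcn_proposal tau delta (ref_chain w k) (xi k w')) (phi j) ^+ 2)%:E =
   (1 - 2 * delta)%:E * (dot (ref_chain w k) (phi j) ^+ 2)%:E + (2 * delta * tau * lambda j ^+ 2)%:E)%E.
  under eq_integral do rewrite /pcn_proposal dotDl !dotZl.
  rewrite gaussian_affine2// exprMn !sqr_sqrtr//; last by rewrite !mulr_ge0// ltW.
under eq_integral do rewrite inner.
have msq : measurable_fun setT (fun w => (dot (ref_chain w k) (phi j) ^+ 2)%:E).
  by apply/measurable_EFinP; apply: measurable_funX; exact: measurable_ref.
have c0 : 0 <= 2 * delta * tau * lambda j ^+ 2 by rewrite !mulr_ge0 ?sqr_ge0// ltW.
rewrite ge0_integralD//; first last.
  exact: measurable_funeM.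
  by move=> w _; rewrite mule_ge0// lee_fin sqr_ge0.
rewrite ge0_integralZl_EFin//; last by move=> w _; rewrite lee_fin sqr_ge0.
rewrite integral_prob_cst.
apply: (@le_trans _ _ ((1 - 2 * delta)%:E * (dot xstar (phi j) ^+ 2 + tau * lambda j ^+ 2)%:E +
   (2 * delta * tau * lambda j ^+ 2)%:E)%E).
  by apply: leeD => //; apply: lee_wpmul2l => //; rewrite lee_fin.
rewrite -EFinM -EFinD lee_fin -subr_ge0.
set A := dot xstar _ ^+ 2.
have -> : A + tau * lambda j ^+ 2 - ((1 - 2 * delta) * (A + tau * lambda j ^+ 2) +
   2 * delta * tau * lambda j ^+ 2) = 2 * delta * A by ring.
by apply: mulr_ge0; [rewrite mulr_ge0// ltW|exact: sqr_ge0].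
Qed.

Definition ref_bound : R := 1 + (nrm xstar ^+ 2 + tau * trace_s).

Lemma integral_ref_nrm k : (\int[P]_w (nrm (ref_chain w k))%:E <= ref_bound%:E)%E.
Proof.
have tS : 0 <= tau * trace_s by rewrite mulr_ge0 ?trace_s_ge0// ltW.
have mn : measurable_fun setT (fun w => nrm (ref_chain w k)).
  by apply: measurable_sobolev_norm; exact: measurable_ref.
have mn2 : measurable_fun setT (fun w => (nrm (ref_chain w k) ^+ 2)%:E).
  by apply/measurable_EFinP; exact: measurable_funX.
apply: (@le_trans _ _ (\int[P]_w (1%:E + (nrm (ref_chain w k) ^+ 2)%:E))%E).
  apply: ge0_le_integral => //.
  - by move=> w _; rewrite lee_fin sobolev_norm_ge0.
  - exact/measurable_EFinP.
  - by apply: emeasurable_funD => //; exact: measurable_cst.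
  - move=> w _; rewrite -EFinD lee_fin; set u := nrm _.
    have := sqr_ge0 (1 - u); nra.
rewrite ge0_integralD//; last by move=> w _; rewrite lee_fin sqr_ge0.
rewrite integral_prob_cst /ref_bound EFinD leeD2l//.
apply: (le_trans (integral_nrm_le (measurable_ref k))).
apply: (le_trans (integral_hs_esum (measurable_ref k) (ref_coord2 k))).
have -> : (\sum_(0 <= j <oo) (j.+1%:R `^ (2 * s) *
      (dot xstar (phi j) ^+ 2 + tau * lambda j ^+ 2))%:E =
    hs_esum s (coords dot phi xstar) + tau%:E * hs_esum s lambda)%E.
  rewrite /hs_esum -nneseriesZl; last by move=> j _; rewrite lee_fin hs_term_ge0.
  rewrite -nneseriesD; first last.
  - by move=> j _; rewrite mule_ge0 ?lee_fin ?hs_term_ge0// ltW.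
  - by move=> j _; rewrite lee_fin hs_term_ge0.
  apply: eq_eseriesr => j _; rewrite -EFinM -EFinD; congr (_%:E).
  by rewrite /hs_term /coords; ring.
by rewrite hs_esum_coords// trace_sE.
Qed.

Let alpha w k := pcn_accept dot phi Psi tau delta (x w k) (xi k w).

Definition rejected w k : R := if alpha w k <= U k w then 1 else 0.

Lemma measurable_past_alpha (J : set (nat + nat)) k : J (inl k) ->
  (forall j, (j < k)%N -> J (inl j) /\ J (inr j)) ->
  measurable_fun setT ((alpha ^~ k) : past J -> R).
Proof.
move=> Jk Jj; apply: measurable_accept => //.
  exact: measurable_past_chain.
exact: measurable_past_xi.
Qed.

Lemma alpha_itv w k : 0 <= alpha w k <= 1. Proof. exact: pcn_accept_itv. Qed.

Lemma prob_U_ge k (a : R) : 0 <= a <= 1 -> P [set w | a <= U k w] = (1 - a)%:E.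
Proof.
move=> /andP[a0 a1]; have [_ uU _] := noise; have [_ UP] := uU k.
have -> : [set w | a <= U k w] = U k @^-1` `[a, +oo[%classic.
  by apply/seteqP; split => w /=; rewrite in_itv/= andbT.
rewrite UP; last exact: measurable_itv.
rewrite /uniform_prob integral_uniform_pdf.
have -> : `[a, +oo[%classic `&` `[0, 1]%classic = `[a, 1]%classic.
  apply/seteqP; split => t /=; rewrite !in_itv/= ?andbT.
    by move=> [-> /andP[_ ->]].
  by move=> /andP[at1 t1]; rewrite at1 t1 (le_trans a0 at1).
rewrite (eq_integral (cst 1%E)); last first.
  move=> t; rewrite inE/= in_itv/= => /andP[at1 t1].
  by rewrite /uniform_pdf (le_trans a0 at1) t1 subr0 invr1.
have := @lebesgue_measure_itv R `[a, 1]; rewrite /= lte_fin => mI.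
rewrite integral_cst// mul1e; apply: (etrans mI).
case: ltP => [_|h]; first by rewrite EFinB.
have -> : a = 1 by apply/eqP; rewrite eq_le a1.
by rewrite subrr.
Qed.

(** U_k is integrated out first, the k-th proposal being frozen. *)
Lemma integral_rejected k (g : Omega -> R) : (forall w, 0 <= g w) ->
  measurable_fun setT (g : past (before_xi k) -> R) ->
  (\int[P]_w (rejected w k * g w)%:E = \int[P]_w ((1 - alpha w k) * g w)%:E)%E.
Proof.
move=> g0 mg.
pose G (z : past (before_xi k) * R) : \bar R :=
  ((if alpha z.1 k <= z.2 then 1 else 0) * g z.1)%:E.
have mal : measurable_fun setT ((alpha ^~ k) : past (before_xi k) -> R).
  apply: measurable_past_alpha; first by rewrite /before_xi /= leqnn.
  by move=> j jk; rewrite /before_xi /= jk (ltnW jk).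
have mG : measurable_fun setT G.
  apply/measurable_EFinP; apply: measurable_funM.
    apply: measurable_fun_ifT; [|exact: measurable_cst|exact: measurable_cst].
    apply: measurable_fun_ler => //.
    exact: (measurableT_comp (f := (alpha ^~ k) : past (before_xi k) -> R)).
  exact: (measurableT_comp (f := g : past (before_xi k) -> R)).
have Jk : ~ before_xi k (inr k) by rewrite /before_xi /= ltnn.
have G0 z : (0 <= G z)%E by rewrite lee_fin mulr_ge0//; case: ifP.
have := noise_fubini noise Jk (@noise_sigma_U _ _ _ _ xi U k) mG G0.
rewrite /G /= -/(rejected _ _) => ->.
apply: eq_integral => w _.
have mset : measurable [set w' | alpha w k <= U k w'].
  rewrite (_ : [set _ | _] = U k @^-1` `[alpha w k, +oo[%classic); last first.
    by apply/seteqP; split => w' /=; rewrite in_itv/= andbT.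
  rewrite -[X in measurable X]setTI; apply: (measurable_U k) => //.
transitivity (\int[P]_w' ((g w)%:E * (\1_[set w' | alpha w k <= U k w'] w')%:E))%E.
  apply: eq_integral => w' _; rewrite -EFinM; congr (_%:E); rewrite mulrC; congr (_ * _).
  rewrite indicE; case: ifPn => h; first by rewrite mem_set.
  by rewrite memNset//=; apply/negP.
rewrite ge0_integralZl_EFin//; last first.
  by apply/measurable_EFinP; exact: measurable_indic.
rewrite integral_indic// setIT; have /= -> := prob_U_ge k (alpha_itv w k).
by rewrite -EFinM mulrC.
Qed.

Let N w k := nrm (x w k).
Let X w k := nrm (xi k w).

(** xi_k is integrated out first, the k-th state being frozen. *)
Lemma integral_past_xi k (g : Omega -> R) : (forall w, 0 <= g w) ->
  measurable_fun setT (g : past (before k) -> R) ->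
  (\int[P]_w (g w * (1 + X w k ^+ 2))%:E <= (1 + trace_s)%:E * \int[P]_w (g w)%:E)%E.
Proof.
move=> g0 mg.
pose G (z : past (before k) * borel H) : \bar R := (g z.1 * (1 + nrm z.2 ^+ 2))%:E.
have mn : measurable_fun setT (nrm : borel H -> R).
  by apply: measurable_sobolev_norm => j; exact: measurable_borel_dot.
have mG : measurable_fun setT G.
  apply/measurable_EFinP; apply: measurable_funM.
    exact: (measurableT_comp (f := g : past (before k) -> R)).
  apply: measurable_funD; first exact: measurable_cst.
  by apply: measurable_funX; exact: (measurableT_comp (f := nrm : borel H -> R)).
have Jk : ~ before k (inl k) by rewrite /before /= ltnn.
have G0 z : (0 <= G z)%E by rewrite lee_fin mulr_ge0// addr_ge0// sqr_ge0.
have := noise_fubini noise Jk (@noise_sigma_xi _ _ _ _ xi U k) mG G0.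
rewrite /G /= -/(X _ _) => ->.
have m2 : measurable_fun setT (fun w => (X w k ^+ 2)%:E).
  apply/measurable_EFinP; apply: measurable_funX; apply: measurable_sobolev_norm.
  exact: measurable_xi.
have mgO : measurable_fun setT (fun w => (g w)%:E).
  apply/measurable_EFinP; apply: past_measurable_fun mg.
  exact: noise_sigma_measurable noise.
have m3 : measurable_fun setT (fun w' => (1 + X w' k ^+ 2)%:E).
  apply/measurable_EFinP; apply: measurable_funD; first exact: measurable_cst.
  exact/measurable_EFinP.
have i0 : (0 <= \int[P]_w' (1 + X w' k ^+ 2)%:E)%E.
  by apply: integral_ge0 => w' _; rewrite lee_fin addr_ge0// sqr_ge0.
have inner w : (\int[P]_w' (g w * (1 + X w' k ^+ 2))%:E =
    (\int[P]_w' (1 + X w' k ^+ 2)%:E) * (g w)%:E)%E.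
  under eq_integral do rewrite EFinM.
  rewrite ge0_integralZl_EFin// 1?muleC//.
  by move=> w' _; rewrite lee_fin addr_ge0// sqr_ge0.
under eq_integral do rewrite inner.
rewrite ge0_integralZl//; last by move=> w _; rewrite lee_fin.
apply: lee_wpmul2r; first by apply: integral_ge0 => w _; rewrite lee_fin.
under eq_integral do rewrite EFinD.
rewrite ge0_integralD//; first last.
- by move=> w _; rewrite lee_fin sqr_ge0.
by rewrite integral_prob_cst EFinD leeD2l//; exact: integral_xi_nrm2.
Qed.

Lemma measurable_past_chain_norm (J : set (nat + nat)) k :
  (forall j, (j < k)%N -> J (inl j) /\ J (inr j)) ->
  measurable_fun setT ((N ^~ k) : past J -> R).
Proof. by move=> Jk; apply: measurable_sobolev_norm; exact: measurable_past_chain. Qed.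

Lemma measurable_past_xi_norm (J : set (nat + nat)) k : J (inl k) ->
  measurable_fun setT ((X ^~ k) : past J -> R).
Proof. by move=> Jk; apply: measurable_sobolev_norm; exact: measurable_past_xi. Qed.

Lemma measurable_chain_norm k : measurable_fun setT (N ^~ k).
Proof. by apply: measurable_sobolev_norm; exact: measurable_pcn_chain. Qed.

Lemma measurable_xi_norm k : measurable_fun setT (X ^~ k).
Proof. by apply: measurable_sobolev_norm; exact: measurable_xi. Qed.

Lemma measurable_alpha k : measurable_fun setT (alpha ^~ k).
Proof. by apply: measurable_accept => //; [exact: measurable_pcn_chain|exact: measurable_xi]. Qed.

Lemma measurable_rejected k : measurable_fun setT (rejected ^~ k).
Proof.
apply: measurable_fun_ifT; [|exact: measurable_cst|exact: measurable_cst].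
by apply: measurable_fun_ler; [exact: measurable_alpha|exact: measurable_U].
Qed.

Lemma chain_norm_ge0 w k : 0 <= N w k. Proof. exact: sobolev_norm_ge0. Qed.
Lemma xi_norm_ge0 w k : 0 <= X w k. Proof. exact: sobolev_norm_ge0. Qed.
Lemma rejected_ge0 w k : 0 <= rejected w k. Proof. by rewrite /rejected; case: ifP. Qed.

Lemma chain_in_hs w k : (forall i, in_hs dot phi s (xi i w)) -> in_hs dot phi s (x w k).
Proof.
move=> hw; elim: k => [//|k IH] /=.
by apply: in_hs_comb => //; exact: in_hs_comb.
Qed.

Lemma ref_in_hs w k : (forall i, in_hs dot phi s (xi i w)) -> in_hs dot phi s (ref_chain w k).
Proof. by move=> hw; elim: k => [//|k IH] /=; exact: in_hs_comb. Qed.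

(** The scalars 1 and - 1 keep the difference in the form of the linear
    combinations for which membership in H^s and norms are handled. *)
Definition deviation w k : R := nrm (1 *: x w k + (-1) *: ref_chain w k).

Lemma measurable_deviation k : measurable_fun setT (deviation ^~ k).
Proof.
apply: measurable_sobolev_norm; apply: measurable_coordsD;
  apply: measurable_coordsZ; try exact: measurable_cst.
  exact: measurable_pcn_chain.
exact: measurable_ref.
Qed.

Lemma pcn_proposalB (y z u : H) :
  1 *: pcn_proposal tau delta y u + (-1) *: pcn_proposal tau delta z u =
  Num.sqrt (1 - 2 * delta) *: (1 *: y + (-1) *: z) + 0 *: (1 *: y + (-1) *: z).
Proof.
rewrite /pcn_proposal; move: (Num.sqrt _) (Num.sqrt _) => q b.
by rewrite scale0r addr0 !scale1r !scaleN1r scalerBr opprD addrACA subrr addr0.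
Qed.

(** If both chains move, the noise cancels and the difference is multiplied by
    sqrt(1 - 2 delta) <= 1.  If the chain stays, the difference also collects
    the displacement that the chain missed. *)
Lemma deviationS w k : (forall i, in_hs dot phi s (xi i w)) ->
  deviation w k.+1 <= deviation w k + rejected w k * (sigma * X w k + 2 * delta * N w k).
Proof.
move=> hw; have hx := chain_in_hs k hw; have hz := ref_in_hs k hw.
set q := Num.sqrt (1 - 2 * delta).
have q0 : 0 <= q by exact: sqrtr_ge0.
have q1 : q <= 1 by exact: sqrt1_le1.
have q01 : 0 <= q <= 1 by rewrite q0.
have hd : in_hs dot phi s (1 *: x w k + (-1) *: ref_chain w k) by exact: in_hs_comb.
have de0 : 0 <= deviation w k by exact: sobolev_norm_ge0.
have xS : x w k.+1 = if alpha w k <= U k w then x w k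
    else pcn_proposal tau delta (x w k) (xi k w).
  rewrite /x /= /pcn_step -/(x w k) -/(alpha w k).
  by case: leP => _; rewrite /= ?subr0 ?subrr ?scale0r ?scale1r ?add0r ?addr0.
rewrite {1}/deviation xS /rejected /=;
case: ifP => _.
  rewrite mul1r.
  have -> : 1 *: x w k + (-1) *: pcn_proposal tau delta (ref_chain w k) (xi k w) =
    1 *: (q *: (1 *: x w k + (-1) *: ref_chain w k) + (1 - q) *: x w k) +
      (- sigma) *: xi k w.
    rewrite /pcn_proposal -/q !scale1r !scaleN1r scalerBr scalerBl scale1r.
    by rewrite opprD scaleNr addrA [in RHS](addrC (q *: x w k - _)) [in RHS]addrA subrK.
  have hc : in_hs dot phi s (q *: (1 *: x w k + (-1) *: ref_chain w k) + (1 - q) *: x w k).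
    exact: in_hs_comb.
  apply: le_trans (sobolev_norm_comb _ _ hc (hw k)) _.
  apply: norm_comb_le; first exact: sqrtr_ge0.
  apply: le_trans (sobolev_norm_comb _ _ hd hx) _.
  exact: (contraction_le2 q01 de0 (sobolev_norm_ge0 _ _ _ _) (onem_sqrt1 delta0 delta1)).
apply: le_add_mul0.
rewrite (pcn_proposalB (x w k) (ref_chain w k) (xi k w)) -/q.
apply: (le_trans (sobolev_norm_comb q 0 hd hd)).
rewrite normr0 (ger0_norm q0); exact: (contraction_le q01 de0).
Qed.

Lemma chain_norm_le_deviation w k : (forall i, in_hs dot phi s (xi i w)) ->
  N w k <= deviation w k + nrm (ref_chain w k).
Proof.
move=> hw; have hx := chain_in_hs k hw; have hz := ref_in_hs k hw.
have hd : in_hs dot phi s (1 *: x w k + (-1) *: ref_chain w k) by exact: in_hs_comb.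
(* the chain as the sum of the difference and of the reference chain *)
have yzE (y z : H) : 1 *: (1 *: y + (-1) *: z) + 1 *: z = y.
  by rewrite !scale1r scaleN1r subrK.
rewrite /N -[x w k in leLHS](yzE _ (ref_chain w k)).
apply: (le_trans (sobolev_norm_comb _ _ hd hz)).
exact: norm1_comb_le.
Qed.

(** The exponential rate, in the time k delta, at which the mean deviation may
    grow; it does not depend on delta. *)
Definition growth_cst : R :=
  rejection_cst (M / tau) (Num.sqrt (2 * tau)) * (1 + trace_s) * (2 * ref_bound).

Local Notation c := (rejection_cst (M / tau) (Num.sqrt (2 * tau))).

Lemma rejection_cst_model_ge0 : 0 <= c.
Proof. by apply: rejection_cst_ge0; rewrite ?sqrtr_ge0// divr_ge0// ltW. Qed.

Lemma ref_bound_ge1 : 1 <= ref_bound.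
Proof.
by rewrite lerDl addr_ge0 ?sqr_ge0// mulr_ge0 ?trace_s_ge0// ltW.
Qed.

Lemma growth_cst_ge0 : 0 <= growth_cst.
Proof.
have B0 := le_trans ler01 ref_bound_ge1.
by rewrite !mulr_ge0 ?rejection_cst_model_ge0// addr_ge0// trace_s_ge0.
Qed.

Lemma deviation_ge0 w k : 0 <= deviation w k. Proof. exact: sobolev_norm_ge0. Qed.

Lemma integral_chain_norm k : (\int[P]_w (1 + N w k)%:E <=
   (2 * ref_bound)%:E * (1 + \int[P]_w (deviation w k)%:E))%E.
Proof.
have m1 : measurable_fun setT (fun w => nrm (ref_chain w k)).
  by apply: measurable_sobolev_norm; exact: measurable_ref.
have md := measurable_deviation k.
apply: (@le_trans _ _ (\int[P]_w (1 + (deviation w k + nrm (ref_chain w k)))%:E)%E).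
  apply: ae_ge0_le_integral => //.
  - by move=> w _; rewrite lee_fin addr_ge0// chain_norm_ge0.
  - by apply/measurable_EFinP; apply: measurable_funD; [exact: measurable_cst|exact: measurable_chain_norm].
  - by move=> w _; rewrite lee_fin addr_ge0// addr_ge0// sobolev_norm_ge0.
  - by apply/measurable_EFinP; exact: (measurable_funD (measurable_cst _) (measurable_funD md m1)).
  - apply: filterS ae_xi_in_hs => w hw _; rewrite lee_fin.
    exact: (lerD (lexx 1) (chain_norm_le_deviation k hw)).
rewrite (integral_onem_add P md m1 (deviation_ge0 ^~ k) (fun w => sobolev_norm_ge0 _ _ _ _)).
apply: onem_add_le; last by rewrite lee_fin ref_bound_ge1.
  by apply: integral_ge0 => w _; rewrite lee_fin deviation_ge0.
exact: integral_ref_nrm.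
Qed.

(** To be used with g the displacement missed by a rejection and b = delta, and
    with g = 1 and b = sqrt delta. *)
Lemma integral_rejection_bound k (g : Omega -> R) (b : R) : 0 <= b ->
  (forall w, 0 <= g w) ->
  measurable_fun setT (g : past (before_xi k) -> R) ->
  (forall w, in_hs dot phi s (x w k) -> in_hs dot phi s (xi k w) ->
    g w * (1 - alpha w k) <= c * (b * ((1 + N w k) * (1 + X w k ^+ 2)))) ->
  (\int[P]_w (rejected w k * g w)%:E <=
     (growth_cst * b)%:E * (1 + \int[P]_w (deviation w k)%:E))%E.
Proof.
move=> b0 g0 mg gle; rewrite integral_rejected//.
have cb0 : 0 <= c * b by rewrite mulr_ge0// rejection_cst_model_ge0.
have mNX : measurable_fun setT (fun w => ((1 + N w k) * (1 + X w k ^+ 2))).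
  apply: measurable_funM; apply: measurable_funD; try exact: measurable_cst.
    exact: measurable_chain_norm.
  by apply: measurable_funX; exact: measurable_xi_norm.
have NX0 w : 0 <= (1 + N w k) * (1 + X w k ^+ 2).
  by rewrite mulr_ge0 ?addr_ge0 ?chain_norm_ge0 ?sqr_ge0.
apply: (@le_trans _ _ (\int[P]_w ((c * b)%:E * ((1 + N w k) * (1 + X w k ^+ 2))%:E))%E).
  apply: ae_ge0_le_integral => //.
  - by move=> w _; rewrite lee_fin mulr_ge0// subr_ge0; case/andP: (alpha_itv w k).
  - apply/measurable_EFinP; apply: measurable_funM.
      by apply: measurable_funB; [exact: measurable_cst|exact: measurable_alpha].
    by apply: past_measurable_fun mg; exact: noise_sigma_measurable noise.
  - by move=> w _; rewrite -EFinM lee_fin mulr_ge0.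
  - by under eq_fun do rewrite -EFinM; apply/measurable_EFinP; apply: measurable_funM.
  - apply: filterS ae_xi_in_hs => w hw _; rewrite -EFinM lee_fin mulrC -mulrA.
    by apply: gle => //; exact: chain_in_hs.
rewrite ge0_integralZl_EFin//; first last.
  by apply/measurable_EFinP.
  by move=> w _; rewrite lee_fin.
apply: (@le_trans _ _ ((c * b)%:E * ((1 + trace_s)%:E * \int[P]_w (1 + N w k)%:E))%E).
  apply: lee_wpmul2l; first by rewrite lee_fin.
  apply: integral_past_xi => [w|]; first by rewrite addr_ge0// chain_norm_ge0.
  apply: measurable_funD; first exact: measurable_cst.
  by apply: measurable_past_chain_norm => j jk; rewrite /before/=.
apply: (@le_trans _ _ ((c * b)%:E * ((1 + trace_s)%:E *
    ((2 * ref_bound)%:E * (1 + \int[P]_w (deviation w k)%:E))))%E).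
  apply: lee_wpmul2l; first by rewrite lee_fin.
  apply: lee_wpmul2l; first by rewrite lee_fin addr_ge0// trace_s_ge0.
  exact: integral_chain_norm.
have -> : growth_cst * b = c * b * (1 + trace_s) * (2 * ref_bound).
  by rewrite /growth_cst; ring.
by rewrite !muleA -!EFinM.
Qed.

(** Discrete Gronwall inequality: a rejection costs O(sqrt delta) and has
    probability O(sqrt delta). *)
Lemma integral_deviation k :
  (1 + \int[P]_w (deviation w k)%:E <= ((1 + growth_cst * delta) ^+ k)%:E)%E.
Proof.
have Kd0 : 0 <= growth_cst * delta by rewrite mulr_ge0 ?growth_cst_ge0// ltW.
elim: k => [|k IH].
  rewrite (eq_integral (cst 0%E)) ?integral0 ?adde0// => w _ /=.
  have yyE (y : H) : 1 *: y + (-1) *: y = 0 *: y + 0 *: y.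
    by rewrite scaleN1r scale1r subrr !scale0r addr0.
  rewrite /deviation /= yyE.
  apply/eqP; rewrite eqe eq_le sobolev_norm_ge0 andbT.
  by apply: le_trans (sobolev_norm_comb _ _ xstar_hs xstar_hs) _; rewrite normr0 mul0r addr0.
have g0 w : 0 <= sigma * X w k + 2 * delta * N w k.
  by rewrite addr_ge0// mulr_ge0 ?sqrtr_ge0 ?xi_norm_ge0 ?chain_norm_ge0// mulr_ge0// ltW.
have mgp : measurable_fun setT ((fun w => sigma * X w k + 2 * delta * N w k) : past (before_xi k) -> R).
  apply: measurable_funD; apply: measurable_funM; try exact: measurable_cst.
    by apply: measurable_past_xi_norm; rewrite /before_xi /=.
  by apply: measurable_past_chain_norm => j jk; rewrite /before_xi /= jk (ltnW jk).
have mg : measurable_fun setT (fun w => rejected w k * (sigma * X w k + 2 * delta * N w k)).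
  apply: measurable_funM; first exact: measurable_rejected.
  by apply: past_measurable_fun mgp; exact: noise_sigma_measurable noise.
have rg0 w : 0 <= rejected w k * (sigma * X w k + 2 * delta * N w k).
  by rewrite mulr_ge0 ?rejected_ge0.
have md := measurable_deviation.
have step : (\int[P]_w (deviation w k.+1)%:E <= \int[P]_w (deviation w k)%:E +
   \int[P]_w (rejected w k * (sigma * X w k + 2 * delta * N w k))%:E)%E.
  rewrite -ge0_integralD//; first last.
  - exact/measurable_EFinP.
  - by move=> w _; rewrite lee_fin.
  - exact/measurable_EFinP.
  - by move=> w _; rewrite lee_fin deviation_ge0.
  apply: ae_ge0_le_integral => //.
  - by move=> w _; rewrite lee_fin deviation_ge0.
  - exact/measurable_EFinP.
  - by move=> w _; rewrite -EFinD lee_fin addr_ge0// deviation_ge0.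
  - by apply: emeasurable_funD; exact/measurable_EFinP.
  - by apply: filterS ae_xi_in_hs => w hw _; rewrite -EFinD lee_fin; exact: deviationS.
have rej := @integral_rejection_bound k _ delta (ltW delta0) g0 mgp.
have {}rej := rej (fun w hx hxi => (proposal_bounds (Psi := Psi) tau0 delta0 delta1 Psi_lip M0 hx hxi).2).
rewrite exprS; apply: (growth_step Kd0 _ step rej IH).
by apply: integral_ge0 => w _; rewrite lee_fin deviation_ge0.
Qed.

Lemma integral_rejected_le k : (\int[P]_w (rejected w k)%:E <=
  (growth_cst * Num.sqrt delta * expR (growth_cst * delta * k%:R))%:E)%E.
Proof.
have K0 := growth_cst_ge0.
have Kd0 : 0 <= growth_cst * delta by rewrite mulr_ge0 ?growth_cst_ge0// ltW.
have := @integral_rejection_bound k (cst 1) (Num.sqrt delta) (sqrtr_ge0 _).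
move=> /(_ (fun=> ler01) (measurable_cst _)) rej.
have {}rej : (\int[P]_w (rejected w k * cst 1 w)%:E <=
    (growth_cst * Num.sqrt delta)%:E * (1 + \int[P]_w (deviation w k)%:E))%E.
  apply: rej => w hx hxi; rewrite mul1r.
  exact: (proposal_bounds tau0 delta0 delta1 Psi_lip M0 hx hxi).1.
under eq_integral => w _ do rewrite -[rejected w k]mulr1 -/(cst 1 w).
apply: (le_trans rej); rewrite [leRHS]EFinM; apply: lee_wpmul2l.
  by rewrite lee_fin mulr_ge0// sqrtr_ge0.
apply: (le_trans (integral_deviation k)); rewrite lee_fin [in expR _]mulrC expRM_natl.
by apply: lerXn2r; rewrite ?nnegrE ?expR_ge0 ?expR_ge1Dx// addr_ge0.
Qed.

End chains.
End moments.

(** * Comparison of the Euler scheme with the exponential *)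

Section exponential_rate.
Variable R : realType.
Implicit Types (q e u a b t x delta : R) (k n : nat).

Lemma subX_le q e k : 0 <= q -> q <= e -> e <= 1 ->
  0 <= e ^+ k - q ^+ k <= k%:R * (e - q).
Proof.
move=> q0 qe e1; elim: k => [|k /andP[IH1 IH2]]; first by rewrite !expr0 subrr mul0r lexx.
have e0 : 0 <= e by exact: le_trans qe.
have -> : e ^+ k.+1 - q ^+ k.+1 = e * (e ^+ k - q ^+ k) + q ^+ k * (e - q).
  by rewrite !exprS; ring.
have qk1 : q ^+ k <= 1 by rewrite exprn_ile1// (le_trans qe).
have qk0 : 0 <= q ^+ k by rewrite exprn_ge0.
have eq0 : 0 <= e - q by rewrite subr_ge0.
rewrite addr_ge0 ?mulr_ge0//= -[k.+1]addn1 natrD mulrDl mul1r.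
apply: lerD; last exact: ler_piMl.
by apply: le_trans IH2; exact: ler_piMl.
Qed.

(** Each of the k - n missing factors accounts for at most 1 - q. *)
Lemma subX_le_rejections q n k : 0 <= q <= 1 -> (n <= k)%N ->
  `|q ^+ n - q ^+ k| <= (1 - q) * (k%:R - n%:R).
Proof.
move=> /andP[q0 q1] nk.
have /andP[h1 h2] := subX_le (k - n) q0 q1 (lexx 1).
rewrite expr1n in h1 h2.
have qn1 : q ^+ n <= 1 by rewrite exprn_ile1.
have qn0 : 0 <= q ^+ n by rewrite exprn_ge0.
have -> : q ^+ n - q ^+ k = q ^+ n * (1 - q ^+ (k - n)).
  by rewrite mulrBr mulr1 -exprD subnKC.
rewrite ger0_norm ?mulr_ge0// mulrC -natrB// [leRHS]mulrC.
apply: le_trans h2.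
exact: ler_piMr.
Qed.

Lemma expRN_le u : 0 <= u -> expR (- u) - (1 - u) <= u ^+ 2.
Proof.
move=> u0; have u1 : 0 < 1 + u by rewrite ltr_pwDl.
have h : expR (- u) <= (1 + u)^-1.
  by rewrite expRN lef_pV2 ?posrE ?expR_gt0//; exact: expR_ge1Dx.
apply: (@le_trans _ _ ((1 + u)^-1 - (1 - u))); first by rewrite lerD2r.
have -> : (1 + u)^-1 - (1 - u) = u ^+ 2 / (1 + u) by field; rewrite gt_eqF.
by rewrite ler_pdivrMr// ler_peMr ?sqr_ge0// lerDl.
Qed.

Lemma expRN_lipschitz a b : 0 <= a <= b -> `|expR (- a) - expR (- b)| <= b - a.
Proof.
move=> /andP[a0 ab].
have -> : expR (- a) - expR (- b) = expR (- a) * (1 - expR (- (b - a))).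
  by rewrite mulrBr mulr1 -expRD; congr (_ - expR _); ring.
have h1 : expR (- (b - a)) <= 1 by rewrite -expR0 ler_expR oppr_le0 subr_ge0.
have h2 : expR (- a) <= 1 by rewrite -expR0 ler_expR oppr_le0.
rewrite ger0_norm; last by rewrite mulr_ge0 ?expR_ge0// subr_ge0.
apply: (@le_trans _ _ (1 - expR (- (b - a)))).
  by rewrite ler_piMl// subr_ge0.
by rewrite lerBlDr -lerBlDl; exact: expR_ge1Dx.
Qed.

(** Three errors are added: that of the k - n rejections, that of the Euler
    scheme at time k delta, and that due to the distance from t to k delta. *)
Lemma pow_exp_dist delta n k t : 0 < delta -> delta < 2^-1 -> (n <= k)%N ->
  0 <= t -> `|t - k%:R * delta| <= delta ->
  `|(1 - 2 * delta) ^+ n - expR (- (2 * t))| <=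
    2 * delta * (k%:R - n%:R) + 4 * delta * (k%:R * delta) + 2 * delta.
Proof.
move=> d0 d1 nk t0 tk.
have q0 : 0 <= 1 - 2 * delta by rewrite subr_ge0 ltW// -ltr_pdivlMl// mulr1.
have q1 : 1 - 2 * delta <= 1 by rewrite gerBl mulr_ge0// ltW.
have q01 : 0 <= 1 - 2 * delta <= 1 by rewrite q0.
have h1 := subX_le_rejections q01 nk.
have u0 : 0 <= 2 * delta by rewrite mulr_ge0// ltW.
have := @subX_le (1 - 2 * delta) (expR (- (2 * delta))) k q0 (expR_ge1Dx _).
rewrite -[X in _ <= X -> _]expR0 ler_expR oppr_le0 => /(_ u0).
rewrite -expRM_natl => /andP[h2 h3].
have h4 := expRN_le u0.
have h5 : `|expR (- (2 * (k%:R * delta))) - expR (- (2 * t))| <= 2 * delta.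
  have kd0 : 0 <= k%:R * delta by rewrite mulr_ge0// ltW.
  have [tk1|tk1] := leP t (k%:R * delta).
    rewrite distrC; apply: (le_trans (@expRN_lipschitz _ _ _)).
      by rewrite mulr_ge0//= ler_pM2l.
    rewrite -mulrBr ler_pM2l//; apply: le_trans tk.
    by rewrite distrC; exact: ler_norm.
  apply: (le_trans (@expRN_lipschitz _ _ _)).
    by rewrite mulr_ge0//= ler_pM2l// ltW.
  rewrite -mulrBr ler_pM2l//; apply: le_trans tk.
  exact: ler_norm.
have eE : k%:R * - (2 * delta) = - (2 * (k%:R * delta)) by ring.
rewrite eE in h2 h3.
set Q := _ ^+ n; set E := expR (- (2 * t)).
have -> : Q - E = (Q - (1 - 2 * delta) ^+ k) +
  ((1 - 2 * delta) ^+ k - expR (- (2 * (k%:R * delta)))) + (expR (- (2 * (k%:R * delta))) - E).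
  by ring.
apply: le_trans (ler_normD _ _) _; apply: lerD => //.
apply: le_trans (ler_normD _ _) _; apply: lerD.
  apply: (le_trans h1); apply: ler_wpM2r; first by rewrite subr_ge0 ler_nat.
  by rewrite opprB addrC subrK.
rewrite distrC ger0_norm//; apply: (le_trans h3).
have -> : 4 * delta * (k%:R * delta) = k%:R * (2 * delta) ^+ 2 by ring.
exact: ler_wpM2l.
Qed.

Lemma convex_dist (a p q v B : R) : 0 <= a <= 1 -> `|p - v| <= B -> `|q - v| <= B ->
  `|a * p + (1 - a) * q - v| <= B.
Proof.
move=> /andP[a0 a1] hp hq.
have -> : a * p + (1 - a) * q - v = a * (p - v) + (1 - a) * (q - v) by ring.
apply: le_trans (ler_normD _ _) _; rewrite !normrM ger0_norm// [`|1 - a|]ger0_norm ?subr_ge0//.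
apply: (@le_trans _ _ (a * B + (1 - a) * B)).
  by apply: lerD; apply: ler_wpM2l; rewrite ?subr_ge0.
by rewrite -mulrDl addrC subrK mul1r.
Qed.

End exponential_rate.

(** * Piecewise linear paths *)

Section interpolation.
Variable R : realType.
Implicit Types (delta t T : R) (a : nat -> R).

(** The interpolation formula of qv_interp, for any sequence of values on the
    grid. *)
Definition interp delta a t : R :=
  let k := Num.truncn (t / delta) in
  delta^-1 * (t - k%:R * delta) * a k.+1 + delta^-1 * (k.+1%:R * delta - t) * a k.

Lemma truncn_grid delta t : 0 < delta -> 0 <= t ->
  (Num.truncn (t / delta))%:R * delta <= t < (Num.truncn (t / delta)).+1%:R * delta.
Proof.
by move=> d0 t0; rewrite -ler_pdivlMr// -ltr_pdivrMr// truncn_itv// divr_ge0// ltW.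
Qed.

Lemma interp_dist delta a t v B : 0 < delta -> 0 <= t ->
  (forall k, (k <= (Num.truncn (t / delta)).+1)%N -> `|t - k%:R * delta| <= delta ->
     `|a k - v| <= B) ->
  `|interp delta a t - v| <= B.
Proof.
move=> d0 t0 aB; have /andP[h1 h2] := truncn_grid d0 t0.
rewrite /interp; set k := Num.truncn _ in h1 h2 aB *.
have kS : k.+1%:R * delta = k%:R * delta + delta :> R by rewrite -addn1 natrD mulrDl mul1r.
rewrite kS in h2 *.
have -> : delta^-1 * (k%:R * delta + delta - t) = 1 - delta^-1 * (t - k%:R * delta).
  by field; rewrite gt_eqF.
apply: convex_dist.
- rewrite mulr_ge0 ?invr_ge0 ?(ltW d0) ?subr_ge0//= ler_pdivrMl// mulr1 lerBlDl.
  exact: ltW.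
- apply: aB => //; rewrite kS ler_norml; apply/andP; split; lra.
- apply: aB => //; rewrite ler_norml; apply/andP; split; lra.
Qed.

Definition clamp (x : R) : R := Num.min 1 (Num.max 0 x).

Lemma continuous_clamp : continuous clamp.
Proof.
move=> x; apply: (@continuous_min _ _ (cst 1) (fun x : R => Num.max 0 x)); first exact: cvg_cst.
apply: (@continuous_max _ _ (cst 0) (fun x : R => x)); [exact: cvg_cst|exact: cvg_id].
Qed.

(** The interpolated path as a sum of one ramp for each cell of the grid, a form
    in which continuity at the grid points is immediate. *)
Definition ramps delta a (K : nat) t : R :=
  a 0 + \sum_(i < K) (a i.+1 - a i) * clamp (delta^-1 * (t - i%:R * delta)).

Lemma continuous_ramps delta a K : continuous (ramps delta a K).
Proof.
move=> t; apply: cvgD; first exact: cvg_cst.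
elim: K => [|K IH].
  by under eq_fun do rewrite big_ord0; rewrite big_ord0; exact: cvg_cst.
under eq_fun do rewrite big_ord_recr/=; rewrite big_ord_recr/=.
apply: cvgD; first exact: IH.
apply: cvgM; first exact: cvg_cst.
apply: (@continuous_comp _ _ _ (fun t => delta^-1 * (t - K%:R * delta)) clamp); last exact: continuous_clamp.
by apply: cvgM; [exact: cvg_cst|apply: cvgB; [exact: cvg_id|exact: cvg_cst]].
Qed.

Lemma interp_ramps delta a K t : 0 < delta -> 0 <= t -> (Num.truncn (t / delta) < K)%N ->
  interp delta a t = ramps delta a K t.
Proof.
move=> d0 t0 kK; have /andP[h1 h2] := truncn_grid d0 t0.
rewrite /interp /ramps; set k := Num.truncn _ in kK h1 h2 *.
have kS i : i.+1%:R * delta = i%:R * delta + delta :> R by rewrite -addn1 natrD mulrDl mul1r.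
pose f i := (a i.+1 - a i) * clamp (delta^-1 * (t - i%:R * delta)).
rewrite -(big_mkord xpredT f) (big_cat_nat (n := k))//=; last exact: ltnW.
rewrite (big_ltn kK) [X in _ + (_ + (_ + X))]big_nat_cond [X in _ + (_ + (_ + X))]big1 => [|i]; last first.
  rewrite andbT => /andP[ki _]; rewrite /f /clamp.
  suff h : delta^-1 * (t - i%:R * delta) <= 0 by rewrite max_l// min_r ?mulr0.
  have : k.+1%:R * delta <= i%:R * delta by rewrite ler_wpM2r ?(ltW d0)// ler_nat.
  move=> h; rewrite mulr_ge0_le0 ?invr_ge0 ?(ltW d0)// subr_le0.
  exact: le_trans (ltW h2) h.
rewrite (_ : \sum_(0 <= i < k) f i = a k - a 0); last first.
  rewrite -telescope_sumr// big_nat_cond [RHS]big_nat_cond; apply: eq_bigr => i.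
  rewrite andbT => /andP[_ ik]; rewrite /f.
  have h : 1 <= delta^-1 * (t - i%:R * delta).
    rewrite ler_pdivlMl// mulr1 lerBrDl -kS; apply: le_trans h1.
    by rewrite ler_wpM2r ?(ltW d0)// ler_nat.
  by rewrite /clamp max_r ?min_l ?mulr1// (le_trans _ h).
have h3 : 0 <= delta^-1 * (t - k%:R * delta).
  by rewrite mulr_ge0 ?invr_ge0 ?(ltW d0)// subr_ge0.
have h4 : delta^-1 * (t - k%:R * delta) <= 1.
  by rewrite ler_pdivrMl// mulr1 lerBlDl -kS ltW.
rewrite /f /clamp max_r// min_r// kS addr0.
by field; rewrite gt_eqF.
Qed.

Lemma continuous_interp delta a T : 0 < delta -> 0 < T ->
  {within `[0, T], continuous (interp delta a)}.
Proof.
move=> d0 T0.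
apply: (@subspace_eq_continuous _ _ _ (ramps delta a (Num.truncn (T / delta)).+1)); last first.
  by apply: continuous_subspaceT; exact: continuous_ramps.
move=> t; rewrite inE/= in_itv/= => /andP[t0 tT]; apply/esym/interp_ramps => //.
rewrite ltnS truncn_ge_nat; last by rewrite divr_ge0// ltW.
apply: (@le_trans _ _ (t / delta)).
  by rewrite truncn_le divr_ge0// ltW.
by rewrite ler_pM2r// invr_gt0.
Qed.

End interpolation.

(** * The limit equation *)

Section ode.
Variable R : realType.

(** The derivative of (v - tau) exp(2 t) vanishes. *)
Lemma ode_solutionE (T tau v0 : R) (v : R -> R) : 0 < T -> ode_solution T tau v0 v ->
  forall t, t \in `[0, T] -> v t = tau + (v0 - tau) * expR (- (2 * t)).
Proof.
move=> T0 [v00 cv dv] t; rewrite in_itv/= => /andP[t0 tT].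
pose g (x : R) : R := (v x - tau) * expR (2 * x).
suff gE : g t = g 0.
  have e0 : expR (2 * t) * expR (- (2 * t)) = 1 by rewrite -expRD subrr expR0.
  have : g t * expR (- (2 * t)) = v t - tau by rewrite /g -mulrA e0 mulr1.
  by rewrite gE /g v00 mulr0 expR0 mulr1 => ->; rewrite addrC subrK.
move: t0; rewrite le_eqVlt => /predU1P[<-//|t0].
have cE : continuous (fun x : R => expR (2 * x)).
  move=> x; apply: (@continuous_comp _ _ _ (fun x : R => 2 * x) expR); last exact: continuous_expR.
  by apply: cvgM; [exact: cvg_cst|exact: cvg_id].
have cg : {within `[0, t], continuous g}.
  have cvt : {within `[0, t], continuous v}.
    by apply: continuous_subspaceW cv => x /=; rewrite !in_itv/= => /andP[-> /le_trans->].
  move=> x; apply: (@continuousM _ _ (fun x : subspace `[0, t] => v x - tau) (fun x : subspace `[0, t] => expR (2 * x))).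
    by apply: continuousB; [exact: cvt|exact: cvg_cst].
  exact: (continuous_subspaceT cE).
have dg x : x \in `]0, t[ -> is_derive x 1 g (cst 0 x).
  rewrite in_itv/= => /andP[x0 xt].
  have dvx : is_derive x 1 v (- 2 * (v x - tau)).
    by apply: dv; rewrite in_itv/= x0 (lt_le_trans xt).
  have dE : is_derive x 1 (fun x : R => expR (2 * x)) (2 * expR (2 * x)).
    have d2 : is_derive x (1 : R) (fun x : R => 2 * x) 2.
      by apply: is_derive_eq; rewrite ?scaler1// mulr1.
    have := @is_derive1_comp _ expR (fun x : R => 2 * x) x _ _ (is_derive_expR _) d2.
    by rewrite mulrC.
  have dB : is_derive x 1 (fun x : R => v x - tau) (- 2 * (v x - tau)).
    by apply: is_derive_eq; rewrite subr0.
  rewrite /g; apply: is_derive_eq.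
  by rewrite /= /GRing.scale /=; ring.
have [c _] := MVT t0 dg cg.
by rewrite mul0r => /eqP; rewrite subr_eq0 => /eqP.
Qed.

End ode.

(** * Measurability of the uniform distance *)

Section unif_dist.
Context d (Omega : measurableType d) (R : realType).
Variables (T : R) (X : Omega -> R -> R) (v : R -> R).
Hypothesis T0 : 0 < T.
Hypothesis cX : forall w, {within `[0, T], continuous (X w)}.
Hypothesis mX : forall t, t \in `[0, T] -> measurable_fun setT (X ^~ t).
Hypothesis cv : {within `[0, T], continuous v}.

(** The paths are continuous, so the supremum may be restricted to rational
    times; this makes the event measurable. *)
Lemma unif_dist_gtP (eps : R) (w : Omega) : (eps%:E < unif_dist T (X w) v)%E <->
  exists q : rat, (ratr q : R) \in `[0, T] /\ eps < `|X w (ratr q) - v (ratr q)|.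
Proof.
split; last first.
  move=> [q [q0 qe]]; apply: (@lt_le_trans _ _ (`|X w (ratr q) - v (ratr q)|%:E)).
    by rewrite lte_fin.
  by apply: ereal_sup_ubound; exists (ratr q).
move=> /ereal_sup_gt[_ [t tT <-]]; rewrite lte_fin => et.
have cf : {within `[0, T], continuous (fun t => `|X w t - v t|)}.
  move=> x; apply: (@continuous_comp _ _ _ (fun x : subspace `[0, T] => X w x - v x) Num.norm).
    by apply: continuousB; [exact: cX|exact: cv].
  exact: norm_continuous.
have tT' : `[0, T]%classic t by [].
move/subspace_continuousP : cf => /(_ _ tT').
move=> /cvgrPdist_lt /(_ (`|X w t - v t| - eps)); rewrite subr_gt0 => /(_ et).
rewrite near_withinE => /nbhs_ballP[r /= r0 hr].
move: tT'; rewrite /= in_itv/= => /andP[t0 tle].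
have : Num.max 0 (t - r) < Num.min T (t + r).
  rewrite gt_max !lt_min T0/=; apply/andP; split; [|apply/andP; split]; lra.
move=> /rat_in_itvoo[q]; rewrite in_itv/= gt_max lt_min.
move=> /andP[/andP[q0 qr1] /andP[qT qr2]].
exists q; split; first by rewrite in_itv/= !ltW.
have := hr (ratr q); rewrite /ball/= => /(_ _ _).
rewrite ltr_norml => h.
have {}h := h (ltac:(apply/andP; split; lra)) (ltac:(by rewrite in_itv/= !ltW)).
rewrite /from_subspace in h.
have := le_lt_trans (ler_norm _) h; rewrite ltrD2l ltrN2.
exact.
Qed.

Lemma measurable_unif_dist_gt (eps : R) :
  measurable [set w | (eps%:E < unif_dist T (X w) v)%E].
Proof.
rewrite (_ : [set _ | _] = \bigcup_(q : rat)
  [set w | (ratr q : R) \in `[0, T] /\ eps < `|X w (ratr q) - v (ratr q)|]); last first.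
  apply/seteqP; split => w /=; first by move=> /unif_dist_gtP[q hq]; exists q.
  by move=> [q _ hq]; apply/unif_dist_gtP; exists q.
apply: bigcupT_measurable_rat => q.
have [qT|qT] := boolP ((ratr q : R) \in `[0, T]); last first.
  by rewrite (_ : [set _ | _] = set0)//; apply/seteqP; split => w //= [].
rewrite (_ : [set _ | _] = (fun w => `|X w (ratr q) - v (ratr q)|) @^-1` `]eps, +oo[%classic); last first.
  by apply/seteqP; split => w /=; rewrite in_itv/= andbT => // -[].
rewrite -[X in measurable X]setTI.
have mf : measurable_fun setT (fun w => `|X w (ratr q) - v (ratr q)|).
  apply: measurableT_comp; first exact: normr_measurable.
  by apply: measurable_funB; [exact: mX|exact: measurable_cst].
by apply: mf => //; exact: measurable_itv.
Qed.

End unif_dist.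

(** * Convergence in probability *)

Section assembly.
Variables (R : realType) (H : completeNormedModType R) (dot : {dot H for idfun}).
Hypothesis hilb : hilbert_norm dot.
Variables (C : {linear H -> H}) (phi : nat -> H) (lambda : nat -> R).
Hypothesis orth : forall i j, dot (phi i) (phi j) = (i == j)%:R.
Hypothesis lambda0 : forall j, 0 < lambda j.
Hypothesis eigC : forall j, C (phi j) = lambda j ^+ 2 *: phi j.
Context d (Omega : measurableType d) (P : probability Omega R).
Variables (xi : nat -> Omega -> H) (U : nat -> Omega -> R).
Hypothesis noise : pcn_noise P dot C xi U.
Variable s : R.
Hypothesis lambda_hs : lambda \in hs_mem s.
Variables (Psi : hs s -> R) (M tau : R) (xstar : H).
Hypothesis cPsi : continuous Psi.
Hypothesis Psi_lip : forall x y, `|Psi y - Psi x| <= M * (1 + `|x| + `|y|) * `|y - x|.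
Hypothesis M0 : 0 <= M.
Hypothesis tau0 : 0 < tau.
Hypothesis xstar_hs : in_hs dot phi s xstar.
Hypothesis xstar_qv : has_finite_qv dot phi lambda xstar.
Local Notation V0 := (qv dot phi lambda xstar).
Local Notation x delta w := (pcn_chain dot phi Psi tau delta xstar (xi ^~ w) (U ^~ w)).
Local Notation nacc delta w := (n_accepted dot phi Psi tau delta xstar (xi ^~ w) (U ^~ w)).
Local Notation rej := (rejected dot phi xi U Psi tau).

Lemma ae_chain_qv delta : 0 < delta -> delta < 2^-1 ->
  {ae P, forall w, forall k, has_finite_qv dot phi lambda (x delta w k) /\
    qv dot phi lambda (x delta w k) =
      tau + (V0 - tau) * (1 - 2 * delta) ^+ nacc delta w k}.
Proof.
move=> delta0 delta1; have qx0 := has_finite_qv_qcov xstar_qv.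
have h1 : {ae P, forall w, forall k, has_qcov dot phi lambda (xi k w) (xi k w) 1}.
  by apply: ae_foralln => k; exact: (ae_qcov_xi hilb orth lambda0 eigC noise).
have h2 : {ae P, forall w, forall k, has_qcov dot phi lambda xstar (xi k w) 0}.
  by apply: ae_foralln => k; exact: (ae_qcov_cst_xi hilb orth lambda0 eigC noise k qx0).
have h3 : {ae P, forall w, forall i k, (i < k)%N -> has_qcov dot phi lambda (xi i w) (xi k w) 0}.
  apply: ae_foralln => i; apply: ae_foralln => k.
  have [ik|ik] := boolP (i == k).
    by apply: filterE => w; rewrite (eqP ik) ltnn.
  by apply: filterS (ae_qcov_xi_xi hilb orth lambda0 eigC noise ik).
apply: filterS3 h1 h2 h3 => w q1 q2 q3 k; apply: has_qcov_qv.
by have [] := @chain_has_qcov _ _ _ _ _ _ Psi tau delta V0 xstar (xi ^~ w) (U ^~ w)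
  tau0 delta0 delta1 qx0 q1 q2 q3 k.
Qed.

Lemma n_accepted_rejected delta w k :
  (nacc delta w k <= k)%N /\
  k%:R - (nacc delta w k)%:R = \sum_(i < k) rej delta xstar w i.
Proof.
rewrite /n_accepted; elim: k => [|k [IH1 IH2]]; first by rewrite !big_ord0 subrr.
rewrite !big_ord_recr/= -IH2 /rejected /accepted.
set a := \sum_(i < k) _ in IH1 *; set al := pcn_accept _ _ _ _ _ _ _.
move: a IH1 {IH2} => a ak; have [_|_] := leP al (U k w).
  by rewrite addn0 leqW// -[k.+1]addn1 natrD; split => //; ring.
by rewrite addn1 ltnS; split => //; rewrite -[k.+1]addn1 -[a.+1]addn1 !natrD; ring.
Qed.

Section fixed_delta.
Variables (T delta : R) (v : R -> R).
Hypotheses (T0 : 0 < T) (delta0 : 0 < delta) (delta1 : delta < 2^-1).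
Hypothesis odev : ode_solution T tau V0 v.
Local Notation K := (Num.truncn (T / delta)).+1.
Local Notation D := `|V0 - tau|.
Local Notation X := (fun w => qv_interp dot phi lambda delta (x delta w)).

Lemma delta_le1 : delta <= 1.
Proof. by rewrite ltW// (lt_trans delta1)// invf_lt1// ltr1n. Qed.

Lemma grid_le : K%:R * delta <= T + delta.
Proof.
rewrite -addn1 natrD mulrDl mul1r lerD2r.
by have /andP[] := truncn_grid delta0 (ltW T0).
Qed.

(** The term delta (4 T + 6) collects the discretisation errors up to the end
    T + delta <= T + 1 of the last cell that meets [0, T]. *)
Lemma unif_dist_le w :
  (forall k, qv dot phi lambda (x delta w k) =
      tau + (V0 - tau) * (1 - 2 * delta) ^+ nacc delta w k) ->
  (unif_dist T (X w) v <=
    (D * (2 * delta * \sum_(i < K) rej delta xstar w i + delta * (4 * T + 6)))%:E)%E.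
Proof.
move=> qE; apply: ge_ereal_sup => _ [t tT <-]; rewrite lee_fin.
rewrite (ode_solutionE T0 odev tT).
move: tT; rewrite /= in_itv/= => /andP[t0 tT].
apply: (@interp_dist _ delta (fun k => qv dot phi lambda (x delta w k)) t) => // k kK tk; rewrite qE.
have [nk rk] := n_accepted_rejected delta w k.
have -> (p q : R) : tau + (V0 - tau) * p - (tau + (V0 - tau) * q) = (V0 - tau) * (p - q) by ring.
rewrite normrM ler_wpM2l//.
apply: le_trans (pow_exp_dist delta0 delta1 nk t0 tk) _.
have kK' : (k <= K)%N.
  apply: (leq_trans kK); rewrite ltnS truncn_ge_nat; last by rewrite divr_ge0// ltW.
  apply: (@le_trans _ _ (t / delta)); first by rewrite truncn_le divr_ge0// ltW.
  by rewrite ler_pM2r// invr_gt0.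
have hs : \sum_(i < k) rej delta xstar w i <= \sum_(i < K) rej delta xstar w i.
  rewrite -(big_mkord xpredT (rej delta xstar w)) -[leRHS](big_mkord xpredT (rej delta xstar w)).
  rewrite [leRHS](big_cat_nat (n := k))//= lerDl sumr_ge0// => i _.
  exact: rejected_ge0.
have hk : k%:R * delta <= T + delta.
  by apply: le_trans grid_le; rewrite ler_wpM2r ?(ltW delta0)// ler_nat.
rewrite rk -addrA; apply: lerD; first by rewrite ler_wpM2l// mulr_ge0// ltW.
have := ler_wpM2l (ltW delta0) hk; move: (delta * (k%:R * delta)) (k%:R * delta) => p q.
have dd : delta * delta <= delta by rewrite ler_piMr ?(ltW delta0)//; exact: delta_le1.
nra.
Qed.

Lemma continuous_qv_interp_chain w : {within `[0, T], continuous (X w)}.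
Proof.
have := @continuous_interp _ delta (fun k => qv dot phi lambda (x delta w k)) T delta0 T0.
exact.
Qed.

Lemma measurable_qv_interp_chain t : measurable_fun setT ((fun w => X w t) : Omega -> R).
Proof.
apply: measurable_qv_interp => k; exact: (measurable_pcn_chain hilb phi noise tau delta xstar cPsi k).
Qed.

Local Notation G := (growth_cst dot phi lambda s M tau xstar).

(** Markov's inequality for the number of rejections, eps / 2 being set aside for
    the discretisation error. *)
Lemma prob_unif_dist_gt (eps : R) : 0 < eps -> delta * (4 * T + 6) * D <= eps / 2 ->
  (P [set w | (eps%:E < unif_dist T (X w) v)%E] <=
   (4 * D / eps * (T + 1) * (G * expR (G * (T + 1))) * Num.sqrt delta)%:E)%E.
Proof.
move=> eps0 deps.
have [_ cv _] := odev.
have mE : measurable [set w | (eps%:E < unif_dist T (X w) v)%E].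
  by apply: measurable_unif_dist_gt => //; [exact: continuous_qv_interp_chain|move=> t _; exact: measurable_qv_interp_chain].
set E := [set w | _] in mE *.
have c0 : 0 <= 4 * D * delta / eps by rewrite divr_ge0 ?(ltW eps0)// !mulr_ge0// ltW.
have mr i : measurable_fun setT (fun w => (rej delta xstar w i)%:E).
  by apply/measurable_EFinP; exact: (measurable_rejected hilb phi noise).
have r0 i w : (0 <= (rej delta xstar w i)%:E)%E by rewrite lee_fin rejected_ge0.
have s0 w : (0 <= \sum_(i < K) (rej delta xstar w i)%:E)%E.
  by apply: sume_ge0.
have ms : measurable_fun setT (fun w => (\sum_(i < K) (rej delta xstar w i)%:E)%E).
  by apply: emeasurable_sum => i.
apply: (@le_trans _ _ (\int[P]_w ((4 * D * delta / eps)%:E *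
    \sum_(i < K) (rej delta xstar w i)%:E))%E).
  rewrite -[X in P X]setIT -integral_indic//.
  apply: ae_ge0_le_integral => //.
  - by apply/measurable_EFinP; exact: measurable_indic.
  - by move=> w _; rewrite mule_ge0// lee_fin.
  - exact: measurable_funeM.
  apply: filterS (ae_chain_qv delta0 delta1) => w qw _.
  rewrite sumEFin -EFinM lee_fin indicE.
  have S0 : 0 <= \sum_(i < K) rej delta xstar w i.
    by apply: sumr_ge0 => i _; exact: rejected_ge0.
  have [wE|wE] := boolP (w \in E); last by rewrite mulr_ge0.
  have := unif_dist_le (fun k => (qw k).2).
  move: wE; rewrite inE /E /= => /lt_le_trans h /h; rewrite lte_fin.
  move: (\sum_(i < K) _) S0 => S S0 hS.
  rewrite mulrAC ler_pdivlMr//= mul1r; nra.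
rewrite ge0_integralZl_EFin// ge0_integral_sum//.
have G0 : 0 <= G by exact: growth_cst_ge0.
have q0 : 0 <= G * expR (G * (T + 1)) * Num.sqrt delta.
  by apply: mulr_ge0; [rewrite mulr_ge0// expR_ge0|exact: sqrtr_ge0].
apply: (@le_trans _ _ ((4 * D * delta / eps)%:E *
    \sum_(i < K) (G * expR (G * (T + 1)) * Num.sqrt delta)%:E)%E).
  apply: lee_wpmul2l; first by rewrite lee_fin.
  apply: lee_sum => i _.
  apply: (le_trans (integral_rejected_le hilb orth lambda0 eigC noise lambda_hs cPsi Psi_lip M0 tau0 delta0 delta1 xstar_hs i)).
  rewrite lee_fin mulrAC ler_wpM2r ?sqrtr_ge0//; apply: ler_wpM2l => //.
  rewrite ler_expR -mulrA; apply: ler_wpM2l => //; rewrite mulrC.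
  apply: le_trans (_ : K%:R * delta <= _); first by rewrite ler_wpM2r ?(ltW delta0)// ler_nat ltnW.
  by apply: (le_trans grid_le); rewrite lerD2l; exact: delta_le1.
rewrite sumEFin -EFinM lee_fin sumr_const card_ord -[leRHS]mulrA.
have KT : K%:R * delta <= T + 1 by apply: (le_trans grid_le); rewrite lerD2l; exact: delta_le1.
have De0 : 0 <= 4 * D / eps by rewrite divr_ge0 ?(ltW eps0)// mulr_ge0.
move: (G * _ * Num.sqrt delta) q0 => Q Q0; rewrite -(mulr_natl Q).
have -> : 4 * D * delta / eps * (K%:R * Q) = 4 * D / eps * (K%:R * delta) * Q by ring.
by apply: ler_wpM2r => //; exact: ler_wpM2l.
Qed.

End fixed_delta.
End assembly.

Theorem theorem15
  (R : realType) (H : completeNormedModType R) (dot : {dot H for idfun})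
  (C : {linear H -> H}) (phi : nat -> H) (lambda : nat -> R)
  (kappa s : R) (Psi : hs s -> R) (gradPsi : hs s -> hs (- s))
  (d : measure_display) (Omega : measurableType d) (P : probability Omega R)
  (xi : nat -> Omega -> H) (U : nat -> Omega -> R)
  (tau T : R) (xstar : H) (v : R -> R) :
  hilbert_norm dot ->
  orthonormal_basis dot phi ->
  positive_selfadjoint dot C ->
  trace_class dot phi C ->
  (forall j, 0 < lambda j) ->
  (forall j, C (phi j) = lambda j ^+ 2 *: phi j) ->
  1 / 2 < kappa ->
  asymp lambda (fun j => j.+1%:R `^ (- kappa)) ->
  0 <= s < kappa - 1 / 2 ->
  quadratic_growth Psi ->
  derivative_bounds Psi gradPsi ->
  pcn_noise P dot C xi U ->
  0 < tau ->
  0 < T ->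
  in_hs dot phi s xstar ->
  has_finite_qv dot phi lambda xstar ->
  ode_solution T tau (qv dot phi lambda xstar) v ->
  let x (delta : R) (w : Omega) : nat -> H :=
    pcn_chain dot phi Psi tau delta xstar (xi ^~ w) (U ^~ w) in
  (forall delta : R, 0 < delta < 1 / 2 ->
     {ae P, forall w, forall k, has_finite_qv dot phi lambda (x delta w k)}) /\
  C_cvg_in_probability P T
    (fun delta w => qv_interp dot phi lambda delta (x delta w)) v.
Proof.
move=> hilb [orth _] _ _ lambda0 eigC _ lambda_asymp /andP[_ skappa] _.
move=> [grad _ [M gradM] _] noise tau0 T0 xstar_hs xstar_qv odev x.
have lambda_hs := hs_mem_asymp lambda0 lambda_asymp skappa.
have M0 : 0 <= M.
  have := gradM 0; rewrite normr0 addr0 mulr1; apply: le_trans; exact: normr_ge0.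
have Psi_lip := lipschitz_of_gradient grad gradM.
have cPsi : continuous Psi.
  by move=> y; apply: differentiable_continuous; have [] := grad y.
have half : 1 / 2 = 2^-1 :> R by rewrite div1r.
split=> [delta /andP[delta0]|].
  rewrite half => delta1.
  have := ae_chain_qv hilb orth lambda0 eigC noise Psi tau0 xstar_qv delta0 delta1.
  by apply: filterS => w h k; have [] := h k.
have h2 : (0 : R) < 2^-1 by rewrite invr_gt0.
have near_small : \forall delta \near (0 : R)^'+, 0 < delta < 2^-1.
  near=> delta; apply/andP; split; near: delta.
    exact: nbhs_right_gt.
  exact: nbhs_right_lt.
split.
  near=> delta.
  have /andP[delta0 delta1] : 0 < delta < 2^-1 by near: delta.
  split=> [w|t _].
    exact: continuous_qv_interp_chain.
  apply: measurable_qv_interp_chain; [exact: hilb|exact: noise|exact: cPsi].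
move=> eps eps0.
set D := `|qv dot phi lambda xstar - tau|.
set G := growth_cst dot phi lambda s M tau xstar.
set c := 4 * D / eps * (T + 1) * (G * expR (G * (T + 1))).
have E0 : 0 < (4 * T + 6) * (D + 1).
  have T6 : 0 < 4 * T + 6 by lra.
  by apply: mulr_gt0 => //; apply: ltr_wpDl; rewrite ?normr_ge0.
apply: (@squeeze_cvge _ _ _ _ (cst 0%E) _ (fun delta => (c * Num.sqrt delta)%:E)).
- near=> delta.
  have /andP[delta0 delta1] : 0 < delta < 2^-1 by near: delta.
  rewrite measure_ge0/=.
  apply: (prob_unif_dist_gt hilb orth lambda0 eigC noise lambda_hs cPsi Psi_lip M0 tau0 xstar_hs xstar_qv T0 delta0 delta1 odev eps0).
  have : delta < eps / 2 / ((4 * T + 6) * (D + 1)).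
    near: delta; apply: nbhs_right_lt; apply: divr_gt0 => //.
    exact: divr_gt0.
  rewrite ltr_pdivlMr// => /ltW; apply: le_trans.
  rewrite -/D -mulrA ler_pM2l//; apply: ler_wpM2l; first lra.
  by rewrite lerDl.
- exact: cvg_cst.
- have c0 : c * Num.sqrt delta @[delta --> (0 : R)] --> c * Num.sqrt 0.
    by apply: cvgM; [exact: cvg_cst|exact: sqrt_continuous].
  rewrite sqrtr0 mulr0 in c0.
  apply: cvg_EFin; first exact: nearW.
  exact: cvg_at_right_filter c0.
Unshelve. all: by end_near.
Qed.
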